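(* There are absolute constants $C\ge 1$ and $c>0$ with the following property. For every finite simple graph $G$ on $n\ge2$ vertices with degree sequence $d_1,\dots,d_n$ and every set $S$ of at least $n^C$ points in general position in the plane, there is a drawing of $G$ on $S$ with at most $c\log n\,\big(\mathrm{pcr}(G)+\sum_{k=1}^n d_k^2\big)$ crossings.
   Context: A set of points is in general position if no three are collinear. For a planar point set $S$ in general position and a graph $G$ with at most $|S|$ vertices, a drawing of $G$ on $S$ maps the vertices injectively to points of $S$ and represents each edge by the straight segment between the images of its endpoints. The pair crossing number $\mathrm{pcr}(G)$ is the minimum, over all drawings of $G$ (vertices to distinct points, edges to simple curves joining their endpoints avoiding other vertices, any two curves sharing finitely many points, no tangencies, no three curves through a common point), of the number of unordered pairs of edges that cross. Logarithms are base 2. *)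

(* Defs.v *)
From mathcomp Require Import all_boot all_order all_algebra finmap.
From mathcomp Require Import all_classical all_reals all_analysis.

Set Implicit Arguments.
Unset Strict Implicit.
Unset Printing Implicit Defensive.

Import Order.TTheory GRing.Theory Num.Theory.
Import numFieldNormedType.Exports.

Local Open Scope classical_set_scope.
Local Open Scope ring_scope.

Section PlaneGeometry.
Variable R : realType.
Implicit Types (p q r : R * R) (A B S : set (R * R)).

Definition collinear p q r : Prop :=
  exists a b c : R, (a, b) != (0, 0) /\
    forall z, z \in [:: p; q; r] -> a * z.1 + b * z.2 = c.

Definition general_position S : Prop :=
  forall p q r, S p -> S q -> S r -> uniq [:: p; q; r] -> ~ collinear p q r.

(* S may be infinite. *)
Definition at_least_points (x : R) S : Prop :=
  exists2 F : {fset R * R}, [set` F] `<=` S & x <= (#|` F|)%:R.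

Definition segment p q : set (R * R) :=
  [set ((1 - t) * p.1 + t * q.1, (1 - t) * p.2 + t * q.2) | t in `[0, 1]].

(* Curves are identified with their point sets, so that the curve representing
   an undirected edge needs no orientation. *)
Definition simple_curve p q A : Prop :=
  exists g : R -> R * R,
    [/\ {within `[0, 1], continuous g},
        {in `[0, 1] &, injective g},
        g 0 = p, g 1 = q & A = g @` `[0, 1]].

(* At p the two curves cross rather than touch: near p, the pair (A, B) is
   homeomorphic (by h, with inverse g) to the pair of coordinate axes near
   the origin. *)
Definition proper_crossing A B p : Prop :=
  exists (U W : set (R * R)) (h g : R * R -> R * R),
    [/\ open U, open W, U p & h p = (0, 0)] /\
    [/\ h @` U = W, {in U, cancel h g},
        {within U, continuous h} & {within W, continuous g}] /\
    (forall z, U z -> (A z <-> (h z).2 = 0) /\ (B z <-> (h z).1 = 0)).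

End PlaneGeometry.

(* A finite simple graph is a symmetric irreflexive relation on a finType. *)
Section Graphs.
Variables (V : finType) (adj : rel V).

Definition edges : {set {set V}} :=
  [set e : {set V} | [exists u, exists v, adj u v && (e == [set u; v])]]%SET.

Definition degree (v : V) : nat := #|[set w | adj v w]%SET|.

End Graphs.

(* The value of dcurve on vertex sets that are not edges is irrelevant. *)
Record drawing (R : realType) (V : finType) := Drawing {
  dpos : V -> R * R;
  dcurve : {set V} -> set (R * R)
}.

Section Drawings.
Variables (R : realType) (V : finType) (adj : rel V).
Implicit Types (D : drawing R V) (e f : {set V}).

Definition edges_cross D e f : Prop :=
  exists p, [/\ dcurve D e p, dcurve D f p & ~ range (dpos D) p].

Definition crossing_pairs D : {set {set {set V}}} :=
  [set P : {set {set V}} | `[< exists e f,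
     [/\ e \in edges adj, f \in edges adj, e != f, P = [set e; f]%SET
       & edges_cross D e f] >]]%SET.

Definition pair_crossings D : nat := #|crossing_pairs D|.

(* Curves meeting at a common end vertex are exempt from the last two
   requirements. *)
Definition topological_drawing D : Prop :=
  [/\ injective (dpos D),
      (forall u v, adj u v ->
         simple_curve (dpos D u) (dpos D v) (dcurve D [set u; v]%SET)) &
      (forall u v w, adj u v -> dcurve D [set u; v]%SET (dpos D w) ->
         w \in [set u; v]%SET)] /\
  [/\ (forall e f, e \in edges adj -> f \in edges adj -> e != f ->
         finite_set (dcurve D e `&` dcurve D f)),
      (forall e f p, e \in edges adj -> f \in edges adj -> e != f ->
         dcurve D e p -> dcurve D f p -> ~ range (dpos D) p ->
         proper_crossing (dcurve D e) (dcurve D f) p) &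
      (forall e f g p,
         e \in edges adj -> f \in edges adj -> g \in edges adj ->
         uniq [:: e; f; g] ->
         dcurve D e p -> dcurve D f p -> dcurve D g p -> range (dpos D) p)].

Definition straight_drawing_on (S : set (R * R)) D : Prop :=
  [/\ injective (dpos D), (forall v, S (dpos D v)) &
      forall u v, adj u v ->
        dcurve D [set u; v]%SET = segment (dpos D u) (dpos D v)].

End Drawings.

Definition is_pcr (R : realType) (V : finType) (adj : rel V) (k : nat) : Prop :=
  (exists2 D : drawing R V, topological_drawing adj D
     & pair_crossings adj D = k) /\
  (forall D : drawing R V, topological_drawing adj D ->
     (k <= pair_crossings adj D)%N).

Definition pcr (R : realType) (V : finType) (adj : rel V) : nat :=
  xget 0%N [set k | is_pcr R adj k].

(* The default value in pcr is never used for a graph that has a drawing. *)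
Lemma pcrP (R : realType) (V : finType) (adj : rel V) (D : drawing R V) :
  topological_drawing adj D -> is_pcr R adj (pcr R adj).
Proof.
move=> hD; rewrite /pcr; case: xgetP => [k _ //|noP]; exfalso.
pose P k := `[< exists2 D : drawing R V, topological_drawing adj D
                  & pair_crossings adj D = k >].
have exP : exists k, P k by exists (pair_crossings adj D); apply/asboolP; exists D.
case: (ex_minnP exP) => m /asboolP Pm mmin.
apply: (noP m); split=> // D' hD'; apply: mmin; apply/asboolP; by exists D'.
Qed.

Definition log2 (R : realType) (x : R) : R := ln x / ln 2.

(* Main.v *)
(* The curves of a topological drawing with pcr(G) crossing pairs touch in m pairs,
   m = O(pcr(G) + sum d_k^2), counting pairs with a common end vertex.  By Lee's
   separator theorem for string graphs, deleting O(sqrt m) curves leaves only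
   connected pieces carrying at most 2m/3 of the touching pairs, so the remaining
   edges split, on disjoint sets of vertices, into two classes with at most 2m/3
   touching pairs each; four rounds of this give 16 classes with at most 16m/81
   touching pairs each.

   Any large point set in general position contains 16 proportionally large clusters
   such that no line meets the convex hulls of three of them.  Put each class,
   recursively, into a cluster of its own.  If a line meets O(sqrt m') edges of a
   class with m' touching pairs, then, as 2 sqrt(16/81) < 1, it meets O(sqrt m) edges altogether.  Hence
   the O(sqrt m) deleted edges account for O(m) crossings, and edges of different
   classes do not cross.  The recursion has depth O(log n).

   The separator theorem: join every two touching pairs by a path of curves so as to
   minimize the weighted sum of the squared congestions.  As K_{3,3} is not planar,
   this sum is large, so in the metric given by the congestion the curves are far
   apart on average.  Three rounds of chopping along distance levels (Klein,
   Plotkin and Rao), where again K_{3,3} is excluded, leave pieces of small diameter;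
   a piece carrying most of the touching pairs is then cut by a cheap distance level
   around it. *)

Require Import Defs.
From mathcomp Require Import all_boot all_order all_algebra finmap.
From mathcomp Require Import all_classical all_reals all_analysis.
From mathcomp Require Import zify ring lra.

Set Implicit Arguments.
Unset Strict Implicit.
Unset Printing Implicit Defensive.

Import Order.TTheory GRing.Theory Num.Theory.
Import numFieldNormedType.Exports.

Local Open Scope classical_set_scope.

(** * Connected sets of lattice points *)

(** The separator has to balance touching pairs, not curves, so every string is weighted by the
    number of strings that it touches; it touches itself, which keeps all weights positive. The
    Jordan curve theorem is avoided: which of finitely many compact connected sets meet is preserved
    on passing to the lattice points near them, and on the lattice the nonplanarity of K_{3,3} is a
    parity count of unit steps. Squared congestion is a suitable cost because it bounds the number
    of touching pairs of paths through 2xy <= x^2 + y^2, while local optimality bounds the cost of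
    each path by a distance. Four is the least number k of rounds with 2 (2/3)^(k/2) < 1, which lets
    the bound on the edges met by a line reproduce itself in the recursion. Edges with a common end
    touch, so the pieces left by a separator have disjoint vertex sets; sum d_k^2 pays for the
    touching pairs that this adds. *)

Section Connection.
Variables (T : Type) (r : T -> T -> Prop).

Inductive conn (A : set T) : T -> T -> Prop :=
| conn_refl z of A z : conn A z z
| conn_step z w u of conn A z w & r w u & A u : conn A z u.

Lemma conn_memr A z w : conn A z w -> A w.
Proof. by case. Qed.

Lemma conn_meml A z w : conn A z w -> A z.
Proof. by elim. Qed.

Lemma conn_trans A z w u : conn A z w -> conn A w u -> conn A z u.
Proof.
by move=> zw wu; elim: wu zw => // {}w v {}u _ IH vu Au /IH zv; exact: conn_step zv vu Au.
Qed.

Lemma conn_sub A B z w : A `<=` B -> conn A z w -> conn B z w.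
Proof.
move=> AB; elim=> [{}z /AB|{}z {}w u _ zw wu /AB Bu]; first exact: conn_refl.
exact: conn_step zw wu Bu.
Qed.

Lemma conn_sym (rsym : forall z w, r z w -> r w z) A z w : conn A z w -> conn A w z.
Proof.
elim=> [{}z Az|{}z {}w u zw IH wu Au]; first exact: conn_refl.
apply: conn_trans IH; apply: conn_step (conn_refl Au) (rsym _ _ wu) _.
exact: conn_memr zw.
Qed.

Lemma conn_inner A z w : conn A z w -> conn (conn A z) z w.
Proof.
elim=> [{}z Az|{}z {}w u zw IH wu Au]; first exact/conn_refl/conn_refl.
apply: (conn_step IH wu); exact: conn_step zw wu Au.
Qed.

Lemma conn_exit A (G : set T) z w : conn A z w -> G z ->
  conn (A `&` G) z w \/
  exists c0 c1, [/\ conn (A `&` G) z c0, r c0 c1, A c1 & ~ G c1].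
Proof.
elim=> [{}z Az Gz|{}z {}w u zw IH wu Au Gz]; first by left; apply: conn_refl.
have [{}zw|] := IH Gz; last by right.
have [Gu|nGu] := pselect (G u); first by left; apply: conn_step zw wu _.
by right; exists w, u.
Qed.

(* For connected sets touching only when they represent adjacent edges, this
   is the nonplanarity of K_{3,3}. *)
Definition K33_free :=
  forall (a b : 'I_3 -> T) (E : 'I_3 -> 'I_3 -> set T),
    (forall i j, conn (E i j) (b i) (a j)) ->
    exists i j i' j', [/\ i != i', j != j' & E i j `&` E i' j' !=set0].

End Connection.

(** * Crossing parities of lattice walks and the nonplanarity of K_{3,3} *)

Section Lattice.
Local Open Scope ring_scope.
Let Z2 := (int * int)%type.
Implicit Types (z w u p : Z2) (s t : Z2 * Z2) (c d : seq (Z2 * Z2)).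

Definition lat_adj z w : bool :=
  (z.1 == w.1) && ((z.2 == w.2 + 1) || (w.2 == z.2 + 1)) ||
  (z.2 == w.2) && ((z.1 == w.1 + 1) || (w.1 == z.1 + 1)).

Lemma lat_adj_sym z w : lat_adj z w -> lat_adj w z.
Proof. by rewrite /lat_adj; lia. Qed.

(* Along a unit step the function x - y changes by one. *)
Let lo_end s : Z2 := if s.1.1 - s.1.2 < s.2.1 - s.2.2 then s.1 else s.2.
Let hi_end s : Z2 := if s.1.1 - s.1.2 < s.2.1 - s.2.2 then s.2 else s.1.
Let horizontal s : bool := s.1.2 == s.2.2.

Let steps c := {in c, forall s, lat_adj s.1 s.2}.
Let runs c z w := forall g : Z2 -> bool,
  \big[addb/false]_(s <- c) (g s.1 (+) g s.2) = g z (+) g w.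

Let conn_steps (A : set Z2) z w : conn lat_adj A z w ->
  exists c, [/\ steps c, runs c z w & forall s, s \in c -> A s.1 /\ A s.2].
Proof.
elim=> [{}z Az|{}z {}w u zw [c [cs cr cA]] wu Au].
  by exists nil; split=> // g; rewrite big_nil addbb.
exists ((w, u) :: c); split.
- by move=> s; rewrite inE => /orP[/eqP->|/cs].
- by move=> g; rewrite big_cons cr /=; case: (g z); case: (g w); case: (g u).
- by move=> s; rewrite inE => /orP[/eqP->|/cA] //; split=> //; apply: conn_memr zw.
Qed.

(* The step s meets the step t after t is translated by (1/2, 1/2). *)
Let cross s t : bool :=
  (horizontal s && ~~ horizontal t && (lo_end s == lo_end t)) (+)
  (~~ horizontal s && horizontal t && (hi_end s == hi_end t)).

Let crossings c d := \big[addb/false]_(s <- c) \big[addb/false]_(t <- d) cross s t.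

Let above p s : bool :=
  [&& horizontal s, (lo_end s).1 == p.1 & p.2 < (lo_end s).2].

(* The winding parity of a closed c around the face with lower left corner p. *)
Let index c p := \big[addb/false]_(s <- c) above p s.

Let stepP z w : lat_adj z w ->
  exists k l : int, [\/ z = (k, l) /\ w = (k + 1, l), z = (k + 1, l) /\ w = (k, l),
     z = (k, l) /\ w = (k, l + 1) | z = (k, l + 1) /\ w = (k, l)].
Proof.
case: z w => [a b] [a' b'] /orP[] /= /andP[/eqP-> /orP[] /eqP->].
- by exists a', b'; constructor 4.
- by exists a', b; constructor 3.
- by exists a', b'; constructor 2.
- by exists a, b'; constructor 1.
Qed.

Let ends_hor (k l : int) :
  [/\ lo_end ((k, l), (k + 1, l)) = (k, l), hi_end ((k, l), (k + 1, l)) = (k + 1, l),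
      lo_end ((k + 1, l), (k, l)) = (k, l) & hi_end ((k + 1, l), (k, l)) = (k + 1, l)].
Proof.
rewrite /lo_end /hi_end /=.
have -> : (k - l < k + 1 - l) = true by lia.
by have -> : (k + 1 - l < k - l) = false by lia.
Qed.

Let ends_ver (k l : int) :
  [/\ lo_end ((k, l), (k, l + 1)) = (k, l + 1), hi_end ((k, l), (k, l + 1)) = (k, l),
      lo_end ((k, l + 1), (k, l)) = (k, l + 1) & hi_end ((k, l + 1), (k, l)) = (k, l)].
Proof.
rewrite /lo_end /hi_end /=.
have -> : (k - l < k - (l + 1)) = false by lia.
by have -> : (k - (l + 1) < k - l) = true by lia.
Qed.

(** The translate of [t] joins the centres of the faces at its two ends, so every crossing with [c]
    switches the winding parity. *)
Let step_index c z : steps c -> runs c z z ->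
  forall t, lat_adj t.1 t.2 ->
  \big[addb/false]_(s <- c) cross s t = index c t.1 (+) index c t.2.
Proof.
move=> cs cr [u w] /= /stepP [k [l tE]].
pose g p := (p.1 == k + 1) && (l < p.2).
rewrite /index -big_split /=.
have [hor|ver] : ((u, w) = ((k, l), (k + 1, l)) \/ (u, w) = ((k + 1, l), (k, l))) \/
   ((u, w) = ((k, l), (k, l + 1)) \/ (u, w) = ((k, l + 1), (k, l))).
  case: tE => [[-> ->]|[-> ->]|[-> ->]|[-> ->]]; [left;left|left;right|right;left|right;right]; by [].
(* The upward rays at the ends of a horizontal [t] lie in adjacent columns. The closed [c] enters or
   leaves the vertical half-line above [(k + 1, l)] an even number of times; after adding this count
   the identity holds step by step. *)
- have -> : \big[addb/false]_(s <- c) cross s (u, w) =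
     \big[addb/false]_(s <- c) cross s (u, w) (+)
     \big[addb/false]_(s <- c) (g s.1 (+) g s.2) by rewrite cr addbb addbF.
  rewrite -big_split; apply: eq_big_seq => s /cs {cs cr}.
  case: s => [a b] /= /stepP [i [j sE]].
  have [h1 h2 h3 h4] := ends_hor k l; have [i1 i2 i3 i4] := ends_hor i j.
  have [j1 j2 j3 j4] := ends_ver i j.
  case: hor => [[-> ->]|[-> ->]]; case: sE => [[-> ->]|[-> ->]|[-> ->]|[-> ->]];
  rewrite /cross /above ?h1 ?h2 ?h3 ?h4 ?i1 ?i2 ?i3 ?i4 ?j1 ?j2 ?j3 ?j4
    /horizontal /g !xpair_eqE /=; lia.
- apply: eq_big_seq => s /cs {cs cr}.
  case: s => [a b] /= /stepP [i [j sE]].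
  have [h1 h2 h3 h4] := ends_ver k l; have [i1 i2 i3 i4] := ends_hor i j.
  have [j1 j2 j3 j4] := ends_ver i j.
  case: ver => [[-> ->]|[-> ->]]; case: sE => [[-> ->]|[-> ->]|[-> ->]|[-> ->]];
  rewrite /cross /above ?h1 ?h2 ?h3 ?h4 ?i1 ?i2 ?i3 ?i4 ?j1 ?j2 ?j3 ?j4
    /horizontal !xpair_eqE /=; lia.
Qed.

Let crossings_closed c d z p q : steps c -> runs c z z -> steps d -> runs d p q ->
  crossings c d = index c p (+) index c q.
Proof.
move=> cs cr ds dr; rewrite -dr /crossings exchange_big /=.
by apply: eq_big_seq => t /ds; exact: step_index cs cr t.
Qed.

(** Interchanging [s] and [t] reverses the shift by (1/2, 1/2), so the two counts can differ only at
    common vertices. Hence the total asymmetry in [crossings_sym] depends only on visits to the ends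
    of the walks. *)
Let cross_sym s t : lat_adj s.1 s.2 -> lat_adj t.1 t.2 ->
  cross s t (+) cross t s = (lo_end s == lo_end t) (+) (hi_end s == hi_end t).
Proof.
case: s t => [a b] [u w] /= /stepP [i [j sE]] /stepP [k [l tE]].
have [h1 h2 h3 h4] := ends_hor k l; have [i1 i2 i3 i4] := ends_hor i j.
have [j1 j2 j3 j4] := ends_ver i j; have [k1 k2 k3 k4] := ends_ver k l.
case: tE => [[-> ->]|[-> ->]|[-> ->]|[-> ->]]; case: sE => [[-> ->]|[-> ->]|[-> ->]|[-> ->]];
rewrite /cross ?h1 ?h2 ?h3 ?h4 ?i1 ?i2 ?i3 ?i4 ?j1 ?j2 ?j3 ?j4 ?k1 ?k2 ?k3 ?k4
  /horizontal !xpair_eqE /=; lia.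
Qed.

Let los c p := \big[addb/false]_(s <- c) (lo_end s == p).
Let his c p := \big[addb/false]_(s <- c) (hi_end s == p).

Let los_his c z w p : runs c z w -> los c p (+) his c p = (z == p) (+) (w == p).
Proof.
move=> /(_ (fun u => u == p)) <-; rewrite /los /his -big_split; apply: eq_bigr => s _.
by rewrite /lo_end /hi_end; case: ifP => _ //; rewrite addbC.
Qed.

Let crossings_sym c d z w p q : steps c -> runs c z w -> steps d -> runs d p q ->
  crossings c d (+) crossings d c =
  (los c p (+) los c q) (+) (his d z (+) his d w).
Proof.
move=> cs cr ds dr.
have -> : crossings d c = \big[addb/false]_(s <- c) \big[addb/false]_(t <- d) cross t s.
  by rewrite /crossings exchange_big.
rewrite /crossings -big_split /=.
transitivity (\big[addb/false]_(s <- c) \big[addb/false]_(t <- d)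
    ((lo_end s == lo_end t) (+) (hi_end s == hi_end t))).
  apply: eq_big_seq => s /cs sa; rewrite -big_split; apply: eq_big_seq => t /ds ta.
  exact: cross_sym.
rewrite exchange_big /=.
transitivity (\big[addb/false]_(t <- d)
    ((los c t.1 (+) los c t.2) (+) ((z == hi_end t) (+) (w == hi_end t)))).
  apply: eq_bigr => t _; rewrite big_split /= -/(los c (lo_end t)) -/(his c (hi_end t)).
  have -> : his c (hi_end t) = los c (hi_end t) (+) (los c (hi_end t) (+) his c (hi_end t)).
    by rewrite addbA addbb addFb.
  rewrite (los_his _ cr) addbA; congr (_ (+) _).
  by rewrite /lo_end /hi_end; case: ifP => _ //; rewrite addbC.
rewrite big_split /= dr; congr (_ (+) _); rewrite big_split /=.
by congr (_ (+) _); apply: eq_bigr => t _; rewrite eq_sym.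
Qed.

Let crossings_disjoint c d : steps c -> steps d ->
  (forall s t, s \in c -> t \in d ->
     [/\ s.1 != t.1, s.1 != t.2, s.2 != t.1 & s.2 != t.2]) -> crossings c d = false.
Proof.
move=> _ _ dis; rewrite /crossings big_seq big1 // => s sc.
rewrite big_seq big1 // => t td; have [h1 h2 h3 h4] := dis _ _ sc td.
rewrite /cross /lo_end /hi_end; do 2 case: ifP => _;
by rewrite ?(negbTE h1) ?(negbTE h2) ?(negbTE h3) ?(negbTE h4) !andbF.
Qed.

Let los0 c p : (forall s, s \in c -> (s.1 != p) && (s.2 != p)) ->
  (los c p = false) * (his c p = false).
Proof.
move=> h; rewrite /los /his; split; rewrite big_seq big1 // => s /h /andP[h1 h2];
by rewrite /lo_end /hi_end; case: ifP => _; apply/negbTE.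
Qed.

(* The three walks b_i -> a_1 -> ... -> a_2 form a theta graph, each of whose
   cycles avoids the walk from the third b_k to a_3; adding up the winding
   parities of the three cycles around the three b_k, which depend only on
   crossings near a_1, gives an odd number. *)
Theorem lattice_K33_free : K33_free lat_adj.
Proof.
move=> a b E Econn; apply: contrapT => noE.
have dis i j i' j' z : i != i' -> j != j' -> E i j z -> ~ E i' j' z.
  by move=> ii jj h1 h2; apply: noE; exists i, j, i', j'; split=> //; exists z.
have /choice [f fP] (x : 'I_3 * 'I_3) : exists c, [/\ steps c, runs c (b x.1) (a x.2) &
    forall s, s \in c -> E x.1 x.2 s.1 /\ E x.1 x.2 s.2].
  exact: conn_steps (Econn x.1 x.2).
pose P i j := f (i, j).
have Ps i j : steps (P i j) by have [] := fP (i, j).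
have Pr i j : runs (P i j) (b i) (a j) by have [] := fP (i, j).
have PE i j s : s \in P i j -> E i j s.1 /\ E i j s.2.
  by have [_ _ h] := fP (i, j); exact: h.
have cr0 i j i' j' : i != i' -> j != j' -> crossings (P i j) (P i' j') = false.
  move=> ii jj; apply: crossings_disjoint => // s t /PE [h1 h2] /PE [h3 h4].
  by split; apply/eqP => e; [move: h1|move: h1|move: h2|move: h2]; rewrite e;
    move=> h; exact: (dis i j i' j' _ ii jj h).
have Eb i j : E i j (b i) by exact: conn_meml (Econn i j).
have Ea i j : E i j (a j) by exact: conn_memr (Econn i j).
pose j1 : 'I_3 := inord 0; pose j2 : 'I_3 := inord 1; pose j3 : 'I_3 := inord 2.
have [j12 j13 j23] : [/\ j1 != j2, j1 != j3 & j2 != j3].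
  by split; apply/eqP => /(congr1 (@nat_of_ord 3)); rewrite !inordK.
have j32 : j3 != j2 by rewrite eq_sym.
have j21 : j2 != j1 by rewrite eq_sym.
have j31 : j3 != j1 by rewrite eq_sym.
have bavoid i i' s : i != i' -> s \in P i j1 -> (s.1 != b i') && (s.2 != b i').
  move=> ii /PE [h1 h2]; apply/andP; split; apply/eqP => e;
  [move: h1 | move: h2]; rewrite e => h; exact: (dis i j1 i' j2 _ ii j12 h).
have ba i : b i != a j1.
  pose i' : 'I_3 := if i == j1 then j2 else j1.
  have ii : i != i' by rewrite /i'; case: (eqVneq i j1) => [->|].
  apply/eqP => e; have := Eb i j2; rewrite e => h.
  by apply: (dis i j2 i' j1 _ ii _ h) => //; rewrite eq_sym.
pose l i := los (P i j1) (a j1).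
(* Neither walk visits the start of the other, so the asymmetry is decided at the common end
   [a j1]. *)
have lam i i' : i != i' ->
    crossings (P i j1) (P i' j1) (+) crossings (P i' j1) (P i j1) = ~~ (l i (+) l i').
  move=> ii; rewrite (crossings_sym (Ps _ _) (Pr _ _) (Ps _ _) (Pr _ _)).
  have i'i : i' != i by rewrite eq_sym.
  rewrite (los0 (fun s => bavoid i i' s ii)) (los0 (fun s => bavoid i' i s i'i)).
  have := los_his (a j1) (Pr i' j1); rewrite eqxx (negbTE (ba i')) /= /l.
  by case: (los _ _); case: (los _ _); case: (his _ _).
pose c i i' := P i j1 ++ P i' j1 ++ P i j2 ++ P i' j2.
have cst i i' : steps (c i i').
  by move=> s; rewrite !mem_cat => /or4P[] /Ps.
have cru i i' : runs (c i i') (a j1) (a j1).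
  move=> g; rewrite !big_cat /= !Pr addbb.
  by case: (g _); case: (g _); case: (g _); case: (g _).
have crossD c1 c2 d : crossings (c1 ++ c2) d = crossings c1 d (+) crossings c2 d.
  by rewrite /crossings big_cat.
have crc i i' d : crossings (c i i') d = (crossings (P i j1) d (+) crossings (P i' j1) d)
   (+) (crossings (P i j2) d (+) crossings (P i' j2) d).
  by rewrite /c !crossD; do 4 case: (crossings _ _).
(* The cycle [c i i'] avoids the walk from [b k] to [a j3], so these two points have the same index.
   Of its four walks only the two at [a j1] can contribute crossings with the walk from [b k] to
   [a j1]. *)
have key i i' k : i != k -> i' != k ->
    (crossings (P i j1) (P k j1) (+) crossings (P i' j1) (P k j1)) =
    index (c i i') (a j1) (+) index (c i i') (a j3).
  move=> ik i'k.
  have e3 := crossings_closed (cst i i') (cru i i') (Ps k j3) (Pr k j3).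
  have e1 := crossings_closed (cst i i') (cru i i') (Ps k j1) (Pr k j1).
  rewrite !crc !(cr0 _ _ _ _ _ j13, cr0 _ _ _ _ _ j23) // in e3.
  rewrite !crc !(cr0 _ _ _ _ _ j21) //= addbF in e1; rewrite e1; move: e3 => /=.
  by case: (index _ _); case: (index _ _); case: (index _ _).
(* Each walk lies on two of the three cycles, so the indices cancel at every face. Adding the three
   instances of [key], the left sides form the sum of the three [lam], which is odd, and the right
   sides cancel. *)
have indD p : index (c j1 j2) p (+) index (c j1 j3) p (+) index (c j2 j3) p = false.
  by rewrite /index /c !big_cat /=; do 6 case: (\big[addb/false]_(_ <- _) _).
have k1 := key j1 j2 j3 j13 j23.
have k2 := key j1 j3 j2 j12 j32; have k3 := key j2 j3 j1 j21 j31.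
have l12 := lam _ _ j12; have l13 := lam _ _ j13; have l23 := lam _ _ j23.
have i1 := indD (a j1); have i3 := indD (a j3).
move: k1 k2 k3 l12 l13 l23 i1 i3.
do 6 case: (crossings _ _); case: (l j1); case: (l j2); case: (l j3) => //=;
do 6 case: (index _ _) => //=.
Qed.

End Lattice.

(** * Chopping in a string metric *)

Lemma nat_argmin (A : Type) (P : A -> Prop) (f : A -> nat) :
  (exists a, P a) -> exists2 a, P a & forall b, P b -> f a <= f b.
Proof.
move=> [a Pa].
have ex : exists n, `[< exists2 b, P b & f b = n >].
  by exists (f a); apply/asboolP; exists a.
case: (ex_minnP ex) => _ /asboolP[b Pb <-] bmin; exists b => // c Pc.
by apply: bmin; apply/asboolP; exists c.
Qed.

(** Hermite's identity: over the [D] possible offsets, an interval of length [w] passes [w]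
    multiples of [D] in total. This is what [chop_offset] averages. *)
Lemma sum_divn_shift (D u : nat) : 0 < D -> \sum_(r < D) (u + r) %/ D = u.
Proof.
case: D => // D _; elim: u => [|u IH].
  by rewrite big1 // => i _; rewrite add0n divn_small.
rewrite -[in RHS]IH big_ord_recr [in RHS]big_ord_recl /= addn0.
have -> : u.+1 + D = u + D.+1 by rewrite addSnnS.
rewrite divnDr ?dvdnn // divnn /= addn1 addnS addnC; congr (_ + _).+1.
by apply: eq_bigr => i _; rewrite /bump addSnnS.
Qed.

Section StringMetric.
Variables (T : Type) (r : T -> T -> Prop).
Hypothesis rsym : forall z w, r z w -> r w z.
Variables (X : finType) (C : X -> set T) (rep : X -> T) (w : X -> nat).
Hypothesis Crep : forall x, C x (rep x).
Hypothesis Cconn : forall x z u, C x z -> C x u -> conn r (C x) z u.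
Implicit Types (F G R : set T) (z u v t c : T) (n k : nat) (x y : X) (Y Z K : {set X}).

Definition touch x y : Prop := C x `&` C y !=set0.

Lemma touch_sym x y : touch x y -> touch y x.
Proof. by move=> [z [zx zy]]; exists z. Qed.

Lemma touch_refl x : touch x x.
Proof. by exists (rep x); split; apply: Crep. Qed.

(* Moving along one component of the part of the string x inside F costs w x,
   however far one moves. *)
Inductive reach Y F : nat -> T -> T -> Prop :=
| reach_refl z of F z : reach Y F 0 z z
| reach_step n z u v x of reach Y F n z u & x \in Y & conn r (C x `&` F) u v :
    reach Y F (n + w x) z v.

Lemma reach_memr Y F n z u : reach Y F n z u -> F u.
Proof. by case=> // m v u' v' x _ _ h; have [] := conn_memr h. Qed.

Lemma reach_last Y F n z v : reach Y F n z v -> z = v \/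
  exists m u x, [/\ reach Y F m z u, x \in Y, conn r (C x `&` F) u v & n = m + w x].
Proof. by case=> [|m {}z u {}v x zu xY uv]; [left|right; exists m, u, x]. Qed.

Lemma reach_one Y F x z u : x \in Y -> conn r (C x `&` F) z u -> reach Y F (w x) z u.
Proof.
by move=> xY zu; rewrite -[w x]add0n; apply: (reach_step (reach_refl _ _) xY zu); have [] := conn_meml zu.
Qed.

Lemma reach_trans Y F m n z u v :
  reach Y F m z u -> reach Y F n u v -> reach Y F (m + n) z v.
Proof.
move=> zu uv; elim: uv zu => [{}u _|{}n {}u u' {}v x _ IH xY u'v] zu; first by rewrite addn0.
by rewrite addnA; apply: (reach_step (IH zu) xY u'v).
Qed.

Lemma reach_sym Y F n z u : reach Y F n z u -> reach Y F n u z.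
Proof.
elim=> [{}z Fz|{}n {}z {}u v x _ IH xY uv]; first exact: reach_refl.
by rewrite addnC; apply: reach_trans IH; apply: (reach_one xY); exact: conn_sym.
Qed.

Lemma reach_sub Y Y' F G n z u : Y \subset Y' -> F `<=` G ->
  reach Y F n z u -> reach Y' G n z u.
Proof.
move=> YY FG; elim=> [{}z /FG Gz|{}n {}z {}u v x _ IH xY uv]; first exact: reach_refl.
apply: (reach_step IH); first exact: (fintype.subsetP YY) xY.
by apply: conn_sub uv; apply: setIS.
Qed.

(** Confines a path to a smaller region, such as a slab, that contains the whole ball around its
    start. *)
Lemma reach_in Y F G n z u : (forall k c, k <= n -> reach Y F k z c -> G c) ->
  reach Y F n z u -> reach Y G n z u.
Proof.
move=> h zu; elim: zu h => [{}z Fz|{}n {}z {}u v x zu IH xY uv] h.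
  by apply/reach_refl/(h 0) => //; apply: reach_refl.
apply: (reach_step (IH _) xY).
  by move=> k c kn; apply: h; apply: leq_trans kn (leq_addr _ _).
apply: conn_sub (conn_inner uv) => c uc; split; first by case: (conn_memr uc).
by apply: (h _ _ (leqnn _)); apply: (reach_step zu xY uc).
Qed.

Definition component Y F z : set T := [set u | exists n, reach Y F n z u].

Lemma component_sub Y F z : component Y F z `<=` F.
Proof. by move=> u [n /reach_memr]. Qed.

Lemma component_start Y F z : F z -> component Y F z z.
Proof. by exists 0; apply: reach_refl. Qed.

Lemma reach_component Y F n z u v : component Y F z u ->
  reach Y F n u v -> reach Y (component Y F z) n u v.
Proof.
move=> [m zu]; apply: reach_in => k c _ uc; exists (m + k); exact: reach_trans zu uc.
Qed.

Lemma component_eq Y F n z u : reach Y F n z u -> component Y F z = component Y F u.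
Proof.
move=> zu; apply/seteqP; split=> v [k h]; [exists (n + k)|exists (n + k)].
- exact: reach_trans (reach_sym zu) h.
- exact: reach_trans zu h.
Qed.

Definition level Y F t z : nat :=
  xget 0 [set n | reach Y F n t z /\ forall k, reach Y F k t z -> n <= k].

Lemma levelP Y F t z : (exists n, reach Y F n t z) ->
  reach Y F (level Y F t z) t z /\ forall k, reach Y F k t z -> level Y F t z <= k.
Proof.
move=> /(nat_argmin (fun n => n)) [n tz nmin].
exact: (@xgetPex nat 0 [set n | reach Y F n t z /\ forall k, reach Y F k t z -> n <= k]
  (ex_intro _ n (conj tz nmin))).
Qed.

Lemma level_le Y F t n z u : (exists k, reach Y F k t z) -> reach Y F n z u ->
  level Y F t u <= level Y F t z + n.
Proof.
move=> h zu; have [tz _] := levelP h; have tu := reach_trans tz zu.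
by have [_ ] := levelP (ex_intro (fun k => reach Y F k t u) _ tu); apply.
Qed.

(** * Connected paths that descend to a root *)

Section Arms.
Variables (Y : {set X}) (F : set T) (t : T) (D : nat).
Hypothesis wD : forall x, x \in Y -> 0 < w x <= D.
Hypothesis Fconn : forall z, F z -> exists n, reach Y F n t z.
Let l z := level Y F t z.

(** [x] is the last string of a cheapest path from [t] to [z]. Its component costs [w x] from any of
    its points, so no point of it can be lower than [u] or higher than [z]. *)
Let last_step z : F z -> z <> t -> exists x u,
  [/\ x \in Y, conn r (C x `&` F) u z, l z = l u + w x & forall c,
      conn r (C x `&` F) u c -> l u <= l c <= l z].
Proof.
move=> Fz zt; have [tz zmin] := levelP (Fconn Fz).
have [/esym //|[n [u [x [tu xY uz lz]]]]] := reach_last tz; rewrite -/(l z) in lz.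
have Fu : F u by exact: reach_memr tu.
have lu : l u <= n by have [_ ] := levelP (Fconn Fu); apply.
have lzu : l z <= l u + w x by apply: (level_le (Fconn Fu) (reach_one xY uz)).
exists x, u; split=> //; first by lia.
move=> c uc; have Fc : F c by have [] := conn_memr uc.
have h1 : l c <= l u + w x by apply: (level_le (Fconn Fu) (reach_one xY uc)).
have h2 : l z <= l c + w x.
  apply: (level_le (Fconn Fc)); apply: (reach_one xY).
  exact: conn_trans (conn_sym rsym uc) uz.
lia.
Qed.

Let stop : F t -> exists P : set T, conn r P t t /\ forall c, P c ->
    [/\ F c, l c <= l t, exists2 n, n <= l t - l c + D & reach Y F n t c &
     c = t].
Proof.
move=> Ft; exists [set t]; split; first exact: conn_refl.
by move=> c ->; split=> //; exists 0 => //; apply: reach_refl.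
Qed.

(** Follow the last strings of cheapest paths back to [t]. Up to the string containing [c] the cost
    equals the loss of level; the slack [D] pays for that string. *)
Lemma descent z : F z -> F t -> exists P : set T, conn r P z t /\ forall c, P c ->
  [/\ F c, l c <= l z & exists2 n, n <= l z - l c + D & reach Y F n z c].
Proof.
move=> Fz Ft; move: {2}(l z) (leqnn (l z)) => n; elim: n z Fz => [|n IH] z Fz ln.
  have [->|zt] := pselect (z = t).
    by have [P [h1 h2]] := stop Ft; exists P; split=> // c /h2[].
  by have [x [u [xY _ ? _]]] := last_step Fz zt; have := wD xY; lia.
have [->|zt] := pselect (z = t).
  by have [P [h1 h2]] := stop Ft; exists P; split=> // c /h2[].
have [x [u [xY uz lz hl]]] := last_step Fz zt; have wx := wD xY.
have Fu : F u by have [] := conn_meml uz.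
have [|P [Pc Ph]] := IH u Fu; first by lia.
exists (conn r (C x `&` F) u `|` P); split.
  apply: (@conn_trans _ _ _ _ u); last by apply: conn_sub Pc; apply: subsetUr.
  by apply: conn_sym => //; apply: conn_sub (conn_inner uz); apply: subsetUl.
move=> c [uc|/Ph[Fc lc [k kn uc]]].
  have := hl c uc; have [_ Fc] := conn_memr uc => ?; split=> //; first by lia.
  by exists (w x); [lia|apply: reach_one xY (conn_trans (conn_sym rsym uz) uc)].
split=> //; first by lia.
exists (w x + k); first by lia.
exact: reach_trans (reach_one xY (conn_sym rsym uz)) uc.
Qed.

(* Truncating the descent where it leaves the slab [lo, l z] for the first time
   is what keeps two arms from meeting just outside the slab. *)
Lemma arm lo z : F z -> F t -> exists P : set T, conn r P z t /\ forall c, P c ->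
  [/\ F c, l c <= l z, exists2 n, n <= l z - l c + 2 * D & reach Y F n z c &
   l c < lo \/ exists2 n, n <= l z - lo + D &
     reach Y [set u | F u /\ lo <= l u <= l z] n z c].
Proof.
move=> Fz Ft; have [lolz|lolz] := leqP lo (l z); last first.
  have [P [Pc Ph]] := descent Fz Ft; exists P; split=> // c /Ph[Fc lc [n nl zc]].
  by split=> //; [exists n => //; lia|left; lia].
move: {2}(l z) (leqnn (l z)) => n; elim: n z Fz lolz => [|n IH] z Fz lolz ln.
  have [->|zt] := pselect (z = t).
    have [P [h1 h2]] := stop Ft; exists P; split=> // c /h2[Fc lc [k kn tc] ->].
    split=> //; first by exists 0 => //; apply: reach_refl.
    right; exists 0 => //; apply: reach_refl; split=> //.
    have : l t <= 0 by have [_] := levelP (Fconn Ft); apply; apply: reach_refl.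
    by move: lolz; lia.
  by have [x [u [xY _ ? _]]] := last_step Fz zt; have := wD xY; lia.
have [zE|zt] := pselect (z = t).
  have [P [h1 h2]] := stop Ft; exists P; rewrite zE; split=> // c /h2[Fc lc [k kn tc] ->].
  split=> //; first by exists 0 => //; apply: reach_refl.
  right; exists 0 => //; apply: reach_refl; split=> //.
  by rewrite -zE lolz leqnn.
have [x [u [xY uz lz hl]]] := last_step Fz zt; have wx := wD xY.
have Fu : F u by have [] := conn_meml uz.
have zu := conn_sym rsym uz.
have hl' c : conn r (C x `&` F) z c -> l u <= l c <= l z.
  by move=> zc; apply: hl; apply: conn_trans uz zc.
have [lou|lou] := leqP lo (l u).
  have [||P [Pc Ph]] := IH u Fu => //; first by lia.
  have sl v : conn r (C x `&` F) z v ->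
      reach Y [set u0 | F u0 /\ lo <= l u0 <= l z] (w x) z v.
    move=> zv; apply: (reach_one xY); apply: conn_sub (conn_inner zv) => c zc.
    by have [? ?] := conn_memr zc; have := hl' c zc; split=> //; split=> //; lia.
  exists (conn r (C x `&` F) z `|` P); split.
    apply: (@conn_trans _ _ _ _ u); last by apply: conn_sub Pc; apply: subsetUr.
    by apply: conn_sub (conn_inner zu); apply: subsetUl.
  move=> c [zc|/Ph[Fc lc [k kn uc] hc]].
    have [_ Fc] := conn_memr zc; split=> //; first by have := hl' c zc; lia.
      by exists (w x); [have := hl' c zc; lia|apply: reach_one xY zc].
    by right; exists (w x); [lia|apply: sl].
  split=> //; first by lia.
    by exists (w x + k); [lia|apply: reach_trans (reach_one xY zu) uc].
  case: hc => [|[k' k'n uc']]; [by left|right].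
  exists (w x + k'); first by lia.
  apply: reach_trans (sl _ zu) _; apply: (reach_sub (subxx _) _ uc') => v [? ?].
  by split=> //; lia.
(* Here the string leaves the slab: it is followed to its first point [c1] below [lo], and then by a
   descent, whose levels never rise above that of [c1]. The string and the descent cost one slack
   [D] each. *)
have [|[c0 [c1 [zc0 c01 [Cc1 Fc1] nc1]]]] := @conn_exit _ r (C x `&` F) [set c | lo <= l c] z u zu lolz.
  by move=> h; have [_ /=] := conn_memr h; lia.
have {}nc1 : l c1 < lo by rewrite ltnNge; apply/negP.
have zc0' : conn r (C x `&` F) z c0 by apply: conn_sub zc0; apply: subIsetl.
have zc1 : conn r (C x `&` F) z c1 by apply: (conn_step zc0' c01).
have [P [Pc Ph]] := descent Fc1 Ft.
exists (conn r (C x `&` F `&` [set c | lo <= l c]) z `|` P); split.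
  apply: (@conn_trans _ _ _ _ c1); last by apply: conn_sub Pc; apply: subsetUr.
  apply: (conn_step _ c01); last by right; apply: conn_meml Pc.
  by apply: conn_sub (conn_inner zc0); apply: subsetUl.
move=> c [zc|/Ph[Fc lc [k kn uc]]].
  have [[_ Fc] /= loc] := conn_memr zc.
  have zc' : conn r (C x `&` F) z c by apply: conn_sub zc; apply: subIsetl.
  split=> //; first by have := hl' c zc'; lia.
    by exists (w x); [have := hl' c zc'; lia|apply: reach_one xY zc'].
  right; exists (w x); first by lia.
  apply: (reach_one xY); apply: conn_sub (conn_inner zc) => v zv.
  have [[? ?] /= ?] := conn_memr zv; split=> //; split=> //.
  have zv' : conn r (C x `&` F) z v by apply: conn_sub zv; apply: subIsetl.
  by have := hl' v zv'; lia.
have hc1 := hl' c1 zc1; split=> //; [by lia| |by left; lia].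
exists (w x + k); first by have := hl' c1 zc1; lia.
exact: reach_trans (reach_one xY zc1) uc.
Qed.

End Arms.
Lemma chop_offset (Y Z : {set X}) (lo : X -> nat) (D : nat) : 0 < D -> Z \subset Y ->
  exists o, #|[set x in Z | (lo x + o) %/ D != (lo x + w x + o) %/ D]%SET| * D <=
            \sum_(x in Y) w x.
Proof.
move=> D0 ZY; apply: contrapT => h.
pose c (o : nat) := #|[set x in Z | (lo x + o) %/ D != (lo x + w x + o) %/ D]%SET|.
have hc o : \sum_(x in Y) w x < c o * D by rewrite ltnNge; apply/negP => ?; apply: h; exists o.
have : \sum_(o < D) c o <= \sum_(x in Y) w x.
  apply: (@leq_trans (\sum_(o < D) \sum_(x in Z) ((lo x + w x + o) %/ D - (lo x + o) %/ D))).
    apply: leq_sum => o _; rewrite /c -sum1_card big_mkcond [leqRHS]big_mkcond /=.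
    apply: leq_sum => x _; rewrite inE; case: (x \in Z) => //=; case: eqVneq => // ne.
    rewrite subn_gt0 ltn_neqAle ne /= leq_div2r //; lia.
  rewrite exchange_big /= [leqRHS](big_setID Z) /= (finset.setIidPr ZY).
  apply: leq_trans (leq_addr _ _).
  apply: leq_sum => x _; rewrite sumnB; last by move=> o _; rewrite leq_div2r //; lia.
  by rewrite !sum_divn_shift //; lia.
move=> h1; have : \sum_(o < D) (\sum_(x in Y) w x).+1 <= (\sum_(o < D) c o) * D.
  by rewrite big_distrl /=; apply: leq_sum => o _; apply: hc.
rewrite sum_nat_const card_ord [_ * D]mulnC leq_pmul2l //; lia.
Qed.

(** * Chopping along distance levels *)

Section Chop.
Variables (Y : {set X}) (z0 : T) (D : nat).
Hypothesis D0 : 0 < D.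

(** The pieces are not listed: each string carries the region of its own piece, and strings of the
    same piece are recognized by carrying equal sets. *)
Definition tracked Z (F : X -> set T) : Prop :=
  [/\ forall x, x \in Z -> C x `<=` F x,
      forall x, x \in Z -> forall u v, F x u -> F x v -> exists n, reach Y (F x) n u v &
      forall x y, x \in Z -> y \in Z -> touch x y -> F x = F y].

Lemma tracked_sub Z Z' (F : X -> set T) : Z' \subset Z -> tracked Z F -> tracked Z' F.
Proof.
move=> /fintype.subsetP ZZ [h1 h2 h3]; split=> [x /ZZ|x /ZZ|x y /ZZ xZ /ZZ yZ].
- exact: h1.
- exact: h2.
- exact: h3.
Qed.

(* The slabs of width D around t are fattened by the margin m, so that balls
   around points of a slab stay inside its component. *)
Definition slab Z (F : X -> set T) m (t : X -> T) (b : X -> nat) (o : nat) (F' : X -> set T) : Prop :=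
  [/\ forall x, x \in Z -> F x (t x),
      forall x, x \in Z -> forall z, C x z -> b x <= level Y (F x) (t x) z + o < b x + D,
      forall x, x \in Z -> F' x = component Y [set z | F x z /\
        b x <= level Y (F x) (t x) z + o + m /\ level Y (F x) (t x) z + o < b x + D + m] (rep x) &
      forall x y, x \in Z -> y \in Z -> touch x y -> t x = t y /\ b x = b y].

Lemma chop Z (F : X -> set T) m : Z \subset Y -> tracked Z F -> exists Z' (F' : X -> set T) (t : X -> T) b o,
  [/\ Z' \subset Z, #|(Z :\: Z')%SET| * D <= \sum_(x in Y) w x,
      tracked Z' F' & slab Z' F m t b o F'].
Proof.
move=> ZY [FC Fc Ft].
(* The root is a function of the region alone, so that strings with equal regions measure levels
   from the same point. *)
have /choice [root rootP] (G : set T) : exists u, G !=set0 -> G u.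
  by have [[u Gu]|nG] := pselect (G !=set0); [exists u|exists z0].
pose t x := root (F x).
have tF x : x \in Z -> F x (t x).
  by move=> xZ; apply: rootP; exists (rep x); apply: FC.
pose l x z := level Y (F x) (t x) z.
have /choice [lo loP] x : exists n, (forall z, C x z -> n <= l x z) /\ exists2 z, C x z & l x z = n.
  have [|z Cz zmin] := @nat_argmin _ (C x) (l x); first by exists (rep x).
  by exists (l x z); split=> //; exists z.
have lhi x z : x \in Z -> C x z -> lo x <= l x z <= lo x + w x.
  move=> xZ Cz; have [lmin [u Cu lu]] := loP x; rewrite lmin //= -lu.
  apply: level_le; first by apply: Fc => //; [exact: tF|exact: FC Cu].
  apply: reach_one; first exact: (fintype.subsetP ZY).
  by apply: conn_sub (Cconn Cu Cz) => c Cc; split=> //; apply: FC Cc.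
have [off hoff] := chop_offset lo D0 ZY.
pose k x := (lo x + off) %/ D.
pose cut := [set x in Z | (lo x + off) %/ D != (lo x + w x + off) %/ D]%SET.
pose b x := k x * D.
have thin x z : x \in (Z :\: cut)%SET -> C x z -> b x <= l x z + off < b x + D.
  rewrite !inE => /andP[nc xZ] Cz; move: nc; rewrite xZ /= negbK => /eqP e; have /andP[h1 h2] := lhi x z xZ Cz.
  have e' : (l x z + off) %/ D = k x.
    apply/eqP; rewrite eqn_leq {1}/k e !leq_div2r //; lia.
  by rewrite /b -e' leq_divM /= -mulSnr -ltn_divLR.
pose R x := [set z | F x z /\ b x <= l x z + off + m /\ l x z + off < b x + D + m].
pose F' x := component Y (R x) (rep x).
have Z'Z : (Z :\: cut \subset Z)%SET by apply: subsetDl.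
have CR x : x \in (Z :\: cut)%SET -> C x `<=` R x.
  move=> xZ z Cz; have xZ' := fintype.subsetP Z'Z _ xZ; split; first exact: FC Cz.
  by have := thin x z xZ Cz; lia.
have Creach x z u : x \in (Z :\: cut)%SET -> C x z -> C x u -> reach Y (R x) (w x) z u.
  move=> xZ Cz Cu; have xZ' := fintype.subsetP Z'Z _ xZ.
  apply: reach_one; first exact: (fintype.subsetP ZY).
  by apply: conn_sub (Cconn Cz Cu) => c Cc; split=> //; apply: CR xZ _ Cc.
have tb x y : x \in (Z :\: cut)%SET -> y \in (Z :\: cut)%SET -> touch x y -> t x = t y /\ b x = b y.
  move=> xZ yZ xy; have Fxy : F x = F y by apply: Ft xy; apply: (fintype.subsetP Z'Z).
  split; first by rewrite /t Fxy.
  have [z [zx zy]] := xy; have := thin x z xZ zx; have := thin y z yZ zy.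
  rewrite /l /t Fxy /b; move: (level _ _ _ _) => n h1 h2; congr (_ * _).
  by apply/eqP; rewrite eqn_leq; apply/andP; split; rewrite leqNgt; apply/negP => hk;
    have := leq_mul hk (leqnn D); lia.
exists (Z :\: cut)%SET, F', t, b, off; split=> //.
- rewrite finset.setDDr finset.setDv finset.set0U; apply: leq_trans hoff; rewrite leq_mul2r; apply/orP; right.
  by apply: subset_leq_card; apply: finset.subsetIr.
- split=> [x xZ z Cz|x xZ u v [n xu] [n' xv]|x y xZ yZ xy].
  + exists (w x); exact: Creach.
  + exists (n + n'); apply: (@reach_component _ (R x)); first by exists n.
    exact: reach_trans (reach_sym xu) xv.
  + have [z [zx zy]] := xy; have [e1 e2] := tb x y xZ yZ xy.
    have RE : R x = R y.
      by rewrite /R /l e1 e2 (Ft x y) //; apply: (fintype.subsetP Z'Z).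
    rewrite /F' (component_eq (Creach x _ z xZ (Crep x) zx)).
    by rewrite [in RHS](component_eq (Creach y _ z yZ (Crep y) zy)) RE.
- split=> // [x xZ|x xZ z Cz]; last exact: thin.
  by apply: tF; apply: (fintype.subsetP Z'Z).
Qed.

Lemma conn_const (A : Type) (f : X -> A) Z K x y : K \subset Z ->
  (forall x y, x \in Z -> y \in Z -> touch x y -> f x = f y) ->
  conn touch [set` K] x y -> f x = f y.
Proof.
move=> KZ fe xy; elim: xy => // {}x u v xu -> uv vK; apply: fe => //.
- by apply: (fintype.subsetP KZ); exact: conn_memr xu.
- exact: (fintype.subsetP KZ).
Qed.

Hypothesis wD : forall x, x \in Y -> 0 < w x <= D.
Hypothesis planar : K33_free r.

(** Inside the fattened slab only the part of the arm before truncation counts. It covers fewer than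
    [D + m] levels, and the last string adds at most [D]. *)
Let chop_arm Z (F : X -> set T) m (t : X -> T) b o (F' : X -> set T) x : x \in Z -> tracked Z F -> slab Z F m t b o F' ->
  exists P : set T, conn r P (rep x) (t x) /\ forall c, P c ->
    [/\ F x c,
        exists2 n, n + level Y (F x) (t x) c <= level Y (F x) (t x) (rep x) + 2 * D &
          reach Y (F x) n (rep x) c &
        F' x c -> exists2 n, n <= 2 * D + m & reach Y (F' x) n (rep x) c].
Proof.
move=> xZ [FC Fc Ft] [tF thin F'E _].
have Fx : F x (rep x) by apply: FC.
have Fconn z : F x z -> exists n, reach Y (F x) n (t x) z by move=> ?; apply: Fc => //; apply: tF.
have [P [Pc Ph]] := arm wD Fconn (b x - m - o) Fx (tF x xZ).
exists P; split=> // c /Ph[Fxc lc [n nl xc] hc]; split=> //.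
  by exists n => //; lia.
rewrite F'E // => F'c; have := component_sub F'c => /= -[_ [h1 h2]].
have := thin x xZ _ (Crep x) => h3.
case: hc => [|[k kn kc]]; first by lia.
exists k; first by lia.
apply: reach_component; first by exists 0; apply: reach_refl; split=> //; lia.
by apply: reach_sub kc => // u [Fu /andP[u1 u2]]; split=> //; lia.
Qed.

(* K_{3,3}: the roots of the three chops on one side, the three x i on the
   other, joined by the arms. *)
Lemma three_chops : exists2 S : {set X}, #|S| * D <= 3 * \sum_(x in Y) w x &
  forall K, (K \subset Y :\: S)%SET ->
    (forall x y, x \in K -> y \in K -> conn touch [set` K] x y) ->
  forall x : 'I_3 -> X, (forall i, x i \in K) ->
  exists i j, i != j /\ exists2 n, n <= 11 * D & reach Y setT n (rep (x i)) (rep (x j)).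
Proof.
have near2 n : n <= 2 * D + 0 -> n <= 4 * D by lia.
have near4 n : n <= 2 * D + 2 * D -> n <= 4 * D by lia.
have in_fat b l l' o k n : b <= l + o < b + D -> k <= n -> n <= 2 * D + 0 ->
    l' <= l + k -> l <= l' + k -> b <= l' + o + 2 * D /\ l' + o < b + D + 2 * D by lia.
have in_slab b l o : b <= l + o < b + D ->
    b <= l + o + 2 * D /\ l + o < b + D + 2 * D by lia.
have far_bound l l' lc k n : n + lc <= l' + 2 * D -> k <= 4 * D -> l <= lc + k ->
    l' <= l + D -> k + n <= 11 * D by lia.
have same_slab b l l' o : b <= l + o < b + D -> b <= l' + o < b + D -> l <= l' + D by lia.
pose F0 x := component Y setT (rep x).
have F0t : tracked Y F0.
  have Cr x z u : x \in Y -> C x z -> C x u -> reach Y setT (w x) z u.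
    by move=> xY zx ux; apply: reach_one => //; rewrite setIT; apply: Cconn.
  split=> [x xY z zx|x xY u v [n xu] [n' xv]|x y xY yY [z [zx zy]]].
  - by exists (w x); apply: Cr.
  - exists (n + n'); apply: reach_component; first by exists n.
    exact: reach_trans (reach_sym xu) xv.
  - rewrite /F0 (component_eq (Cr x _ z xY (Crep x) zx)).
    by rewrite (component_eq (Cr y _ z yY (Crep y) zy)).
have [Z1 [F1 [t1 [b1 [d1 [Z1Y c1 F1t s1]]]]]] := chop 0 (subxx Y) F0t.
(* Arms of the first chop may meet arms of the third, which live in [F2]. The margin [2 * D] keeps
   the ball of radius [2 * D] in [F1] around a surviving string inside [F2]. *)
have [Z2 [F2 [t2 [b2 [d2 [Z21 c2 F2t s2]]]]]] := chop (2 * D) Z1Y F1t.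
have Z2Y := fintype.subset_trans Z21 Z1Y.
have [Z3 [F3 [t3 [b3 [d3 [Z32 c3 F3t s3]]]]]] := chop 0 Z2Y F2t.
exists (Y :\: Z3)%SET.
  have : #|(Y :\: Z3)%SET| <= #|(Y :\: Z1)%SET| + #|(Z1 :\: Z2)%SET| + #|(Z2 :\: Z3)%SET|.
    have sub : (Y :\: Z3 \subset (Y :\: Z1) :|: (Z1 :\: Z2) :|: (Z2 :\: Z3))%SET.
      by apply/fintype.subsetP => x; rewrite !inE; case: (x \in Y); case: (x \in Z1); case: (x \in Z2); case: (x \in Z3).
    apply: leq_trans (subset_leq_card sub) _; apply: leq_trans (leq_card_setU _ _) _.
    by rewrite leq_add2r; apply: leq_card_setU.
  by rewrite -(leq_pmul2r D0) => h; lia.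
move=> K KS Kc x xK; apply: contrapT => far.
have KZ3 : K \subset Z3.
  by apply/fintype.subsetP => y /(fintype.subsetP KS); rewrite !inE negb_and negbK => /andP[/orP[//|/negbTE->]].
have x3 i : x i \in Z3 by apply: (fintype.subsetP KZ3).
have x2 i : x i \in Z2 by apply: (fintype.subsetP Z32).
have x1 i : x i \in Z1 by apply: (fintype.subsetP Z21).
have x0 i : x i \in Y by apply: (fintype.subsetP Z1Y).
have KZ2 := fintype.subset_trans KZ3 Z32; have KZ1 := fintype.subset_trans KZ2 Z21.
have KY := fintype.subset_trans KZ1 Z1Y.
have xx i j : conn touch [set` K] (x i) (x j) by apply: Kc.
have F0e i j : F0 (x i) = F0 (x j).
  by have [_ _ h] := F0t; apply: conn_const KY h (xx i j).
have F1e i j : F1 (x i) = F1 (x j).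
  by have [_ _ h] := F1t; apply: conn_const KZ1 h (xx i j).
have F2e i j : F2 (x i) = F2 (x j).
  by have [_ _ h] := F2t; apply: conn_const KZ2 h (xx i j).
have tbe Z (F : X -> set T) m (t : X -> T) b o (F' : X -> set T) i j : K \subset Z -> slab Z F m t b o F' ->
    t (x i) = t (x j) /\ b (x i) = b (x j).
  move=> KZ [_ _ _ h]; split; apply: conn_const KZ _ (xx i j) => u v uZ vZ uv;
  by have [] := h u v uZ vZ uv.
(* Chop [j] starts from the region [G j] and measures levels there from [t j]. *)
pose G (j : 'I_3) := nth (F2 (x ord0)) [:: F0 (x ord0); F1 (x ord0)] j.
pose t (j : 'I_3) := nth (t3 (x ord0)) [:: t1 (x ord0); t2 (x ord0)] j.
pose L j := level Y (G j) (t j).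
have LD j i i' : L j (rep (x i)) <= L j (rep (x i')) + D.
  have lD Z (F : X -> set T) m (t' : X -> T) b o (F' : X -> set T) : K \subset Z -> slab Z F m t' b o F' ->
      (forall i, F (x i) = F (x ord0)) -> level Y (F (x ord0)) (t' (x ord0)) (rep (x i)) <=
      level Y (F (x ord0)) (t' (x ord0)) (rep (x i')) + D.
    move=> KZ s Fe; have [_ thin _ _] := s.
    have h (k : 'I_3) := thin (x k) (fintype.subsetP KZ _ (xK k)) _ (Crep (x k)).
    have := h i'; have := h i; rewrite !Fe.
    have [-> ->] := tbe _ _ _ _ _ _ _ i ord0 KZ s.
    by have [-> ->] := tbe _ _ _ _ _ _ _ i' ord0 KZ s; exact: same_slab.
  case: j => -[|[|[|//]]] j3.
  - by apply: lD KZ1 s1 _.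
  - by apply: lD KZ2 s2 _.
  - by apply: lD KZ3 s3 _.
have arms i j : exists P : set T, conn r P (rep (x i)) (t j) /\ forall c, P c ->
    [/\ G j c,
        exists2 n, n + L j c <= L j (rep (x i)) + 2 * D & reach Y (G j) n (rep (x i)) c &
        forall j' : 'I_3, j < j' -> G j' c ->
          exists2 n, n <= 4 * D & reach Y (G j') n (rep (x i)) c].
  case: j => -[|[|[|//]]] j3; rewrite /L /G /t /=.
  - have [P [Pc Ph]] := chop_arm (x1 i) (tracked_sub Z1Y F0t) s1.
    have [te _] := tbe _ _ _ _ _ _ _ i ord0 KZ1 s1.
    rewrite te (F0e i ord0) (F1e i ord0) in Pc Ph.
    exists P; split=> // c /Ph[h1 h2 h3]; split=> // -[[|[|[|//]]] ?] //= _.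
      by move=> /h3[n /near2 nD nc]; exists n.
    have [_ thin2 F2E _] := s2.
    have F2x := F2E _ (x2 i).
    rewrite -(F2e i ord0) F2x => F2c; have [F1c _] := component_sub F2c.
    rewrite (F1e i ord0) in F1c; have [n nD nc] := h3 F1c.
    exists n; first exact: near2.
    have x1F : F1 (x i) (rep (x i)) by have [h _ _] := F1t; apply: h.
    have th := thin2 _ (x2 i) _ (Crep (x i)).
    apply: reach_component; first by apply: component_start; split=> //; exact: in_slab th.
    rewrite -(F1e i ord0) in nc; apply: reach_in nc => k u kn xu.
    split; first exact: reach_memr xu.
    have [_ F1c' _] := F1t.
    have tF1 : F1 (x i) (t2 (x i)) by have [h _ _ _] := s2; apply: h.
    have u1 := level_le (F1c' _ (x1 i) _ _ tF1 x1F) xu.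
    have u2 := level_le (F1c' _ (x1 i) _ _ tF1 (reach_memr xu)) (reach_sym xu).
    exact: in_fat th kn nD u1 u2.
  - have [P [Pc Ph]] := chop_arm (x2 i) (tracked_sub Z21 F1t) s2.
    have [te _] := tbe _ _ _ _ _ _ _ i ord0 KZ2 s2.
    rewrite te (F1e i ord0) (F2e i ord0) in Pc Ph.
    exists P; split=> // c /Ph[h1 h2 h3]; split=> // -[[|[|[|//]]] ?] //= _.
    by move=> /h3[n /near4 nD nc]; exists n.
  - have [P [Pc Ph]] := chop_arm (x3 i) (tracked_sub Z32 F2t) s3.
    have [te _] := tbe _ _ _ _ _ _ _ i ord0 KZ3 s3.
    rewrite te (F2e i ord0) in Pc Ph.
    by exists P; split=> // c /Ph[h1 h2 h3]; split=> // -[[|[|[|//]]] ?].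
have /choice [P PP] (ij : 'I_3 * 'I_3) := arms ij.1 ij.2.
(* At a common point the arm of the earlier chop is within [4 * D] of its string inside [G j']. As
   the levels of the two strings differ by at most [D], the other arm has cost at most
   [4 * D + D + 2 * D]; together [11 * D]. *)
have clash (i i' j j' : 'I_3) c : i != i' -> j < j' -> P (i, j) c -> ~ P (i', j') c.
  move=> ii jj /((PP (i, j)).2 c) [_ _ /= /(_ j' jj) h] /((PP (i', j')).2 c) /= [Gc [n nl xn] _].
  have [k k4 xk] := h Gc; apply: far; exists i, i'; split=> //.
  exists (k + n); last first.
    apply: reach_trans (reach_sub (subxx Y) (@subsetT _ _) xk) _.
    exact: reach_sub (subxx Y) (@subsetT _ _) (reach_sym xn).
  have : L j' (rep (x i)) <= L j' c + k.
    apply: level_le (reach_sym xk).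
    have [_ c0' _] := F0t; have [_ c1' _] := F1t; have [_ c2' _] := F2t.
    have [h1 _ _ _] := s1; have [h2 _ _ _] := s2; have [h3 _ _ _] := s3.
    move: Gc; rewrite /G /t; case: (j') => -[|[|[|//]]] ? /= Gc.
    - by apply: (c0' _ (x0 _)) => //; apply: h1.
    - by apply: (c1' _ (x1 _)) => //; apply: h2.
    - by apply: (c2' _ (x2 _)) => //; apply: h3.
  by move=> /(far_bound _ _ _ _ _ nl k4); apply; exact: LD.
have [i [j [i' [j' [ii jj [c [Pc Pc']]]]]]] :=
  @planar t (rep \o x) (fun i j => P (i, j)) (fun i j => (PP (i, j)).1).
have [lt|gt|e] := ltngtP j j'.
- exact: clash ii lt Pc Pc'.
- by rewrite eq_sym in ii; apply: clash ii gt Pc' Pc.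
- by rewrite -val_eqE /= e eqxx in jj.
Qed.

End Chop.

End StringMetric.

(** * Congestion of path systems *)

Lemma leq_sumU (X : finType) (A B : {set X}) (w : X -> nat) :
  \sum_(x in A :|: B) w x <= \sum_(x in A) w x + \sum_(x in B) w x.
Proof.
rewrite (big_setID A) /= finset.setUK leq_add2l (finset.setDUl A B A) finset.setDv finset.set0U.
by rewrite [leqRHS](big_setID A) /= leq_addl.
Qed.

Lemma leq_sum_sub (X : finType) (A B : {set X}) (w : X -> nat) :
  A \subset B -> \sum_(x in A) w x <= \sum_(x in B) w x.
Proof. by move=> AB; rewrite [leqRHS](big_setID A) /= (finset.setIidPr AB) leq_addr. Qed.

Lemma Cauchy_sumn (X : finType) (A : {set X}) (a c : X -> nat) :
  (\sum_(x in A) a x * c x) ^ 2 <= (\sum_(x in A) a x) * (\sum_(x in A) a x * c x ^ 2).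
Proof.
have e : 2 * (\sum_(x in A) a x * c x) ^ 2 =
    \sum_(x in A) \sum_(y in A) 2 * (a x * c x * (a y * c y)).
  rewrite -mulnn big_distrlr /= big_distrr /=; apply: eq_bigr => x _.
  by rewrite big_distrr.
have e' : 2 * ((\sum_(x in A) a x) * (\sum_(x in A) a x * c x ^ 2)) =
    \sum_(x in A) \sum_(y in A) (a x * (a y * c y ^ 2) + a y * (a x * c x ^ 2)).
  rewrite mul2n -addnn; transitivity (\sum_(x in A) \sum_(y in A) a x * (a y * c y ^ 2) +
     \sum_(x in A) \sum_(y in A) a y * (a x * c x ^ 2)).
    by congr (_ + _); rewrite big_distrlr //= exchange_big.
  by rewrite -big_split; apply: eq_bigr => x _; rewrite -big_split.
rewrite -(leq_pmul2l (ltn0Sn 1)) e e'.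
apply: leq_sum => x _; apply: leq_sum => y _.
have := leq_mul (leqnn (a x * a y)) (nat_Cauchy (c x) (c y)).
by rewrite -!mulnn; lia.
Qed.

(** [W] counts tokens, [A] is the weighted total congestion and [D] the sum of distances. The
    estimate gives 648 + 13122 = 13770, rounded up to 118^2 so that a square root can be taken
    later. *)
Lemma path_system_arith A W D : A ^ 2 <= W * D -> W ^ 4 <= 81 * D ->
  (W ^ 2 * (2 * A + W)) ^ 2 <= 13924 * W * D ^ 2.
Proof.
move=> hA W4.
have WD : W <= 81 * D.
  by apply: leq_trans W4; case: W {hA} => // n; rewrite -{1}[n.+1]expn1 leq_pexp2l.
have h1 : (2 * A + W) ^ 2 <= 8 * (W * D) + 2 * W ^ 2.
  by rewrite sqrnD; have [+ _] := nat_Cauchy (2 * A) W; rewrite expnMn; move: hA;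
    move: (A ^ 2) (W ^ 2) (W * D) (2 * A * W) => x y z t; lia.
rewrite expnMn -expnM.
apply: leq_trans (leq_mul (leqnn (W ^ 4)) h1) _; rewrite mulnDr.
have h3 := leq_mul W4 (leqnn (8 * (W * D))).
have h4 : W ^ 4 * (2 * W ^ 2) <= (81 * D) * (2 * (W * (81 * D))).
  by rewrite -mulnn leq_mul // leq_mul // leq_mul.
apply: leq_trans (leq_add h3 h4) _.
have -> : 81 * D * (8 * (W * D)) = 648 * (W * D ^ 2) by rewrite -mulnn; ring.
have -> : 81 * D * (2 * (W * (81 * D))) = 13122 * (W * D ^ 2) by rewrite -mulnn; ring.
by rewrite -mulnDl -mulnA leq_mul2r; apply/orP; right.
Qed.

Lemma sum_ffun2 (I S : finType) (i i' : I) (G : S -> S -> nat) : i != i' ->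
  \sum_(f : {ffun I -> S}) G (f i) (f i') =
  #|S| ^ (#|I| - 2) * \sum_s \sum_s' G s s'.
Proof.
move=> ii.
transitivity (\sum_(u : S * S) \sum_(f : {ffun I -> S} | (f i, f i') == u) G u.1 u.2).
  rewrite (partition_big (fun f : {ffun I -> S} => (f i, f i')) predT) //=.
  by apply: eq_bigr => u _; apply: eq_bigr => f /eqP <-.
rewrite pair_big big_distrr /=; apply: eq_bigr => -[s s'] _ /=.
rewrite sum_nat_const; congr (_ * _).
pose F k : pred S := if k == i then pred1 s else if k == i' then pred1 s' else predT.
transitivity #|family F|.
  apply: eq_card => f; rewrite inE unfold_in /=; apply/andP/forallP => [[/eqP e1 /eqP e2] k|h].
    rewrite /F; case: eqP => [->|_]; first by rewrite inE e1.
    by case: eqP => [->|_] //; rewrite inE e2.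
  have := h i; have := h i'; rewrite /F eqxx [i' == i]eq_sym (negbTE ii) eqxx.
  by rewrite !inE => /eqP-> /eqP->.
rewrite card_family foldrE big_map big_enum /= (bigD1 i) //= (bigD1 i') 1?eq_sym //=.
rewrite {1}/F eqxx card1 /F [i' == i]eq_sym (negbTE ii) eqxx card1 !mul1n.
rewrite (eq_bigr (fun=> #|S|)); last by move=> k /andP[/negbTE-> /negbTE->].
rewrite prod_nat_const; congr (_ ^ _).
rewrite -(cardC (pred2 i i')) card2 ii /= addKn.
by apply: eq_card => k; rewrite !inE negb_or.
Qed.

Section StringGraph.
Variables (X : finType) (tch : rel X).
Hypothesis tch_refl : reflexive tch.
Hypothesis tch_sym : symmetric tch.
Implicit Types (x y : X) (S K Y : {set X}).

Definition linked S x y : Prop := conn tch [set` S] x y.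

Definition touches x : nat := #|[set y | tch x y]%SET|.

Hypothesis planar : forall (a b : 'I_3 -> X) (S : 'I_3 -> 'I_3 -> {set X}),
  (forall i j, linked (S i j) (b i) (a j)) ->
  exists i j i' j', [/\ i != i', j != j' &
    exists x y, [/\ x \in S i j, y \in S i' j' & tch x y]].

Local Notation a := touches.

Section PathSystem.
Variable Y : {set X}.
Hypothesis Yconn : forall x y, x \in Y -> y \in Y -> linked Y x y.

(** Tokens turn the weights [a x] into multiplicities: [x] carries one token per string that it
    touches, and a path is routed for every ordered pair of tokens. *)
Let tok := {p : X * X | (p.1 \in Y) && tch p.1 p.2}.
Let loc (s : tok) : X := (val s).1.
Let W := \sum_(x in Y) a x.

Let locY s : loc s \in Y.
Proof. by have /andP[] := valP s. Qed.

Let sum_tok (f : X -> nat) : \sum_(s : tok) f (loc s) = \sum_(x in Y) a x * f x.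
Proof.
rewrite -(big_sub [pred p : X * X | (p.1 \in Y) && tch p.1 p.2] (fun p => f p.1)) /=.
rewrite -(pair_big_dep (mem Y) tch (fun x y => f x)) /=.
by apply: eq_bigr => x _; rewrite sum_nat_const /touches cardsE.
Qed.

Let card_tok : #|{: tok}| = W.
Proof.
rewrite -sum1_card (sum_tok (fun=> 1)) /W.
by apply: eq_bigr => x _; rewrite muln1.
Qed.

Let valid (p : tok -> tok -> {set X}) :=
  forall s t, p s t \subset Y /\ linked (p s t) (loc s) (loc t).

Let c (p : tok -> tok -> {set X}) x : nat := \sum_(s : tok) \sum_(t : tok) (x \in p s t).

Let Phi p := \sum_(x in Y) a x * c p x ^ 2.

Let c_upd p s t (S : {set X}) x :
  c (fun s' t' => if (s' == s) && (t' == t) then S else p s' t') x + (x \in p s t) =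
  c p x + (x \in S).
Proof.
rewrite /c !pair_big /= (bigD1 (s, t)) //= [in RHS](bigD1 (s, t)) //= !eqxx /=.
rewrite addnAC [RHS]addnAC [_ + (x \in S)]addnC; congr (_ + _).
apply: eq_bigr => -[s' t'] /=; case: ifP => // /andP[/eqP-> /eqP->].
by rewrite eqxx.
Qed.

(* Local optimality of a path system that minimizes the total cost: rerouting
   one path never helps. *)
Let reroute p s t S : valid p -> (forall q, valid q -> Phi p <= Phi q) ->
  S \subset Y -> linked S (loc s) (loc t) ->
  \sum_(x in p s t) a x * c p x <= \sum_(x in S) a x * (2 * c p x + 1).
Proof.
move=> pv pmin SY Sl.
pose q s' t' := if (s' == s) && (t' == t) then S else p s' t'.
have qv : valid q.
  by move=> s' t'; rewrite /q; case: ifP => // /andP[/eqP-> /eqP->].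
have := pmin q qv; rewrite /Phi.
have [psY _] := pv s t.
pose c0 x := c p x - (x \in p s t).
have cp x : c p x = c0 x + (x \in p s t).
  rewrite subnK // /c (bigD1 s) //= (bigD1 t) //= -addnA; exact: leq_addr.
have cq x : c q x = c0 x + (x \in S).
  by have := c_upd p s t S x; rewrite -/(q) cp; rewrite /q; lia.
have sumE (A : {set X}) : A \subset Y ->
    \sum_(x in Y) a x * (c0 x + (x \in A)) ^ 2 =
    \sum_(x in Y) a x * c0 x ^ 2 + \sum_(x in A) a x * (2 * c0 x + 1).
  move=> AY; have -> : \sum_(x in A) a x * (2 * c0 x + 1) =
      \sum_(x in Y) a x * ((x \in A) * (2 * c0 x + 1)).
    rewrite [RHS](big_setID A) /= (finset.setIidPr AY) [X in _ = _ + X]big1 ?addn0.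
      by apply: eq_bigr => x ->; rewrite mul1n.
    by move=> x; rewrite !inE => /andP[/negbTE-> _]; rewrite mul0n muln0.
  rewrite -big_split; apply: eq_bigr => x _ /=.
  by case: (x \in A); rewrite -?mulnn; nia.
rewrite (eq_bigr (fun x => a x * (c0 x + (x \in p s t)) ^ 2)); last by move=> x _; rewrite cp.
rewrite [leqRHS](eq_bigr (fun x => a x * (c0 x + (x \in S)) ^ 2)); last by move=> x _; rewrite cq.
rewrite !sumE // leq_add2l => h.
apply: leq_trans (leq_trans h _).
  by apply: leq_sum => x xp; rewrite leq_mul2l cp xp; apply/orP; right; lia.
by apply: leq_sum => x xS; rewrite leq_mul2l cp; apply/orP; right; lia.
Qed.

(** Choose three tokens for each side of a K_{3,3} in all [W ^ 6] ways. Each time one of at most 81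
    pairs of independent paths touches, and as a pair is fixed by four tokens, it touches
    [W ^ 2 * Q] times in total. Finally [Q <= Phi p] by 2xy <= x^2 + y^2. *)
Let crossing_bound p : valid p -> W ^ 4 <= 81 * Phi p.
Proof.
move=> pv.
pose hit (s t s' t' : tok) : nat := \sum_(x in Y) \sum_(y in Y | tch x y) (x \in p s t) * (y \in p s' t').
pose Q := \sum_(x in Y) \sum_(y in Y | tch x y) c p x * c p y.
have QE : \sum_s \sum_s' \sum_t \sum_t' hit s t s' t' = Q.
  rewrite /Q /hit.
  transitivity (\sum_s \sum_s' \sum_(x in Y) \sum_(y in Y | tch x y)
      (\sum_t (x \in p s t)) * (\sum_t' (y \in p s' t'))).
    apply: eq_bigr => s _; apply: eq_bigr => s' _.
    transitivity (\sum_t \sum_(x in Y) \sum_t' \sum_(y in Y | tch x y)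
       (x \in p s t) * (y \in p s' t')).
      by apply: eq_bigr => t _; rewrite exchange_big.
    rewrite exchange_big; apply: eq_bigr => x _ /=.
    transitivity (\sum_t \sum_(y in Y | tch x y) \sum_t' (x \in p s t) * (y \in p s' t')).
      by apply: eq_bigr => t _; rewrite exchange_big.
    rewrite exchange_big; apply: eq_bigr => y _ /=.
    by rewrite big_distrlr.
  transitivity (\sum_s \sum_(x in Y) \sum_s' \sum_(y in Y | tch x y)
      (\sum_t (x \in p s t)) * (\sum_t' (y \in p s' t'))).
    by apply: eq_bigr => s _; rewrite exchange_big.
  rewrite exchange_big; apply: eq_bigr => x _ /=.
  transitivity (\sum_s \sum_(y in Y | tch x y) \sum_s'
      (\sum_t (x \in p s t)) * (\sum_t' (y \in p s' t'))).
    by apply: eq_bigr => s _; rewrite exchange_big.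
  rewrite exchange_big; apply: eq_bigr => y _ /=.
  by rewrite /c big_distrlr.
have QPhi : Q <= Phi p.
  have Qa : \sum_(x in Y) \sum_(y in Y | tch x y) c p x ^ 2 <= Phi p.
    apply: leq_sum => x _; rewrite sum_nat_const leq_mul2r; apply/orP; right.
    by rewrite /touches; apply/subset_leq_card/fintype.subsetP => y; rewrite !inE => /andP[].
  have Qb : \sum_(x in Y) \sum_(y in Y | tch x y) c p y ^ 2 <= Phi p.
    rewrite (exchange_big_dep (mem Y)) /=; last by move=> x y _ /andP[].
    apply: leq_trans Qa; apply: leq_sum => x xY; rewrite leq_eqVlt; apply/orP; left; apply/eqP.
    by apply: eq_bigl => y; rewrite xY tch_sym.
  rewrite -(leq_pmul2l (ltn0Sn 1)) [X in _ <= X]mul2n -addnn.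
  apply: leq_trans (leq_add Qa Qb); rewrite -big_split big_distrr /=.
  apply: leq_sum => x _; rewrite -big_split big_distrr /=; apply: leq_sum => y _.
  exact: nat_Cauchy.
have W0 : \sum_(b : {ffun 'I_3 -> tok}) \sum_(a : {ffun 'I_3 -> tok}) 1 = W ^ 6.
  by rewrite !sum_nat_const !card_ffun card_ord card_tok muln1 -expnD.
have [->|Wp] := posnP W; first by rewrite exp0n.
pose pat := ('I_3 * 'I_3 * ('I_3 * 'I_3))%type.
pose good (q : pat) := (q.1.1 != q.2.1) && (q.1.2 != q.2.2).
have Wle : W ^ 6 <= \sum_(q : pat | good q) \sum_(b : {ffun 'I_3 -> tok})
    \sum_(a : {ffun 'I_3 -> tok}) hit (b q.1.1) (a q.1.2) (b q.2.1) (a q.2.2).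
  rewrite -W0 [leqRHS]exchange_big /=; apply: leq_sum => b _.
  rewrite [leqRHS]exchange_big /=; apply: leq_sum => e _.
  have [i [j [i' [j' [ii jj [x [y [xi yi xy]]]]]]]] :=
    @planar (loc \o e) (loc \o b) (fun i j => p (b i) (e j)) (fun i j => (pv (b i) (e j)).2).
  rewrite (bigD1 ((i, j), (i', j'))) /good /=; last by rewrite ii jj.
  apply: leq_trans (leq_addr _ _); rewrite /hit.
  have xY := fintype.subsetP (pv (b i) (e j)).1 _ xi.
  have yY := fintype.subsetP (pv (b i') (e j')).1 _ yi.
  rewrite (bigD1 x) //= (bigD1 y) /=; last by rewrite yY.
  by rewrite xi yi -addnA leq_addr.
have Wq (q : pat) : good q -> \sum_(b : {ffun 'I_3 -> tok})
    \sum_(a : {ffun 'I_3 -> tok}) hit (b q.1.1) (a q.1.2) (b q.2.1) (a q.2.2) = W * (W * Q).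
  move=> /andP[ii jj].
  under eq_bigr => b _ do rewrite (sum_ffun2 (fun t t' => hit (b q.1.1) t (b q.2.1) t') jj).
  rewrite -big_distrr /= card_tok card_ord expn1; congr (_ * _).
  rewrite (sum_ffun2 (fun s s' => \sum_t \sum_t' hit s t s' t') ii).
  by rewrite card_tok card_ord expn1 QE.
have {Wle}Wle : W ^ 6 <= 81 * (W * (W * Q)).
  apply: leq_trans Wle _; rewrite (eq_bigr _ Wq) sum_nat_const leq_mul2r; apply/orP; right.
  by apply: leq_trans (max_card _) _; rewrite !card_prod card_ord.
have : W ^ 2 * W ^ 4 <= W ^ 2 * (81 * Q) by rewrite -expnD -mulnn; lia.
rewrite leq_pmul2l ?expn_gt0 ?Wp // => h.
by apply: leq_trans h _; rewrite leq_mul2l QPhi.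
Qed.

(* The weights w measure the congestion of the path system. *)
Lemma path_system : exists (w : X -> nat) (d : X -> X -> nat),
  let D := \sum_(x in Y) a x * \sum_(y in Y) a y * d x y in
  [/\ forall x, x \in Y -> 0 < w x,
      forall x y, x \in Y -> y \in Y ->
        (exists S, [/\ S \subset Y, linked S x y & \sum_(z in S) w z = d x y]) /\
        forall S, S \subset Y -> linked S x y -> d x y <= \sum_(z in S) w z,
      W ^ 4 <= 81 * D &
      (W ^ 2 * \sum_(x in Y) w x) ^ 2 <= 13924 * W * D ^ 2].
Proof.
have [|p pv pmin] := @nat_argmin _ valid Phi.
  exists (fun _ _ => Y) => s t; split=> //; exact: Yconn.
(* The increase of [Phi] when one more path passes through [x]. *)
pose w x := a x * (2 * c p x + 1).
have a0 x : 0 < a x by apply/card_gt0P; exists x; rewrite inE.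
have /choice [d dP] (xy : X * X) : exists n, xy.1 \in Y -> xy.2 \in Y ->
    (exists S, [/\ S \subset Y, linked S xy.1 xy.2 & \sum_(z in S) w z = n]) /\
    forall S, S \subset Y -> linked S xy.1 xy.2 -> n <= \sum_(z in S) w z.
  have [/andP[xY yY]|ne] := boolP ((xy.1 \in Y) && (xy.2 \in Y)); last first.
    by exists 0 => h1 h2; rewrite h1 h2 in ne.
  have [|S [SY Sl] Smin] := @nat_argmin _ (fun S => S \subset Y /\ linked S xy.1 xy.2)
    (fun S => \sum_(z in S) w z); first by exists Y; split=> //; apply: Yconn.
  exists (\sum_(z in S) w z) => _ _; split; first by exists S.
  by move=> S' ? ?; apply: Smin.
exists w, (fun x y => d (x, y)) => D.
have DE : D = \sum_(s : tok) \sum_(t : tok) d (loc s, loc t).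
  rewrite /D (sum_tok (fun x => \sum_(t : tok) d (x, loc t))).
  by apply: eq_bigr => x _; rewrite (sum_tok (fun y => d (x, y))).
(* Summed over all pairs of tokens, the left side of [reroute] is [Phi p]; with [S] a cheapest
   connection, its right side is a distance. *)
have PhiD : Phi p <= D.
  rewrite DE; apply: (@leq_trans (\sum_(s : tok) \sum_(t : tok) \sum_(x in p s t) a x * c p x)).
    rewrite /Phi; have -> : \sum_(x in Y) a x * c p x ^ 2 =
       \sum_(x in Y) \sum_(s : tok) \sum_(t : tok) (x \in p s t) * (a x * c p x).
      apply: eq_bigr => x _; rewrite -mulnn mulnA mulnC [X in X * _ = _]/c big_distrl /=.
      by apply: eq_bigr => s _; rewrite big_distrl.
    rewrite exchange_big /=; apply: leq_sum => s _.
    rewrite exchange_big /=; apply: leq_sum => t _.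
    rewrite big_mkcond [leqRHS]big_mkcond /=; apply: leq_sum => x _.
    by case: (x \in Y); case: (x \in p s t); rewrite ?mul1n.
  apply: leq_sum => s _; apply: leq_sum => t _.
  have [[S [SY Sl <-]] _] := dP (loc s, loc t) (locY s) (locY t).
  exact: reroute pv pmin SY Sl.
have W4 := leq_trans (crossing_bound pv) (leq_mul (leqnn 81) PhiD).
split=> //; first by move=> x xY; rewrite muln_gt0 a0 addn1.
  by move=> x y xY yY; apply: (dP (x, y)).
have := Cauchy_sumn Y a (c p); rewrite -/W -/(Phi p).
have -> : \sum_(x in Y) w x = 2 * (\sum_(x in Y) a x * c p x) + W.
  rewrite big_distrr -big_split /=; apply: eq_bigr => x _; rewrite /w; lia.
move: (\sum_(x in Y) a x * c p x) => A hA.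
have {}hA : A ^ 2 <= W * D by apply: leq_trans hA (leq_mul (leqnn _) PhiD).
exact: path_system_arith hA W4.
Qed.

End PathSystem.
End StringGraph.

(** * Separators of string graphs *)

Lemma conn_rel (T : Type) (r r' : T -> T -> Prop) (A : set T) z u :
  (forall x y, r x y -> r' x y) -> conn r A z u -> conn r' A z u.
Proof.
move=> rr'; elim=> [{}z Az|{}z {}u v _ IH /rr' uv Av]; first exact: conn_refl.
exact: conn_step IH uv Av.
Qed.

Lemma sum_ltn_minn (N R v : nat) : \sum_(k < N) (R + k < v) = minn N (v - R).
Proof. by elim: N => [|N IH]; rewrite ?big_ord0 ?big_ord_recr /= ?IH; lia. Qed.

(** Sum over the levels [k >= R]: each [x] lies in at most [w x] of the layers, while the masses
    beyond the levels add up to at least the excess on the left, so some layer is small relative to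
    the mass beyond it. The demand that something lies beyond makes the cut proper. *)
Lemma sweep (X : finType) (Y : {set X}) (a f w : X -> nat) (R : nat) :
  R * \sum_(x in Y) a x < \sum_(x in Y) a x * f x ->
  exists2 k, R <= k & (exists2 x, x \in Y & k < f x) /\
   #|[set x in Y | k < f x <= k + w x]%SET| *
     (\sum_(x in Y) a x * f x - R * \sum_(x in Y) a x)
     <= (\sum_(x in [set x in Y | k < f x]%SET) a x) * \sum_(x in Y) w x.
Proof.
move=> fbig; apply: contrapT => h.
set E := _ - _ in h; set B := \sum_(x in Y) w x in h.
pose g k := #|[set x in Y | k < f x <= k + w x]%SET|.
pose m k := \sum_(x in [set x in Y | k < f x]%SET) a x.
pose N := (\sum_(x in Y) f x).+1.
have fN x : x \in Y -> f x - R <= N.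
  by move=> xY; rewrite /N (bigD1 x) //=; lia.
have sumg : \sum_(k < N) g (R + k) <= B.
  have -> : \sum_(k < N) g (R + k) = \sum_(x in Y) \sum_(k < N) (R + k < f x <= R + k + w x).
    rewrite exchange_big; apply: eq_bigr => k _; rewrite /g -sum1_card big_mkcond [RHS]big_mkcond.
    by apply: eq_bigr => x _; rewrite finset.inE; case: (x \in Y) => //=; case: ifP.
  apply: leq_sum => x xY.
  have : \sum_(k < N) (R + k < f x <= R + k + w x) + \sum_(k < N) (R + w x + k < f x) =
         \sum_(k < N) (R + k < f x).
    by rewrite -big_split; apply: eq_bigr => k _ /=; lia.
  by rewrite !sum_ltn_minn; lia.
have summ : E <= \sum_(k < N) m (R + k).
  have -> : \sum_(k < N) m (R + k) = \sum_(x in Y) a x * (f x - R).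
    transitivity (\sum_(x in Y) \sum_(k < N) (R + k < f x) * a x).
      rewrite exchange_big; apply: eq_bigr => k _; rewrite /m big_mkcond [RHS]big_mkcond.
      by apply: eq_bigr => x _; rewrite finset.inE; case: (x \in Y) => //=; case: ifP => _; lia.
    apply: eq_bigr => x xY; rewrite -big_distrl /= sum_ltn_minn mulnC.
    by rewrite (minn_idPr (fN x xY)).
  rewrite /E leq_subLR big_distrr -big_split /=; apply: leq_sum => x _.
  by rewrite [R * _]mulnC -mulnDr leq_mul2l; apply/orP; right; lia.
have mg k : R <= k -> (exists2 x, x \in Y & k < f x) -> m k * B < g k * E.
  by move=> Rk ex; rewrite ltnNge; apply/negP => hk; apply: h; exists k.
have mg0 k : R <= k -> m k * B <= g k * E.
  move=> Rk; have [/(mg k Rk)/ltnW //|nex] := pselect (exists2 x, x \in Y & k < f x).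
  rewrite /m big1 // => x; rewrite finset.inE => /andP[xY kx].
  by case: nex; exists x.
have exR : exists2 x, x \in Y & R < f x.
  apply: contrapT => nex; move: fbig; rewrite ltnNge => /negP; apply.
  rewrite big_distrr /=; apply: leq_sum => x xY; rewrite mulnC leq_mul2r; apply/orP; right.
  by rewrite leqNgt; apply/negP => ?; apply: nex; exists x.
have : (\sum_(k < N) m (R + k)) * B < (\sum_(k < N) g (R + k)) * E.
  rewrite !big_distrl /= !big_ord_recl /= addn0 -addSn.
  apply: leq_add; first exact: mg.
  by apply: leq_sum => k _; apply: mg0; exact: leq_addr.
rewrite ltnNge => /negP; apply.
by apply: (@leq_trans (B * E)); rewrite ?leq_mul2r ?sumg ?orbT // mulnC leq_mul2r summ orbT.
Qed.

Section Separator.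
Variables (T : Type) (r : T -> T -> Prop).
Hypothesis rsym : forall z w, r z w -> r w z.
Hypothesis planar : K33_free r.
Variables (X : finType) (C : X -> set T) (rep : X -> T) (z0 : T).
Hypothesis Crep : forall x, C x (rep x).
Hypothesis Cconn : forall x z u, C x z -> C x u -> conn r (C x) z u.
Implicit Types (x y : X) (S K Y B : {set X}).

Definition meets x y : bool := `[< touch C x y >].

Let meets_refl : reflexive meets.
Proof. by move=> x; apply/asboolP; apply: (touch_refl Crep). Qed.

Let meets_sym : symmetric meets.
Proof. by move=> x y; apply/asboolP/asboolP; apply: touch_sym. Qed.

Let linked_sym S x y : linked meets S x y -> linked meets S y x.
Proof. by apply: conn_sym => u v; rewrite meets_sym. Qed.

Let linked_touch S x y : linked meets S x y <-> conn (touch C) [set` S] x y.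
Proof. by split; apply: conn_rel => u v /asboolP. Qed.

Let linked_conn S x y : linked meets S x y ->
  conn r [set z | exists2 u, u \in S & C u z] (rep x) (rep y).
Proof.
elim=> [{}x xS|{}x u v xu IH uv vS].
  by apply: conn_refl; exists x.
have [c [cu cv]] := asboolW uv.
have uS : u \in S := conn_memr xu.
apply: (conn_trans IH); apply: (@conn_trans _ _ _ _ c).
  by apply: conn_sub (Cconn (Crep u) cu) => z uz; exists u.
by apply: conn_sub (Cconn cv (Crep v)) => z vz; exists v.
Qed.

Let planar_strings (a b : 'I_3 -> X) (S : 'I_3 -> 'I_3 -> {set X}) :
  (forall i j, linked meets (S i j) (b i) (a j)) ->
  exists i j i' j', [/\ i != i', j != j' &
    exists x y, [/\ x \in S i j, y \in S i' j' & meets x y]].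
Proof.
move=> h; have [i [j [i' [j' [ii jj [c [[x xS xc] [y yS yc]]]]]]]] :=
  @planar (rep \o a) (rep \o b) _ (fun i j => linked_conn (h i j)).
exists i, j, i', j'; split=> //; exists x, y; split=> //.
by apply/asboolP; exists c.
Qed.

Let reach_linked (w : X -> nat) Y F n z u x : reach r C w Y F n z u -> x \in Y -> C x z ->
  exists S v, [/\ S \subset Y, linked meets S x v, C v u & \sum_(t in S) w t <= w x + n].
Proof.
move=> zu xY xz; elim: zu xz => [{}z _|{}n {}z {}u v y _ IH yY uv] xz.
  exists [set x]%SET, x; split=> //; first by rewrite finset.sub1set.
    by apply: conn_refl => /=; rewrite finset.inE.
  by rewrite finset.big_set1 addn0.
have [S [t [SY xt tu wS]]] := IH xz.
have [yu _] := conn_meml uv; have [yv _] := conn_memr uv.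
exists (S :|: [set y])%SET, y; split=> //.
- by rewrite finset.subUset SY finset.sub1set.
- apply: (@conn_step _ _ _ _ t).
  + by apply: conn_sub xt => k /=; rewrite finset.inE => ->.
  + by apply/asboolP; exists u.
  + by rewrite /= !finset.inE eqxx orbT.
- by apply: leq_trans (leq_sumU _ _ _) _; rewrite finset.big_set1 addnA leq_add2r.
Qed.

(** [three_chops] wants weights at most [D], so heavier strings are deleted beforehand at the price
    of one more total weight. The two end strings raise [11 * D] to [13 * D]. *)
Let decomposition Y (w : X -> nat) (D : nat) : 0 < D -> (forall x, x \in Y -> 0 < w x) ->
  exists2 S : {set X}, #|S| * D <= 4 * \sum_(x in Y) w x &
    forall K, K \subset (Y :\: S)%SET ->
      (forall x y, x \in K -> y \in K -> linked meets K x y) ->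
    forall x : 'I_3 -> X, (forall i, x i \in K) -> exists i j, i != j /\
      exists2 S' : {set X}, S' \subset Y /\ linked meets S' (x i) (x j) & \sum_(t in S') w t <= 13 * D.
Proof.
move=> D0 w0; pose X0 := [set x in Y | D < w x]%SET.
pose Y' := (Y :\: X0)%SET.
have Y'Y : Y' \subset Y by apply: subsetDl.
have wD x : x \in Y' -> 0 < w x <= D.
  rewrite !finset.inE negb_and -leqNgt => /andP[h xY]; rewrite w0 //.
  by move: h; rewrite xY.
have [S cS hS] := three_chops rsym Crep Cconn z0 D0 wD planar.
exists (X0 :|: S)%SET.
  have c0 : #|X0| * D <= \sum_(x in Y) w x.
    rewrite -sum_nat_const; apply: (@leq_trans (\sum_(x in X0) w x)).
      by apply: leq_sum => x; rewrite finset.inE => /andP[_ /ltnW].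
    by apply: leq_sum_sub; apply/fintype.subsetP => x; rewrite finset.inE => /andP[].
  have c1 : \sum_(x in Y') w x <= \sum_(x in Y) w x by apply: leq_sum_sub.
  have c2 : #|(X0 :|: S)%SET| * D <= (#|X0| + #|S|) * D by rewrite leq_mul2r leq_card_setU orbT.
  by move: cS c0 c1 c2; rewrite mulnDl; lia.
move=> K KY Kc x xK.
have KY' : K \subset (Y' :\: S)%SET.
  by apply: fintype.subset_trans KY _; rewrite finset.setDDl.
have [|i [j [ij [n nD xij]]]] := hS K KY' _ x xK.
  by move=> u v uK vK; apply/linked_touch; apply: Kc.
have xY' k : x k \in Y' by have := fintype.subsetP KY' _ (xK k); rewrite finset.inE => /andP[].
have [S' [v [S'Y l tj wS']]] := reach_linked xij (xY' i) (Crep (x i)).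
exists i, j; split=> //; exists (S' :|: [set (x j)])%SET.
  split; first by rewrite finset.subUset (fintype.subset_trans S'Y Y'Y) finset.sub1set (fintype.subsetP Y'Y).
  apply: (@conn_step _ _ _ _ v).
  + by apply: conn_sub l => k /=; rewrite finset.inE => ->.
  + by apply/asboolP; exists (rep (x j)).
  + by rewrite /= !finset.inE eqxx orbT.
have := wD _ (xY' i); have := wD _ (xY' j).
by have := leq_sumU S' [set x j]%SET w; rewrite finset.big_set1; lia.
Qed.

Local Notation a := (touches meets).
Let mu S := \sum_(x in S) a x.

Let muD Y B : B \subset Y -> mu Y = mu B + mu (Y :\: B)%SET.
Proof. by move=> BY; rewrite /mu (big_setID B) /= (finset.setIidPr BY). Qed.

Let connected K := forall x y, x \in K -> y \in K -> linked meets K x y.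

Variables (M s : nat).
Hypothesis Mmu : mu [set: X]%SET = M.
Hypothesis Ms : M <= s ^ 2.

Let mu_le S : mu S <= M.
Proof. by rewrite -Mmu; apply: leq_sum_sub; apply: finset.subsetT. Qed.

Let sparse_or_balanced Y : connected Y -> 0 < mu Y ->
  (exists2 S : {set X}, #|S| <= 24544 * s &
     forall K, K \subset (Y :\: S)%SET -> connected K -> 3 * mu K <= 2 * M) \/
  (exists B Xr : {set X}, [/\ B \proper Y, #|Xr| * mu Y <= 472 * s * mu (Y :\: B)%SET,
     M <= 3 * mu B & forall x y, x \in B -> y \in (Y :\: B :\: Xr)%SET -> ~~ meets x y]).
Proof.
move=> Yc; set W := mu Y => W0.
have [w [d [w0 dP W4 WB]]] := path_system meets_refl meets_sym planar_strings Yc.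
pose D := \sum_(x in Y) a x * \sum_(y in Y) a y * d x y; pose B0 := \sum_(x in Y) w x.
rewrite -/(mu Y) -/W -/D -/B0 in W4 WB.
have D0 : 0 < D.
  by rewrite lt0n; apply/eqP => D0; move: W4; rewrite D0 muln0 leqn0 expn_eq0 /= eqn0Ngt W0.
have {}WB : W ^ 2 * B0 <= 118 * s * D.
  rewrite -(@leq_exp2r _ _ 2) //; apply: leq_trans WB _; rewrite 2!expnMn.
  have -> : 118 ^ 2 = 13924 by [].
  by rewrite leq_mul2r leq_mul2l /= (leq_trans (mu_le Y) Ms) orbT.
(* By the triangle inequality through a string of [Y], the average distance from it is at least
   [D / (2 * W ^ 2)]. The factor [L] makes this [26 * D], twice the diameter bound of
   [decomposition]. *)
pose L := 52 * W ^ 2; pose w' x := L * w x.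
have L0 : 0 < L by rewrite muln_gt0 expn_gt0 W0.
have [|S cS hS] := @decomposition Y w' D D0; first by move=> x xY; rewrite muln_gt0 L0 w0.
have [bal|] := pselect (forall K, K \subset (Y :\: S)%SET -> connected K -> 3 * mu K <= 2 * M).
  left; exists S => //; rewrite -(leq_pmul2r D0); apply: leq_trans cS _.
  rewrite -big_distrr /= -/B0 /L; have := WB; move: (W ^ 2 * B0) => t ht.
  have -> : 4 * (52 * W ^ 2 * B0) = 208 * (W ^ 2 * B0) by ring.
  have -> : 24544 * s * D = 208 * (118 * s * D) by ring.
  by rewrite leq_mul2l WB orbT.
move=> /existsNP[K /not_implyP[KY /not_implyP[Kc /negP]]]; rewrite -ltnNge => Kbig; right.
have dsym x y : x \in Y -> y \in Y -> d x y = d y x.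
  have le u v : u \in Y -> v \in Y -> d u v <= d v u.
    move=> uY vY; have [_ h] := dP _ _ uY vY; have [[S' [? ? <-]] _] := dP _ _ vY uY.
    by apply: h => //; apply: linked_sym.
  by move=> xY yY; apply/eqP; rewrite eqn_leq !le.
have dtri x y z : x \in Y -> y \in Y -> z \in Y -> d x z <= d x y + d y z.
  move=> xY yY zY; have [[S1 [S1Y l1 <-]] _] := dP _ _ xY yY.
  have [[S2 [S2Y l2 <-]] _] := dP _ _ yY zY; have [_ h] := dP _ _ xY zY.
  apply: leq_trans (leq_sumU _ _ _); apply: h; first by rewrite finset.subUset S1Y.
  by apply: (@conn_trans _ _ _ _ y); [apply: conn_sub l1|apply: conn_sub l2] => u /=;
    rewrite finset.inE => ->; rewrite ?orbT.
have KsubY : K \subset Y by apply: fintype.subset_trans KY (subsetDl _ _).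
pose ball y := [set x in Y | L * d y x <= 13 * D]%SET.
(* Among any three strings of [K] two are within [13 * D], so one or two balls cover [K], and one of
   them carries a third of [M]. *)
have cov : exists2 y, y \in K & M <= 3 * mu (ball y).
  have [K0|[y yK]] := set_0Vmem K.
    by move: Kbig; rewrite K0 /mu finset.big_set0 muln0.
  apply: contrapT => nex.
  have small z : z \in K -> 3 * mu (ball z) < M.
    by move=> zK; rewrite ltnNge; apply/negP => h; apply: nex; exists z.
  have [Ky|] := boolP (K \subset ball y).
    have := leq_sum_sub a Ky; have := small y yK; rewrite /mu in Kbig *; lia.
  case/fintype.subsetPn => y' y'K ny'.
  have [Ky|] := boolP (K \subset ball y :|: ball y')%SET.
    have := leq_sum_sub a Ky; have := leq_sumU (ball y) (ball y') a.
    have := small y yK; have := small y' y'K; rewrite /mu in Kbig *; lia.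
  case/fintype.subsetPn => y'' y''K; rewrite finset.inE negb_or => /andP[n1 n2].
  pose x (i : 'I_3) := nth y'' [:: y; y'] i.
  have xK i : x i \in K by case: i => -[|[|[|]]].
  have [i [j [ij [S' [S'Y l] wS]]]] := hS K KY Kc x xK.
  have xY k : x k \in Y by apply: (fintype.subsetP KsubY).
  have dij : L * d (x i) (x j) <= 13 * D.
    apply: leq_trans wS; rewrite -big_distrr leq_mul2l; apply/orP; right.
    by have [_] := dP _ _ (xY i) (xY j); apply.
  have dji : L * d (x j) (x i) <= 13 * D by rewrite dsym.
  move: ny' n1 n2; rewrite !finset.inE !(fintype.subsetP KsubY) //=.
  move: ij dij dji; rewrite /x -(inj_eq val_inj).
  by case: i j {l} => -[|[|[|i]]] hi [[|[|[|j]]] hj] //= _ h1 h2; rewrite ?h1 ?h2.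
have [y yK yball] := cov; have yY := fintype.subsetP KsubY _ yK.
pose f x := L * d y x.
have fbig : 26 * (W * D) <= \sum_(x in Y) a x * f x.
  have : D <= 2 * (W * \sum_(x in Y) a x * d y x).
    apply: (@leq_trans (\sum_(x in Y) a x * \sum_(z in Y) a z * (d y x + d y z))).
      apply: leq_sum => x xY; rewrite leq_mul2l; apply/orP; right.
      apply: leq_sum => z zY; rewrite leq_mul2l; apply/orP; right.
      by apply: leq_trans (dtri _ y _ _ _ _) _ => //; rewrite (dsym x y).
    rewrite (eq_bigr (fun x => W * (a x * d y x) + a x * \sum_(z in Y) a z * d y z)).
      by rewrite big_split /= -big_distrr -big_distrl /=; rewrite -/(mu Y) -/W; lia.
    move=> x xY; rewrite (eq_bigr (fun z => a z * d y x + a z * d y z)).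
      rewrite big_split /= -big_distrl /= -/(mu Y) -/W mulnDr; congr (_ + _); ring.
    by move=> z _; rewrite mulnDr.
  rewrite -(leq_pmul2l W0) => h.
  have -> : \sum_(x in Y) a x * f x = L * \sum_(x in Y) a x * d y x.
    by rewrite big_distrr; apply: eq_bigr => x _; rewrite /f mulnCA.
  rewrite /L; move: (\sum_(x in Y) _) h => t h.
  have -> : 52 * W ^ 2 * t = 26 * (W * (2 * (W * t))) by rewrite -mulnn; ring.
  by rewrite leq_mul2l.
have [|k Rk [[x xY kx] hk]] := @sweep X Y a f w' (13 * D).
  by rewrite -/(mu Y) -/W; move: fbig D0 W0; case: (W) => // W'; case: (D) => // D'; lia.
rewrite -/(mu Y) -/W in hk.
pose B := [set x in Y | f x <= k]%SET.
have YB : [set x in Y | k < f x]%SET = (Y :\: B)%SET.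
  by apply/finset.setP => z; rewrite !finset.inE ltnNge; case: (z \in Y); rewrite ?andbT ?andbF.
rewrite YB in hk.
exists B, [set x in Y | k < f x <= k + w' x]%SET; split.
- rewrite fintype.properE; apply/andP; split; first by apply/fintype.subsetP => z; rewrite finset.inE => /andP[].
  by apply/fintype.subsetPn; exists x => //; rewrite finset.inE xY -ltnNge.
- set g := #|_| in hk *; rewrite -(leq_pmul2r D0) -(leq_pmul2l (isT : 0 < 13)).
  have h1 : g * (13 * (W * D)) <= g * (\sum_(x in Y) a x * f x - 13 * D * W).
    by rewrite leq_mul2l; apply/orP; right; move: fbig; lia.
  have -> : 13 * (g * W * D) = g * (13 * (W * D)) by ring.
  apply: leq_trans h1 (leq_trans hk _).
  rewrite -big_distrr /= -/B0 -/(mu (Y :\: B)%SET) /L.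
  have -> : mu (Y :\: B)%SET * (52 * W ^ 2 * B0) = 52 * mu (Y :\: B)%SET * (W ^ 2 * B0) by ring.
  have -> : 13 * (472 * s * mu (Y :\: B)%SET * D) = 52 * mu (Y :\: B)%SET * (118 * s * D) by ring.
  by rewrite leq_mul2l WB orbT.
- apply: leq_trans yball _; rewrite leq_mul2l /=; apply: leq_sum_sub; apply/fintype.subsetP => z.
  by rewrite !finset.inE => /andP[-> h] /=; apply: leq_trans Rk.
(* Passing to a touching string [z] raises the scaled distance by at most [w' z], so a string beyond
   level [k] that touches [B] lies in the deleted layer. *)
- move=> u z; rewrite !finset.inE => /andP[uY fu] /and3P[h1 h2 zY].
  rewrite zY /= in h1 h2; rewrite -ltnNge in h2; rewrite h2 /= -ltnNge in h1.
  apply/negP => uz; have [_ dmin] := dP _ _ yY zY; have [[S' [S'Y l wS]] _] := dP _ _ yY uY.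
  have : d y z <= d y u + w z.
    rewrite -wS; apply: (@leq_trans (\sum_(v in S' :|: [set z]) w v)); last first.
      by apply: leq_trans (leq_sumU _ _ _) _; rewrite finset.big_set1.
    apply: dmin; first by rewrite finset.subUset S'Y finset.sub1set.
    apply: (@conn_step _ _ _ _ u) => //; last by rewrite /= !finset.inE eqxx orbT.
    by apply: conn_sub l => v /=; rewrite finset.inE => ->.
  rewrite -(leq_pmul2l L0) mulnDr => h3.
  by move: h1 h3 fu; rewrite /f /w'; lia.
Qed.

(** Each layer is charged to the mass cut off with it, at the rate 708 = 472 * 3 / 2 because
    [2 * M < 3 * mu Y] as long as the recursion continues. The term with 24544 is paid once, for the
    balanced decomposition at the end. *)
Let separator_rec n Y : #|Y| <= n -> exists2 S : {set X},
  #|S| * M <= 708 * s * mu Y + 24544 * s * M &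
  forall K, K \subset (Y :\: S)%SET -> connected K -> 3 * mu K <= 2 * M.
Proof.
elim: n Y => [|n IH] Y cY.
  exists finset.set0; first by rewrite finset.cards0.
  move=> K KY _; have Y0 : Y = finset.set0 by apply/eqP; rewrite -cards_eq0 -leqn0.
  by move: KY; rewrite Y0 finset.set0D finset.subset0 => /eqP->; rewrite /mu finset.big_set0 muln0.
have [small|] := leqP (3 * mu Y) (2 * M).
  exists finset.set0; first by rewrite finset.cards0.
  move=> K; rewrite finset.setD0 => KY _; have := leq_sum_sub a KY; rewrite /mu in small *; lia.
move=> big; have [Yc|nYc] := pselect (connected Y); last first.
  have [bal|] := pselect (forall K, K \subset Y -> connected K -> 3 * mu K <= 2 * M).
    exists finset.set0; first by rewrite finset.cards0.
    by move=> K; rewrite finset.setD0; apply: bal.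
  move=> /existsNP[K0 /not_implyP[K0Y /not_implyP[K0c /negP]]]; rewrite -ltnNge => K0big.
  have [K00|[x0 x0K]] := set_0Vmem K0.
    by move: K0big; rewrite K00 /mu finset.big_set0 muln0.
  pose Y' := [set y in Y | `[< linked meets Y x0 y >]]%SET.
  have Y'Y : Y' \subset Y by apply/fintype.subsetP => y; rewrite finset.inE => /andP[].
  have K0Y' : K0 \subset Y'.
    apply/fintype.subsetP => y yK; rewrite finset.inE (fintype.subsetP K0Y) //=; apply/asboolP.
    by apply: conn_sub (K0c _ _ x0K yK) => u /=; apply: (fintype.subsetP K0Y).
  have ltY : #|Y'| < #|Y|.
    apply: proper_card; rewrite fintype.properE Y'Y /=; apply/negP => YY'; apply: nYc => x y xY yY.
    have := fintype.subsetP YY' _ xY; have := fintype.subsetP YY' _ yY.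
    rewrite !finset.inE => /andP[_ /asboolP h1] /andP[_ /asboolP h2].
    exact: conn_trans (linked_sym h2) h1.
  have [|S cS hS] := IH Y'; first by lia.
  exists S.
    by apply: leq_trans cS _; rewrite leq_add2r leq_mul2l; apply/orP; right; apply: leq_sum_sub.
  move=> K KY Kc; have [[y [yK yY']]|nK] := pselect (exists y, y \in K /\ y \in Y').
    apply: hS => //; apply/fintype.subsetP => z zK.
    have := fintype.subsetP KY _ zK; rewrite !finset.inE => /andP[-> zY]; rewrite zY /=.
    move: yY'; rewrite finset.inE => /andP[yY /asboolP h]; apply/asboolP.
    apply: (conn_trans h); apply: conn_sub (Kc _ _ yK zK) => u /= uK.
    by have := fintype.subsetP KY _ uK; rewrite finset.inE => /andP[].
  (* Such a piece is disjoint from [K0], which carries more than two thirds of [M]. *)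
  have : mu K + mu K0 <= M.
    rewrite -(Mmu) (@muD [set: X]%SET K0) ?finset.subsetT // addnC leq_add2l.
    apply: leq_sum_sub; apply/fintype.subsetP => z zK; rewrite !finset.inE andbT.
    by apply/negP => zK0; apply: nK; exists z; split=> //; apply: (fintype.subsetP K0Y').
  by move: K0big; lia.
have W0 : 0 < mu Y by move: big; lia.
have [[S cS hS]|[B [Xr [BY cXr bigB sep]]]] := sparse_or_balanced Yc W0.
  exists S => //; apply: leq_trans (leq_addl _ _); by rewrite leq_mul2r cS orbT.
have [|S cS hS] := IH B; first by have := proper_card BY; lia.
have BsY := proper_sub BY.
exists (S :|: Xr)%SET.
  have h : #|(S :|: Xr)%SET| * M <= (#|S| + #|Xr|) * M by rewrite leq_mul2r leq_card_setU orbT.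
  apply: leq_trans h _; rewrite mulnDl (muD BsY).
  have : #|Xr| * M <= 708 * s * mu (Y :\: B)%SET.
    rewrite -(leq_pmul2l (isT : 0 < 2)).
    have h1 : #|Xr| * (2 * M) <= #|Xr| * (3 * mu Y) by rewrite leq_mul2l; apply/orP; right; lia.
    have e1 : #|Xr| * (3 * mu Y) = 3 * (#|Xr| * mu Y) by ring.
    have e2 : 2 * (708 * s * mu (Y :\: B)%SET) = 3 * (472 * s * mu (Y :\: B)%SET) by ring.
    rewrite e2; have -> : 2 * (#|Xr| * M) = #|Xr| * (2 * M) by ring.
    by apply: leq_trans h1 _; rewrite e1 leq_mul2l.
  by move: cS; rewrite mulnDr; lia.
move=> K KY Kc.
have KinY z : z \in K -> z \in Y /\ z \notin (S :|: Xr)%SET.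
  by move=> zK; have := fintype.subsetP KY _ zK; rewrite finset.inE => /andP[].
(* A connected piece without strings of the layer stays on one side of it; beyond [B] at most
   [M - mu B], hence two thirds of [M], is left. *)
have Bst x y : x \in K -> y \in K -> (x \in B) = (y \in B).
  move=> xK yK; move: (Kc x y xK yK) => xy; elim: xy {xK yK} => // {}x u v xu -> uv vK.
  have uK : u \in K := conn_memr xu; have {}vK : v \in K by [].
  have [uY] := KinY u uK; have [vY] := KinY v vK.
  rewrite !finset.inE !negb_or => /andP[_ vX] /andP[_ uX].
  apply/idP/idP => h; apply: contraT => h'.
  - by have := sep u v h; rewrite !finset.inE vX h' vY uv => /(_ isT).
  - by have := sep v u h; rewrite !finset.inE uX h' uY meets_sym uv => /(_ isT).
have [[y [yK yB]]|nK] := pselect (exists y, y \in K /\ y \in B).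
  apply: hS => //; apply/fintype.subsetP => z zK; have [_] := KinY z zK.
  by rewrite !finset.inE negb_or => /andP[-> _]; rewrite -(Bst y z).
have KYB : K \subset (Y :\: B)%SET.
  apply/fintype.subsetP => z zK; rewrite finset.inE (KinY z zK).1 andbT.
  by apply/negP => zB; apply: nK; exists z.
have := leq_sum_sub a KYB; rewrite -/(mu K) -/(mu (Y :\: B)%SET).
by have := mu_le Y; rewrite (muD BsY); lia.
Qed.

(* Lee's separator theorem for string graphs. *)
Theorem string_separator : exists2 S : {set X}, #|S| <= 25252 * s &
  forall K, K \subset (~: S)%SET ->
    (forall x y, x \in K -> y \in K -> linked meets K x y) ->
    3 * \sum_(x in K) touches meets x <= 2 * M.
Proof.
have [M0|Mp] := posnP M.
  exists finset.set0; first by rewrite finset.cards0.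
  by move=> K _ _; have := mu_le K; rewrite M0 /mu; lia.
have [S cS hS] := separator_rec (leqnn #|[set: X]|%SET).
exists S; last by move=> K; rewrite -finset.setTD; apply: hS.
rewrite -(leq_pmul2r Mp); apply: leq_trans cS _; rewrite Mmu -mulnDl -mulnDl.
by rewrite leq_mul2r; apply/orP; right.
Qed.

End Separator.

(** * Clusters met by few lines *)

(** Every ordered triple of indices costs a factor 3. The rest pays for [N] blocks with two spare
    points each, by [m + 2 <= 3 * m] for positive [m]. *)
Definition cluster_factor (N : nat) : nat := N.+1 * 3 * 3 ^ #|{: 'I_N * 'I_N * 'I_N}|.

Section Clusters.
Local Open Scope ring_scope.
Variables (R : realFieldType) (I : finType) (pt : I -> R * R).
Implicit Types (l f : R * R * R) (z : R * R) (A B C P Q : {set I}) (i j k : I) (n : nat).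

Definition affine l z : R := l.1.1 * z.1 + l.1.2 * z.2 + l.2.

Definition is_line l : bool := l.1 != (0, 0).

Hypothesis gp : forall i j k l, uniq [:: i; j; k] -> is_line l ->
  ~ (affine l (pt i) = 0 /\ affine l (pt j) = 0 /\ affine l (pt k) = 0).

Let below (m c : R) i : bool := (pt i).2 - m * (pt i).1 < c.
Let above (m c : R) i : bool := c < (pt i).2 - m * (pt i).1.

(* Among the lines through a point of A and a
   point of B having more than n points of A weakly below and more than n
   points of B weakly above, the steepest halves both sets. *)
Lemma ham_sandwich A B n : (forall i j, i \in A -> j \in B -> (pt i).1 < (pt j).1) ->
  (2 * n < #|A|)%N -> (2 * n < #|B|)%N ->
  exists m c, [/\ (n <= #|[set i in A | below m c i]|)%N, (n <= #|[set i in A | above m c i]|)%N,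
    (n <= #|[set i in B | below m c i]|)%N, (n <= #|[set i in B | above m c i]|)%N &
    exists a b, [/\ a \in A, b \in B & forall i, i != a -> i != b -> below m c i || above m c i]].
Proof.
move=> AB cA cB.
pose sl (ij : I * I) : R := ((pt ij.2).2 - (pt ij.1).2) / ((pt ij.2).1 - (pt ij.1).1).
pose v (m : R) i : R := (pt i).2 - m * (pt i).1.
have slP i j m : i \in A -> j \in B -> (v m i <= v m j) = (m <= sl (i, j)).
  move=> iA jB; rewrite /sl ler_pdivlMr ?subr_gt0 ?AB //= /v mulrBr.
  by apply/idP/idP; lra.
have slP' i j m : i \in A -> j \in B -> (v m i < v m j) = (m < sl (i, j)).
  move=> iA jB; rewrite /sl ltr_pdivlMr ?subr_gt0 ?AB //= /v mulrBr.
  by apply/idP/idP; lra.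
have slE i j : i \in A -> j \in B -> v (sl (i, j)) i = v (sl (i, j)) j.
  move=> iA jB; have h : (pt j).1 - (pt i).1 != 0 by rewrite subr_eq0 gt_eqF // AB.
  by rewrite /v /sl /=; field.
pose ok (ij : I * I) := [&& ij.1 \in A, ij.2 \in B,
  (n < #|[set i in A | (v (sl ij) i <= v (sl ij) ij.1)%R]%SET|)%N &
  (n < #|[set j in B | (v (sl ij) ij.1 <= v (sl ij) j)%R]%SET|)%N].
(* The line through the pair of least slope has all of [A'] weakly below it and all of [B'] weakly
   above. *)
have minpair (A' B' : {set I}) : A' \subset A -> B' \subset B -> (n < #|A'|)%N -> (n < #|B'|)%N ->
    exists i j, [/\ ok (i, j), i \in A' & j \in B'].
  move=> A'A B'B cA' cB'.
  have [i0 i0A] : exists i, i \in A' by apply/card_gt0P; lia.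
  have [j0 j0B] : exists j, j \in B' by apply/card_gt0P; lia.
  pose Pij := [pred ij : I * I | (ij.1 \in A') && (ij.2 \in B')].
  have ij0 : Pij (i0, j0) by rewrite /= i0A.
  case: (Order.TotalTheory.arg_minP sl ij0) => -[i j] /= /andP[iA jB] ijmin.
  have iA' := fintype.subsetP A'A _ iA; have jB' := fintype.subsetP B'B _ jB.
  exists i, j; split=> //; rewrite /ok /= iA' jB' /=; apply/andP; split.
  - apply: leq_trans cA' _; apply/subset_leq_card/fintype.subsetP => k kA.
    rewrite finset.inE (fintype.subsetP A'A) //= (slE i j) // slP // ?(fintype.subsetP A'A) //.
    by apply: (ijmin (k, j)); rewrite /= kA.
  - apply: leq_trans cB' _; apply/subset_leq_card/fintype.subsetP => k kB.
    rewrite finset.inE (fintype.subsetP B'B) //= slP // ?(fintype.subsetP B'B) //.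
    by apply: (ijmin (i, k)); rewrite /= iA.
have [i1 [j1 [ok1 _ _]]] := minpair A B (subxx _) (subxx _) ltac:(lia) ltac:(lia).
case: (@Order.TotalTheory.arg_maxP _ R _ (i1, j1) ok sl ok1) => -[a b] /and4P[/= aA bB hA hB] abmax.
set m := sl (a, b) in hA hB abmax; pose c := v m a.
have cb : c = v m b by rewrite /c /m slE.
(* With more than [n] points of [A] strictly below, [minpair] would yield an admissible line from
   one of them to a point of [B] weakly above, which is steeper. *)
have le1 : (#|[set i in A | (v m i < c)%R]%SET| <= n)%N.
  rewrite leqNgt; apply/negP => h.
  have [||i [j [okij iA jB]]] := minpair _ _ _ _ h hB;
    try by apply/fintype.subsetP => k; rewrite finset.inE => /andP[].
  move: iA jB; rewrite !finset.inE => /andP[iA ic] /andP[jB jc].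
  have := abmax _ okij; rewrite leNgt -slP' //.
  by rewrite (lt_le_trans ic).
have le2 : (#|[set j in B | (c < v m j)%R]%SET| <= n)%N.
  rewrite leqNgt; apply/negP => h.
  have [||i [j [okij iA jB]]] := minpair _ _ _ _ hA h;
    try by apply/fintype.subsetP => k; rewrite finset.inE => /andP[].
  move: iA jB; rewrite !finset.inE => /andP[iA ic] /andP[jB jc].
  have := abmax _ okij; rewrite leNgt -slP' //.
  by rewrite (le_lt_trans ic).
have online i : i != a -> i != b -> below m c i || above m c i.
  move=> ia ib; rewrite /below /above -/(v m i); case: ltgtP => // e.
  case: (@gp i a b (- m, 1, - c)).
  - rewrite /= !inE negb_or ia ib /= andbT; apply: contraTneq (AB a b aA bB) => ->.
    by rewrite ltxx.
  - by rewrite /is_line /= xpair_eqE oner_eq0 andbF.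
  - move: e cb; rewrite /affine /c /v /=; lra.
exists m, c; split=> //; last by exists a, b.
- have : [set i in A | (v m i <= c)%R]%SET \subset (a |: [set i in A | below m c i])%SET.
    apply/fintype.subsetP => i; rewrite !finset.inE => /andP[iA]; rewrite le_eqVlt iA => /orP[|lt]; last by rewrite /below -/(v m i) lt orbT.
    case: (eqVneq i a) => //= ia /eqP e; have := online i ia.
    rewrite /below /above -/(v m i) e ltxx orbF => h; apply: h.
    by apply: contraTneq (AB _ _ iA bB) => ->; rewrite ltxx.
  move=> /subset_leq_card; have := hA; rewrite -/c => h1 h2.
  have := leq_trans h2 (leq_card_setU _ _); rewrite cards1; lia.
- have e : (#|A| = #|[set i in A | (v m i < c)%R]%SET| + #|A :\: [set i in A | (v m i < c)%R]|%SET)%N.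
    rewrite -(cardsID [set i in A | (v m i < c)%R]%SET A); congr (_ + _)%N.
    by apply: eq_card => i; rewrite !finset.inE; case: (i \in A).
  have : (A :\: [set i in A | (v m i < c)%R] \subset a |: [set i in A | above m c i])%SET.
    apply/fintype.subsetP => i; rewrite !finset.inE => /andP[+ iA]; rewrite iA /= -leNgt.
    case: (eqVneq i a) => //= ia; rewrite le_eqVlt => /orP[/eqP e'|//].
    have := online i ia; rewrite /below /above -/(v m i) -e' ltxx => h; apply: h.
    by apply: contraTneq (AB _ _ iA bB) => ->; rewrite ltxx.
  move=> /subset_leq_card h2.
  have := leq_trans h2 (leq_card_setU _ _); rewrite cards1; lia.
- have e : (#|B| = #|[set i in B | (c < v m i)%R]%SET| + #|B :\: [set i in B | (c < v m i)%R]|%SET)%N.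
    rewrite -(cardsID [set i in B | (c < v m i)%R]%SET B); congr (_ + _)%N.
    by apply: eq_card => i; rewrite !finset.inE; case: (i \in B).
  have : (B :\: [set i in B | (c < v m i)%R] \subset b |: [set i in B | below m c i])%SET.
    apply/fintype.subsetP => i; rewrite !finset.inE => /andP[+ iB]; rewrite iB /= -leNgt.
    case: (eqVneq i b) => //= ib; rewrite le_eqVlt => /orP[/eqP e'|//].
    have := online i; rewrite /below /above -/(v m i) e' ltxx => h; apply: h => //.
    by apply: contraTneq (AB _ _ aA iB) => ->; rewrite ltxx.
  move=> /subset_leq_card h2.
  have := leq_trans h2 (leq_card_setU _ _); rewrite cards1; lia.
- have : [set j in B | (c <= v m j)%R]%SET \subset (b |: [set j in B | above m c j])%SET.
    apply/fintype.subsetP => i; rewrite !finset.inE => /andP[iB]; rewrite le_eqVlt iB => /orP[|lt]; last by rewrite /above -/(v m i) lt orbT.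
    case: (eqVneq i b) => //= ib /eqP e; have := online i.
    rewrite /below /above -/(v m i) -e ltxx => h; apply: h => //.
    by apply: contraTneq (AB _ _ aA iB) => ->; rewrite ltxx.
  move=> /subset_leq_card; have := hB; rewrite -/c => h1 h2.
  have := leq_trans h2 (leq_card_setU _ _); rewrite cards1; lia.
Qed.

Definition separates f A B : Prop :=
  (forall i, i \in A -> affine f (pt i) < 0) /\ (forall i, i \in B -> 0 < affine f (pt i)).

(** The halving line passes through no point of [C], so one side contains enough of [C]; the parts
    of [A] and [B] are taken on the other side. *)
Lemma separate_third A B C n : (forall i j, i \in A -> j \in B -> (pt i).1 < (pt j).1) ->
  disjoint (mem C) (mem (A :|: B)%SET) ->
  (2 * n < #|A|)%N -> (2 * n < #|B|)%N -> (2 * n < #|C|)%N ->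
  exists A' B' C' : {set I},
  [/\ [/\ A' \subset A, B' \subset B & C' \subset C],
      [/\ (n <= #|A'|)%N, (n <= #|B'|)%N & (n <= #|C'|)%N] &
      exists f, separates f (A' :|: B') C'].
Proof.
move=> AB dis cA cB cC.
have [m [c [h1 h2 h3 h4 [a [b [aA bB onl]]]]]] := ham_sandwich AB cA cB.
have [hC|hC] := leqP n #|[set i in C | above m c i]%SET|.
- exists [set i in A | below m c i]%SET, [set i in B | below m c i]%SET, [set i in C | above m c i]%SET.
  split=> //; first by split; apply/fintype.subsetP => i; rewrite finset.inE => /andP[].
  exists (- m, 1, - c); split=> i; rewrite !finset.inE /affine /below /above /=.
    by move=> /orP[] /andP[_]; lra.
  by move=> /andP[_]; lra.
- exists [set i in A | above m c i]%SET, [set i in B | above m c i]%SET, [set i in C | below m c i]%SET.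
  split.
  + by split; apply/fintype.subsetP => i; rewrite finset.inE => /andP[].
  + split=> //.
    have : (C \subset [set i in C | above m c i] :|: [set i in C | below m c i])%SET.
      apply/fintype.subsetP => i iC; rewrite !finset.inE iC /= orbC; apply: onl.
        by apply/eqP => e; have := disjointFr dis iC; rewrite e finset.inE aA.
      by apply/eqP => e; have := disjointFr dis iC; rewrite e finset.inE bB orbT.
    by move=> /subset_leq_card h; have := leq_trans h (leq_card_setU _ _); lia.
  + exists (m, - 1, c); split=> i; rewrite !finset.inE /affine /below /above /=.
      by move=> /orP[] /andP[_]; lra.
    by move=> /andP[_]; lra.
Qed.

Section Family.
Variable N : nat.
Implicit Types (F G : 'I_N -> {set I}) (t : 'I_N * 'I_N * 'I_N).

Let good t := (t.1.1 < t.1.2)%N && (t.2 != t.1.1) && (t.2 != t.1.2).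

Let ordered F := forall (a b : 'I_N) i j, (a < b)%N -> i \in F a -> j \in F b -> (pt i).1 < (pt j).1.

Let refine F n (ts : seq ('I_N * 'I_N * 'I_N)) : (0 < n)%N -> ordered F ->
  (forall a, (3 ^ size ts * n <= #|F a|)%N) ->
  exists G, [/\ forall a, G a \subset F a, forall a, (n <= #|G a|)%N &
    forall t, t \in ts -> good t -> exists f, separates f (G t.1.1 :|: G t.1.2) (G t.2)].
Proof.
move=> n0; elim: ts F => [|t ts IH] F Fo cF.
  by exists F; split=> // a; have := cF a; rewrite mul1n.
have Fsub G : (forall a, G a \subset F a) -> ordered G.
  move=> GF a b i j ab iG jG; apply: (Fo a b) => //; exact: (fintype.subsetP (GF _)).
have [gt|ngt] := boolP (good t); last first.
  have [|G [GF cG hG]] := IH F Fo.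
    by move=> a; apply: leq_trans (cF a); rewrite leq_mul2r leq_exp2l // leqnSn orbT.
  by exists G; split=> // t'; rewrite inE => /orP[/eqP->|/hG //]; rewrite (negbTE ngt).
case: t gt cF => [[a b] c] /andP[/andP[/= ab ca] cb] cF.
set q := (3 ^ size ts * n)%N in IH.
have q0 : (0 < q)%N by rewrite muln_gt0 expn_gt0 n0.
have c3 d : (2 * q < #|F d|)%N by apply: leq_trans (cF d); rewrite expnS -mulnA -/q; lia.
have dis d e : d != e -> disjoint (mem (F d)) (mem (F e)).
  rewrite neq_ltn => /orP[] de; apply/pred0P => i /=; apply/negP => /andP[h1 h2].
    by have := Fo _ _ _ _ de h1 h2; rewrite ltxx.
  by have := Fo _ _ _ _ de h2 h1; rewrite ltxx.
have dC : disjoint (mem (F c)) (mem (F a :|: F b)%SET).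
  apply/pred0P => i /=; apply/negP => /andP[ic]; rewrite finset.inE => /orP[].
    by rewrite (disjointFr (dis c a ca) ic).
  by rewrite (disjointFr (dis c b cb) ic).
have [A' [B' [C' [[AF BF CF] [cA cB cC] [f fs]]]]] :=
  separate_third (fun i j => Fo a b i j ab) dC (c3 a) (c3 b) (c3 c).
have ba : b != a by rewrite neq_ltn ab orbT.
pose F' d := if d == a then A' else if d == b then B' else if d == c then C' else F d.
have F'F d : F' d \subset F d.
  by rewrite /F'; case: eqP => [->|_] //; case: eqP => [->|_] //; case: eqP => [->|_].
have [|G [GF cG hG]] := IH F' (Fsub _ F'F).
  by move=> d; rewrite /F'; do 3 (case: eqP => // _); have := c3 d; lia.
exists G; split=> //; first by move=> d; apply: fintype.subset_trans (GF d) (F'F d).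
move=> t; rewrite inE => /orP[/eqP->|]; last exact: hG.
move=> _; exists f; have [f1 f2] := fs; split=> i /=.
- rewrite finset.inE => /orP[] /(fintype.subsetP (GF _)) h; apply: f1; rewrite finset.inE.
    by rewrite /F' eqxx in h; rewrite h.
  by rewrite /F' (negbTE ba) eqxx in h; rewrite h orbT.
- move=> /(fintype.subsetP (GF _)) h; apply: f2.
  by rewrite /F' (negbTE ca) (negbTE cb) eqxx in h.
Qed.

(** The two spare points between blocks make the order strict: equal abscissas across the gap would
    put three points on a vertical line. *)
Let blocks P n : (N * (n + 2) <= #|P|)%N -> exists F,
  [/\ forall a, F a \subset P, forall a, (n <= #|F a|)%N & ordered F].
Proof.
move=> cP; pose le i j := (pt i).1 <= (pt j).1.
pose s := sort le (enum P).
have le_tot : total le by move=> i j; apply: le_total.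
have le_tr : transitive le by move=> j i k; apply: le_trans.
have ss : sorted le s by apply: sort_sorted.
have su : uniq s by rewrite sort_uniq enum_uniq.
have sz : size s = #|P| by rewrite size_sort -cardE.
have sP i : (i \in s) = (i \in P) by rewrite mem_sort mem_enum.
pose F (a : 'I_N) := [set i in P | (a * (n + 2) <= index i s < a * (n + 2) + n)%N]%SET.
exists F; split.
- by move=> a; apply/fintype.subsetP => i; rewrite finset.inE => /andP[].
- move=> a; have aN : ((a.+1) * (n + 2) <= size s)%N.
    by rewrite sz; apply: leq_trans cP; rewrite leq_mul2r ltn_ord orbT.
  have u : uniq (take n (drop (a * (n + 2)) s)) by rewrite take_uniq // drop_uniq.
  have na : (n <= size (drop (a * (n + 2)) s))%N by rewrite size_drop; move: aN; rewrite mulSn; lia.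
  have <- : size (take n (drop (a * (n + 2)) s)) = n by rewrite size_takel.
  rewrite -(card_uniqP u); apply/subset_leq_card/fintype.subsetP => i.
  move=> /(nthP i) [k]; rewrite size_takel // => kn; rewrite nth_take // nth_drop => <-.
  have kz : (a * (n + 2) + k < size s)%N by move: aN; rewrite mulSn; lia.
  by rewrite finset.inE -sP mem_nth // index_uniq //=; lia.
- move=> a b i j ab; rewrite !finset.inE => /andP[iP /andP[i1 i2]] /andP[jP /andP[j1 j2]].
  have ij : (index i s + 2 < index j s)%N.
    have : (a.+1 * (n + 2) <= b * (n + 2))%N by rewrite leq_mul2r ab orbT.
    by rewrite mulSn; lia.
  have js : (index j s < size s)%N by rewrite index_mem sP.
  have lek (k k' : nat) : (k <= k')%N -> (k' < size s)%N -> le (nth i s k) (nth i s k').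
    move=> kk' k's; apply: (sorted_leq_nth le_tr _ i ss) => //.
    - by move=> ?; apply: lexx.
    - by rewrite inE; lia.
  have li : nth i s (index i s) = i by rewrite nth_index // sP.
  have lj : nth i s (index j s) = j by rewrite nth_index // sP.
  rewrite lt_neqAle; apply/andP; split; last first.
    by have := lek (index i s) (index j s); rewrite li lj; apply => //; lia.
  apply/eqP => e.
  set p := nth i s (index i s).+1; set q := nth i s (index i s).+2.
  have h1 : le i p by rewrite -{1}li; apply: lek; lia.
  have h2 : le p q by apply: lek; lia.
  have h3 : le q j by rewrite -lj; apply: lek; lia.
  have px : (pt p).1 = (pt i).1 by apply/le_anti/andP; split=> //; rewrite e; apply: (le_tr _ _ _ h2 h3).
  have qx : (pt q).1 = (pt i).1 by apply/le_anti/andP; split; [rewrite e|apply: (le_tr _ _ _ h1 h2)].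
  case: (@gp i p q (1, 0, - (pt i).1)).
  - have uq (k k' : nat) : (k < k')%N -> (k' < size s)%N -> nth i s k != nth i s k'.
      by move=> kk k's; rewrite nth_uniq //; [rewrite neq_ltn kk|apply: ltn_trans k's].
    have ip : i != p by rewrite -{1}li; apply: uq; lia.
    have iq : i != q by rewrite -{1}li; apply: uq; lia.
    have pq : p != q by apply: uq; lia.
    by rewrite /= !inE negb_or ip iq pq.
  - by rewrite /is_line /= xpair_eqE oner_eq0.
  - by rewrite /affine /= px qx; split; [ring|split; ring].
Qed.

Definition separated F : Prop := forall a b c : 'I_N, a != b -> c != a -> c != b ->
  exists f, separates f (F a :|: F b) (F c).

Lemma separated_family P n : (cluster_factor N * n <= #|P|)%N ->
  exists F, [/\ forall a, F a \subset P, forall a, (n <= #|F a|)%N & separated F].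
Proof.
pose ts := enum [set: 'I_N * 'I_N * 'I_N]%SET.
have -> : cluster_factor N = (N.+1 * 3 * 3 ^ size ts)%N by rewrite -cardE finset.cardsT.
case: n => [|n] cP.
  exists (fun=> finset.set0); split=> [a|a|a b c _ _ _] //.
  - exact: finset.sub0set.
  - by exists (0, 0, 0); split=> i; rewrite !finset.inE.
have [|F [FP cF Fo]] := @blocks P (3 ^ size ts * n.+1).
  have n0 : (0 < 3 ^ size ts * n.+1)%N by rewrite muln_gt0 expn_gt0.
  by apply: leq_trans cP; rewrite -!mulnA -[(N.+1 * _)%N]mulnC; nia.
have [G [GF cG hG]] := @refine F n.+1 ts isT Fo cF.
exists G; split=> //; first by move=> a; apply: fintype.subset_trans (GF a) (FP a).
move=> a b c; rewrite neq_ltn => /orP[] ab ca cb.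
- by have := hG (a, b, c); rewrite mem_enum finset.inE => /(_ isT); rewrite /good /= ab ca cb => /(_ isT).
- have := hG (b, a, c); rewrite mem_enum finset.inE => /(_ isT); rewrite /good /= ab ca cb => /(_ isT).
  by rewrite finset.setUC.
Qed.

End Family.
End Clusters.

(** * Splitting the edges by colouring the vertices *)

Section Splitting.
Variables (V : finType) (tch : rel {set V}) (E : {set {set V}}) (c : nat).
Hypothesis tch_sym : symmetric tch.
Hypothesis E_neq0 : forall e, e \in E -> exists v, v \in e.
Hypothesis share_tch : forall e f v, e \in E -> f \in E -> v \in e -> v \in f -> tch e f.
Implicit Types (e f : {set V}) (A B S K U : {set {set V}}) (u v : V) (s k : nat).

Definition touch_deg A e : nat := #|[set f in A | tch e f]%SET|.

Definition touch_pairs A : nat := \sum_(e in A) touch_deg A e.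

Local Notation M := touch_pairs.

Hypothesis sep : forall A s, A \subset E -> M A <= s ^ 2 ->
  exists S, [/\ S \subset A, #|S| <= c * s & forall K, K \subset (A :\: S)%SET ->
    (forall e f, e \in K -> f \in K -> linked tch K e f) ->
    3 * \sum_(e in K) touch_deg A e <= 2 * M A].

Lemma touch_deg_sub A B e : A \subset B -> touch_deg A e <= touch_deg B e.
Proof.
move=> AB; apply/subset_leq_card/fintype.subsetP => f; rewrite !finset.inE.
by case/andP => /(fintype.subsetP AB) -> ->.
Qed.

Lemma touch_pairs_sub A B : A \subset B -> M A <= M B.
Proof.
move=> AB; apply: (@leq_trans (\sum_(e in A) touch_deg B e)); last exact: leq_sum_sub.
by apply: leq_sum => e _; apply: touch_deg_sub.
Qed.

(** Classes come from vertex colours, so that different classes have disjoint vertex sets and can be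
    placed independently. *)
Definition color_class A S (col : V -> nat) i : {set {set V}} :=
  [set e in A :\: S | [forall v in e, col v == i]]%SET.

Lemma color_class_sub A S col i : color_class A S col i \subset (A :\: S)%SET.
Proof. by apply/fintype.subsetP => e; rewrite finset.inE => /andP[]. Qed.

Let color_classP A S col i e :
  reflect (e \in (A :\: S)%SET /\ forall v, v \in e -> col v = i) (e \in color_class A S col i).
Proof.
have -> : (e \in color_class A S col i) =
    (e \in (A :\: S)%SET) && [forall v in e, col v == i] by rewrite finset.inE.
apply: (iffP andP) => -[h1 h2]; split=> //.
  by move=> v ve; apply/eqP; have /forallP/(_ v)/implyP := h2; apply.
by apply/forallP => v; apply/implyP => /h2 ->.
Qed.

(** A component with a third of the mass can stand alone. If there is none, take a maximal union of
    components with at most two thirds: were the rest larger than two thirds, this union would have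
    less than a third and could take in one more component. *)
Let group A B : B \subset A ->
  (forall K, K \subset B -> (forall e f, e \in K -> f \in K -> linked tch K e f) ->
    3 * \sum_(e in K) touch_deg A e <= 2 * M A) ->
  exists U, [/\ U \subset B, forall e f, e \in U -> f \in B -> tch e f -> f \in U,
    3 * \sum_(e in U) touch_deg A e <= 2 * M A &
    3 * \sum_(e in (B :\: U)%SET) touch_deg A e <= 2 * M A].
Proof.
move=> BA sepB; pose mu U := \sum_(e in U) touch_deg A e.
have muB : mu B <= M A by apply: leq_sum_sub.
have muD U : U \subset B -> mu U + mu (B :\: U)%SET = mu B.
  by move=> UB; rewrite /mu [RHS](big_setID U) /= (finset.setIidPr UB).
pose comp e := [set f in B | `[< linked tch B e f >]]%SET.
have compB e : comp e \subset B by apply/fintype.subsetP => f; rewrite finset.inE => /andP[].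
have comp_closed e f g : f \in comp e -> g \in B -> tch f g -> g \in comp e.
  rewrite !finset.inE => /andP[_ /asboolP ef] gB fg; rewrite gB /=; apply/asboolP.
  exact: conn_step ef fg gB.
have comp_le e : 3 * mu (comp e) <= 2 * M A.
  apply: sepB => // f g; rewrite !finset.inE => /andP[_ /asboolP ef] /andP[_ /asboolP eg].
  have sub : conn tch [set` B] e `<=` [set` comp e].
    by move=> x ex /=; rewrite finset.inE (conn_memr ex : x \in B) /=; apply/asboolP.
  apply: (@conn_trans _ _ _ _ e); last by apply: conn_sub sub (conn_inner eg).
  by apply: conn_sym; [move=> x y; rewrite tch_sym|apply: conn_sub sub (conn_inner ef)].
have [[e [eB big]]|nbig] := pselect (exists e, e \in B /\ M A <= 3 * mu (comp e)).
  exists (comp e); split=> //; [exact: comp_closed|exact: comp_le|].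
  by rewrite -/(mu (B :\: comp e)%SET); have := muD _ (compB e); lia.
pose P U := [/\ U \subset B, forall e f, e \in U -> f \in B -> tch e f -> f \in U & 3 * mu U <= 2 * M A].
have [|U [UB Ucl Umu] Umax] := @nat_argmin _ P (fun U => #|~: U|%SET).
  exists finset.set0; split; [exact: finset.sub0set|by move=> e f; rewrite finset.inE|].
  by rewrite /mu finset.big_set0 muln0.
exists U; split=> //; rewrite leqNgt; apply/negP => big; rewrite -/(mu (B :\: U)%SET) in big.
have [e0|[e]] := set_0Vmem (B :\: U)%SET; first by move: big; rewrite e0 /mu finset.big_set0 muln0.
rewrite finset.inE => /andP[eU eB].
have ecomp : e \in comp e by rewrite finset.inE eB; apply/asboolP; apply: conn_refl.
have : P (U :|: comp e)%SET.
  split; first by rewrite finset.subUset UB compB.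
  - move=> f g; rewrite !finset.in_setU => /orP[fU|fe] gB fg; first by rewrite (Ucl f).
    by rewrite (comp_closed e f) ?orbT.
  - have h : 3 * mu (comp e) < M A by rewrite ltnNge; apply/negP => h; apply: nbig; exists e.
    have h2 : mu (U :|: comp e)%SET <= mu U + mu (comp e) by apply: leq_sumU.
    by have := muD _ UB; lia.
move=> /Umax; rewrite leqNgt => /negP; apply; apply: proper_card.
apply/properP.
split; first by rewrite finset.setCS; apply: finset.subsetUl.
by exists e; rewrite finset.in_setC // finset.in_setU ecomp orbT.
Qed.

Lemma split2 A s : A \subset E -> M A <= s ^ 2 ->
  exists S (col : V -> nat), [/\ S \subset A, #|S| <= c * s, forall v, col v < 2,
    forall e, e \in (A :\: S)%SET -> exists i, e \in color_class A S col i &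
    forall i, 3 * M (color_class A S col i) <= 2 * M A].
Proof.
move=> AE Ms; have [S [SA cS hS]] := sep AE Ms.
have BA : (A :\: S \subset A)%SET by apply: finset.subsetDl.
have BE := fintype.subset_trans BA AE.
have [U [UB Ucl U1 U2]] := group BA hS.
(* Edges at a common vertex touch and [U] is closed under touching in [A :\: S], so all remaining
   edges at a vertex agree on membership in [U]. *)
pose col v : nat := [exists e in U, v \in e].
have colU e v : e \in (A :\: S)%SET -> v \in e -> col v = (e \in U).
  move=> eB ve; rewrite /col; congr nat_of_bool; apply/idP/idP => [/existsP[f /andP[fU vf]]|eU].
    apply: (Ucl f) => //; apply: (@share_tch f e v) => //; apply: (fintype.subsetP BE) => //.
    exact: (fintype.subsetP UB).
  by apply/existsP; exists e; rewrite eU.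
exists S, col; split=> //; first by move=> v; rewrite /col; case: [exists _ in _, _].
  by move=> e eB; exists (nat_of_bool (e \in U)); apply/color_classP; split=> // v; apply: colU.
have le K : K \subset A -> M K <= \sum_(e in K) touch_deg A e.
  by move=> KA; apply: leq_sum => e _; apply: touch_deg_sub.
move=> i; have CB := color_class_sub A S col i.
apply: (@leq_trans (3 * \sum_(e in color_class A S col i) touch_deg A e)).
  by rewrite leq_mul2l; apply/orP; right; apply: le; apply: fintype.subset_trans CB BA.
have [i1|i1] := eqVneq i 1.
  apply: leq_trans U1; rewrite leq_mul2l; apply/orP; right; apply: leq_sum_sub.
  apply/fintype.subsetP => e /color_classP[eB h].
  have [v ve] := E_neq0 (fintype.subsetP BE _ eB).
  by have := h v ve; rewrite (colU e) // i1; case: (e \in U).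
apply: leq_trans U2; rewrite leq_mul2l; apply/orP; right; apply: leq_sum_sub.
apply/fintype.subsetP => e /color_classP[eB h].
have [v ve] := E_neq0 (fintype.subsetP BE _ eB).
rewrite finset.inE eB andbT; apply/negP => eU; by move: i1; rewrite -(h v ve) (colU e) // eU.
Qed.

(** One separator for each class of each round makes [2 ^ k - 1] separators, all bounded with the
    same [s] because a subclass has no more touching pairs. *)
Lemma split_pow k A s : A \subset E -> M A <= s ^ 2 ->
  exists S (col : V -> nat), [/\ S \subset A, #|S| <= (2 ^ k - 1) * (c * s), forall v, col v < 2 ^ k,
    forall e, e \in (A :\: S)%SET -> exists i, e \in color_class A S col i &
    forall i, 3 ^ k * M (color_class A S col i) <= 2 ^ k * M A].
Proof.
elim: k A => [|k IH] A AE Ms.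
  exists finset.set0, (fun=> 0); split=> //; [exact: finset.sub0set|by rewrite finset.cards0| |].
  - by move=> e eA; exists 0; apply/color_classP.
  - move=> i; rewrite !mul1n; apply: touch_pairs_sub; apply: fintype.subset_trans (color_class_sub _ _ _ _) _.
    exact: finset.subsetDl.
have [S [col [SA cS col2 colE Mcol]]] := split2 AE Ms.
have Bsub i : color_class A S col i \subset A.
  by apply: fintype.subset_trans (color_class_sub _ _ _ _) (finset.subsetDl _ _).
have /choice [f fP] (i : nat) : exists p : {set {set V}} * (V -> nat),
   [/\ p.1 \subset color_class A S col i, #|p.1| <= (2 ^ k - 1) * (c * s), forall v, p.2 v < 2 ^ k,
    forall e, e \in (color_class A S col i :\: p.1)%SET ->
      exists j, e \in color_class (color_class A S col i) p.1 p.2 j &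
    forall j, 3 ^ k * M (color_class (color_class A S col i) p.1 p.2 j) <=
              2 ^ k * M (color_class A S col i)].
  have [||S' [col' h]] := IH (color_class A S col i).
  - exact: fintype.subset_trans (Bsub i) AE.
  - by apply: leq_trans Ms; apply: touch_pairs_sub.
  by exists (S', col').
pose S' := (S :|: (f 0).1 :|: (f 1).1)%SET.
(* The first round supplies the leading binary digit of the colour. *)
pose col' v := col v * 2 ^ k + (f (col v)).2 v.
have col'2 v : (f (col v)).2 v < 2 ^ k by have [_ _ h _ _] := fP (col v); apply: h.
have k0 : 0 < 2 ^ k by rewrite expn_gt0.
have sub0 i : (f i).1 \subset A.
  by have [h _ _ _ _] := fP i; apply: fintype.subset_trans h (Bsub i).
have fS' i : i < 2 -> (f i).1 \subset S'.
  by case: i => [|[|//]] _; apply/fintype.subsetP => e h; rewrite !finset.inE h ?orbT.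
exists S', col'; split.
- by rewrite !finset.subUset SA !sub0.
- have := leq_trans (leq_card_setU (S :|: (f 0).1)%SET (f 1).1)
    (leq_add (leq_card_setU S (f 0).1) (leqnn _)).
  have [_ h0 _ _ _] := fP 0; have [_ h1 _ _ _] := fP 1.
  move=> h; apply: leq_trans h _.
  have -> : 2 ^ k.+1 - 1 = 1 + (2 ^ k - 1) + (2 ^ k - 1) by rewrite expnS; lia.
  by rewrite !mulnDl mul1n; apply: leq_add h1; apply: leq_add.
- by move=> v; rewrite /col' expnS; have := col2 v; have := col'2 v; nia.
- move=> e; rewrite !finset.inE !negb_or => /andP[/andP[/andP[eS e0] e1] eA].
  have [|i eCi] := colE e; first by rewrite finset.inE eS.
  have /color_classP[_ hi] := eCi.
  have [v ve] := E_neq0 (fintype.subsetP AE _ eA).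
  have i2 : i < 2 by rewrite -(hi v ve).
  have [_ _ _ h _] := fP i; have [|j /color_classP[_ hj]] := h e.
    by rewrite finset.inE eCi andbT; case: (i) i2 => [|[|]].
  exists (i * 2 ^ k + j); apply/color_classP; split.
    by rewrite !finset.inE !negb_or eS e0 e1.
  by move=> u ue; rewrite /col' (hi u ue) (hj u ue).
- move=> i; set C := color_class _ _ _ _.
  have [->|[e0 e0C]] := set_0Vmem C; first by rewrite /M finset.big_set0 muln0.
  have /color_classP[] := e0C; rewrite finset.inE => /andP[_ e0A] hi0.
  have [v ve] := E_neq0 (fintype.subsetP AE _ e0A).
  have di := hi0 v ve; pose a := col v; pose j := (f a).2 v.
  have sub : C \subset color_class (color_class A S col a) (f a).1 (f a).2 j.
    apply/fintype.subsetP => e /color_classP[+ hi].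
    rewrite finset.inE => /andP[eS' eA].
    have ea u : u \in e -> col u = a /\ (f a).2 u = j.
      move=> ue; have := hi u ue; rewrite -di /col' -/a => h.
      have ca : col u = a.
        have := congr1 (fun x => x %/ 2 ^ k) h; rewrite /= !divnMDl // !divn_small ?addn0 //.
        exact: col'2.
      by split=> //; move: h; rewrite ca => /addnI.
    apply/color_classP; split; last by move=> u /ea[].
    rewrite finset.inE; apply/andP; split.
      by apply: contra eS'; apply: (fintype.subsetP (fS' _ (col2 v))).
    apply/color_classP; split; last by move=> u /ea[].
    rewrite finset.inE eA andbT; apply: contra eS' => eS; by rewrite !finset.inE eS.
  have [_ _ _ _ h] := fP a.
  rewrite !expnS -!mulnA; apply: (@leq_trans (3 * (2 ^ k * M (color_class A S col a)))).
    rewrite leq_mul2l /=; apply: leq_trans (h j).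
    by rewrite leq_mul2l; apply/orP; right; apply: touch_pairs_sub.
  by rewrite mulnCA [leqRHS]mulnCA leq_mul2l Mcol orbT.
Qed.

End Splitting.

(** * Half-planes, and lines through the hulls of clusters *)

Section Convexity.
Local Open Scope ring_scope.
Variable R : realFieldType.
Implicit Types (l f : R * R * R) (p q z : R * R) (t : R).

Definition mix t p q : R * R := ((1 - t) * p.1 + t * q.1, (1 - t) * p.2 + t * q.2).

Lemma affine_mix l t p q : affine l (mix t p q) = (1 - t) * affine l p + t * affine l q.
Proof. by rewrite /affine /=; ring. Qed.

Lemma mix_lt0 l t p q : 0 <= t <= 1 -> affine l p < 0 -> affine l q < 0 -> affine l (mix t p q) < 0.
Proof.
rewrite affine_mix => /andP[t0 t1] lp lq.
have h1 : (1 - t) * affine l p <= 0 by rewrite mulr_ge0_le0 ?subr_ge0 // ltW.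
have [t00|tn] := eqVneq t 0; first by rewrite t00; lra.
have : t * affine l q < 0 by rewrite pmulr_rlt0 // lt_neqAle eq_sym tn.
lra.
Qed.

Lemma mix_gt0 l t p q : 0 <= t <= 1 -> 0 < affine l p -> 0 < affine l q -> 0 < affine l (mix t p q).
Proof.
rewrite affine_mix => /andP[t0 t1] lp lq.
have h1 : 0 <= (1 - t) * affine l p by rewrite mulr_ge0 ?subr_ge0 // ltW.
have [t00|tn] := eqVneq t 0; first by rewrite t00; lra.
have : 0 < t * affine l q by rewrite mulr_gt0 // lt_neqAle eq_sym tn.
lra.
Qed.

Lemma mix_zero l p q : affine l p <= 0 -> 0 <= affine l q ->
  exists2 t, 0 <= t <= 1 & affine l (mix t p q) = 0.
Proof.
move=> lp lq; have [lp0|lp0] := eqVneq (affine l p) 0.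
  by exists 0; [rewrite lexx ler01|rewrite affine_mix lp0; ring].
have d0 : 0 < affine l q - affine l p by rewrite subr_gt0; lra.
exists (- affine l p / (affine l q - affine l p)).
  rewrite divr_ge0 ?oppr_ge0 // ?(ltW d0) //= ler_pdivrMr //; lra.
by rewrite affine_mix; field; lra.
Qed.

(** On the line [l], [f] is an affine function of the coordinate [- b * x + a * y]; the factor
    [a ^+ 2 + b ^+ 2] clears denominators. *)
Lemma collinear_middle l f p q z : is_line l ->
  affine l p = 0 -> affine l q = 0 -> affine l z = 0 ->
  - l.1.2 * p.1 + l.1.1 * p.2 <= - l.1.2 * z.1 + l.1.1 * z.2 <= - l.1.2 * q.1 + l.1.1 * q.2 ->
  affine f p < 0 -> affine f q < 0 -> affine f z < 0.
Proof.
case: l f p q z => [[a b] c] [[a' b'] c'] [px py] [qx qy] [zx zy].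
rewrite /is_line /affine /= xpair_eqE => ln lp lq lz.
set T := fun x y : R => - b * x + a * y => tz.
have D0 : 0 < a ^+ 2 + b ^+ 2.
  rewrite lt_neqAle addr_ge0 ?sqr_ge0 // andbT eq_sym paddr_eq0 ?sqr_ge0 //.
  by rewrite !sqrf_eq0.
have key x y : a * x + b * y + c = 0 ->
    (a ^+ 2 + b ^+ 2) * (a' * x + b' * y + c') =
    (b' * a - a' * b) * T x y + (c' * (a ^+ 2 + b ^+ 2) - c * (a' * a + b' * b)).
  move=> e; have -> : c = - (a * x + b * y) by lra.
  by rewrite /T; ring.
rewrite -(pmulr_rlt0 (_ * px + _ + _) D0) -(pmulr_rlt0 (_ * qx + _ + _) D0).
rewrite -(pmulr_rlt0 (_ * zx + _ + _) D0) !key //.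
move: tz; rewrite -/(T px py) -/(T qx qy) -/(T zx zy).
move: (T px py) (T qx qy) (T zx zy) (b' * a - a' * b) => u v t g /andP[ut tv] h1 h2.
have [g0|g0] := leP 0 g; first by apply: le_lt_trans h2; rewrite lerD2r ler_wpM2l.
by apply: le_lt_trans h1; rewrite lerD2r ler_wnM2l // ltW.
Qed.

Section Hulls.
Variables (I : finType) (pt : I -> R * R) (N : nat) (F : 'I_N -> {set I}).
Hypothesis sepF : separated pt F.

Lemma line_hits_two l (a b c : 'I_N) : is_line l -> a != b -> c != a -> c != b ->
  (forall d, d \in [:: a; b; c] -> exists i j, [/\ i \in F d, j \in F d,
     affine l (pt i) <= 0 & 0 <= affine l (pt j)]) -> False.
Proof.
move=> ln ab ca cb hit.
(* Membership of [z] in the hull is expressed by half-planes: those containing [F d] contain [z]. *)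
have zP d : d \in [:: a; b; c] -> exists z, affine l z = 0 /\ forall f,
    ((forall i, i \in F d -> affine f (pt i) < 0) -> affine f z < 0) /\
    ((forall i, i \in F d -> 0 < affine f (pt i)) -> 0 < affine f z).
  move=> /hit [i [j [iF jF li lj]]]; have [t t01 tz] := mix_zero li lj.
  exists (mix t (pt i) (pt j)); split=> // f; split=> h.
    by apply: mix_lt0 => //; apply: h.
  by apply: mix_gt0 => //; apply: h.
have mid d1 d2 d3 (z1 z2 z3 : R * R) : d1 != d2 -> d3 != d1 -> d3 != d2 ->
    affine l z1 = 0 -> affine l z2 = 0 -> affine l z3 = 0 ->
    (forall f, (forall i, i \in F d1 -> affine f (pt i) < 0) -> affine f z1 < 0) ->
    (forall f, (forall i, i \in F d2 -> affine f (pt i) < 0) -> affine f z2 < 0) ->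
    (forall f, (forall i, i \in F d3 -> 0 < affine f (pt i)) -> 0 < affine f z3) ->
    - l.1.2 * z1.1 + l.1.1 * z1.2 <= - l.1.2 * z3.1 + l.1.1 * z3.2 <= - l.1.2 * z2.1 + l.1.1 * z2.2 -> False.
  move=> n1 n2 n3 l1 l2 l3 h1 h2 h3 ord.
  have [f [f1 f2]] := sepF n1 n2 n3.
  have := collinear_middle ln l1 l2 l3 ord (h1 f _) (h2 f _).
  have : 0 < affine f z3 by apply: h3.
  move=> z30 h; have : affine f z3 < 0.
    by apply: h => i iF; apply: f1; rewrite finset.inE iF ?orbT.
  by move: z30; lra.
have [za [la ha]] := zP a (mem_head _ _).
have [|zb [lb hb]] := zP b; first by rewrite !inE eqxx orbT.
have [|zc [lc hc]] := zP c; first by rewrite !inE eqxx !orbT.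
have ha1 f := (ha f).1; have ha2 f := (ha f).2.
have hb1 f := (hb f).1; have hb2 f := (hb f).2.
have hc1 f := (hc f).1; have hc2 f := (hc f).2.
have ba : b != a by rewrite eq_sym.
have ac : a != c by rewrite eq_sym.
have bc : b != c by rewrite eq_sym.
pose T (z : R * R) := - l.1.2 * z.1 + l.1.1 * z.2.
have [tab|/ltW tba] := leP (T za) (T zb); have [tbc|/ltW tcb] := leP (T zb) (T zc).
- by apply: (mid a c b za zc zb) => //; rewrite -/(T za) -/(T zb) tab.
- have [tac|/ltW tca] := leP (T za) (T zc).
    by apply: (mid a b c za zb zc) => //; rewrite -/(T za) -/(T zc) tac.
  by apply: (mid c b a zc zb za) => //; rewrite -/(T za) -/(T zc) tca.
- have [tac|/ltW tca] := leP (T za) (T zc).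
    by apply: (mid b c a zb zc za) => //; rewrite -/(T za) -/(T zb) tba.
  by apply: (mid b a c zb za zc) => //; rewrite -/(T zb) -/(T zc) tbc.
- by apply: (mid c a b zc za zb) => //; rewrite -/(T zc) -/(T zb) tcb.
Qed.

(** [separated] speaks of three distinct clusters only; [2 < N] supplies a third one, to obtain a
    line between the given two. *)
Lemma disjoint_hulls (a b : 'I_N) i j i' j' t t' : (2 < N)%N -> a != b ->
  i \in F a -> j \in F a -> i' \in F b -> j' \in F b -> 0 <= t <= 1 -> 0 <= t' <= 1 ->
  mix t (pt i) (pt j) != mix t' (pt i') (pt j').
Proof.
move=> N2 ab iF jF iF' jF' t01 t01'.
have [d da db] : exists2 d : 'I_N, a != d & b != d.
  have : (0 < #|~: [set a; b]%SET|)%N by rewrite cardsCs finset.setCK cards2 card_ord ab; lia.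
  case/card_gt0P => d; rewrite !finset.inE negb_or => /andP[da db].
  by exists d; rewrite eq_sym.
have ba : b != a by rewrite eq_sym.
have [f [f1 f2]] := sepF da ba db.
apply/eqP => e.
have h1 : affine f (mix t (pt i) (pt j)) < 0.
  by apply: mix_lt0 => //; apply: f1; rewrite finset.inE ?iF ?jF.
have h2 : 0 < affine f (mix t' (pt i') (pt j')) by apply: mix_gt0 => //; apply: f2.
by move: h1 h2; rewrite e; lra.
Qed.

End Hulls.
End Convexity.

(** * Recursive placement of the edge classes *)

Lemma nat_sqrt_up n : 0 < n -> exists2 s, n <= s ^ 2 & s ^ 2 <= 4 * n.
Proof.
move=> n0; have ex : exists s, n <= s ^ 2 by exists n; rewrite -mulnn leq_pmulr.
case: (ex_minnP ex) => s hs smin; exists s => //.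
case: s hs smin => [|[|s]] hs smin; [by rewrite exp0n|by rewrite exp1n; lia|].
have : s.+1 ^ 2 < n by rewrite ltnNge; apply/negP => /smin; rewrite ltnn.
by rewrite -!mulnn; nia.
Qed.

(** In units of c sqrt(m), the separator has size at most 15 * 2 = 30 and each of the two classes
    contributes at most 4/9 of 270; and 30 + 2 * 120 = 270. The proof squares this, using (y + z)^2
    <= 9 y^2 + 9/8 z^2, which is sharp at z = 8 y. *)
Lemma hits_arith (c s m x sz u v : nat) : x <= sz + (u + v) ->
  81 * u ^ 2 <= 16 * (270 * 270 * c ^ 2 * m) -> 81 * v ^ 2 <= 16 * (270 * 270 * c ^ 2 * m) ->
  sz <= 15 * (c * s) -> s ^ 2 <= 4 * m -> x ^ 2 <= 270 * 270 * c ^ 2 * m.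
Proof.
move=> hx hu hv hsz hs.
have hsz2 : sz ^ 2 <= 900 * (c ^ 2 * m).
  apply: (@leq_trans ((15 * (c * s)) ^ 2)); first by rewrite leq_exp2r.
  rewrite !expnMn; have -> : 900 * (c ^ 2 * m) = 15 ^ 2 * (c ^ 2 * (4 * m)) by ring.
  by rewrite leq_mul2l leq_mul2l hs !orbT.
have hx2 : x ^ 2 <= (sz + (u + v)) ^ 2 by rewrite leq_exp2r.
have [h1 _] := nat_Cauchy u v.
have h2 : (u + v) ^ 2 <= 2 * u ^ 2 + 2 * v ^ 2 by rewrite sqrnD; lia.
have [h3 _] := nat_Cauchy (8 * sz) (u + v).
have h4 : 8 * (sz + (u + v)) ^ 2 <= 72 * sz ^ 2 + 9 * (u + v) ^ 2.
  move: h3; rewrite (sqrnD sz) expnMn; move: (sz ^ 2) ((u + v) ^ 2) => y z.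
  have -> : 8 * sz * (u + v) = 8 * (sz * (u + v)) by ring.
  by move: (sz * (u + v)) => t; lia.
move: hx2 h2 h4 hu hv hsz2.
have -> : 270 * 270 * c ^ 2 * m = 270 * 270 * (c ^ 2 * m) by ring.
move: (x ^ 2) ((sz + (u + v)) ^ 2) (sz ^ 2) ((u + v) ^ 2) (u ^ 2) (v ^ 2) (c ^ 2 * m) => a1 a2 a3 a4 a5 a6 a7; lia.
Qed.

Section Layout.
Variables (R : realFieldType) (I : finType) (pt : I -> R * R) (i0 : I).
Hypothesis pt_inj : injective pt.
Hypothesis gp : forall i j k l, uniq [:: i; j; k] -> is_line l ->
  ~ (affine l (pt i) = 0 /\ affine l (pt j) = 0 /\ affine l (pt k) = 0)%R.
Variables (V : finType) (tch : rel {set V}) (E : {set {set V}}) (c : nat).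
Hypothesis tch_refl : reflexive tch.
Hypothesis tch_sym : symmetric tch.
Hypothesis E_pair : forall e, e \in E -> exists u v, u != v /\ e = [set u; v]%SET.
Hypothesis share_tch : forall e f v, e \in E -> f \in E -> v \in e -> v \in f -> tch e f.
Implicit Types (e f : {set V}) (A B S K : {set {set V}}) (U : {set V}) (u v : V)
  (P : {set I}) (pos : V -> I) (s k h : nat).

Local Notation M := (touch_pairs tch).

Hypothesis sep : forall A s, A \subset E -> M A <= s ^ 2 ->
  exists S, [/\ S \subset A, #|S| <= c * s & forall K, K \subset (A :\: S)%SET ->
    (forall e f, e \in K -> f \in K -> linked tch K e f) ->
    3 * \sum_(e in K) touch_deg tch A e <= 2 * M A].

Definition on_edge pos e (z : R * R) : Prop := exists u v t,
  [/\ u \in e, v \in e, (0 <= t <= 1)%R & z = mix t (pt (pos u)) (pt (pos v))].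

(** Common ends count as well, which only enlarges the number to be bounded. *)
Definition cross pos e f : bool := `[< exists z, on_edge pos e z /\ on_edge pos f z >].

Definition line_hits pos l e : bool := `[< exists u v, [/\ u \in e, v \in e,
  (affine l (pt (pos u)) <= 0)%R & (0 <= affine l (pt (pos v)))%R] >].

Let line_hits_ext pos pos' l e : {in e, pos =1 pos'} ->
  line_hits pos l e = line_hits pos' l e.
Proof.
move=> pe; apply: asbool_equiv_eq; split=> -[u [v [ue ve h1 h2]]]; exists u, v.
  by rewrite -!pe.
by rewrite !pe.
Qed.

Let cross_ext pos pos' e f : {in e, pos =1 pos'} -> {in f, pos =1 pos'} ->
  cross pos e f = cross pos' e f.
Proof.
have ext (q q' : V -> I) (k : {set V}) z : {in k, q =1 q'} -> on_edge q k z -> on_edge q' k z.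
  by move=> qe [u [v [t [uk vk t01 ->]]]]; exists u, v, t; rewrite !qe.
move=> pe pf; have pe' : {in e, pos' =1 pos} by move=> v /pe.
have pf' : {in f, pos' =1 pos} by move=> v /pf.
apply: asbool_equiv_eq; split=> -[z [ze zf]]; exists z; split.
- exact: ext pe ze.
- exact: ext pf zf.
- exact: ext pe' ze.
- exact: ext pf' zf.
Qed.

Let cross_line pos e u v : e = [set u; v]%SET -> pos u != pos v ->
  exists2 l, is_line l & forall f, cross pos e f -> line_hits pos l f.
Proof.
move=> eE uv; set p := pt (pos u); set q := pt (pos v).
pose l := (p.2 - q.2, q.1 - p.1, p.1 * q.2 - p.2 * q.1)%R.
have pq : p != q by rewrite (inj_eq pt_inj).
exists l.
  apply: contraNneq pq => -[/eqP h1 /eqP h2]; move: h1 h2; rewrite !subr_eq0.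
  by case: (p) (q) => [p1 p2] [q1 q2] /= /eqP-> /eqP->.
have lp : (affine l p = 0)%R by rewrite /affine /l /=; ring.
have lq : (affine l q = 0)%R by rewrite /affine /l /=; ring.
move=> g /asboolP [z [[u1 [v1 [t [u1e v1e t01 ze]]]] [u2 [v2 [t' [u2f v2f t01' ze']]]]]].
have l0 w : w \in e -> (affine l (pt (pos w)) = 0)%R.
  by rewrite eE !finset.inE => /orP[] /eqP->.
have lz : (affine l z = 0)%R by rewrite ze affine_mix !l0 //; ring.
apply/asboolP; move: lz; rewrite ze' affine_mix.
set x := affine l _; set y := affine l _ => xy; case/andP: t01' => t0 t1.
have [x0|x0] := leP x 0%R; have [y0|y0] := leP y 0%R.
- have [t00|tn] := eqVneq t' 0%R.
    have x00 : x = 0%R by move: xy; rewrite t00; lra.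
    by exists u2, u2; split=> //; rewrite -/x x00.
  have y00 : y = 0%R.
    apply/le_anti; rewrite y0 /=; have : (0 <= t' * y)%R.
      have : ((1 - t') * x <= 0)%R by rewrite mulr_ge0_le0 ?subr_ge0.
      by move: xy; lra.
    by rewrite pmulr_rge0 // lt_neqAle eq_sym tn.
  by exists v2, v2; split=> //; rewrite -/y y00.
- by exists u2, v2; split=> //; rewrite -/y ltW.
- by exists v2, u2; split=> //; rewrite -/x ltW.
- have [t00|tn] := eqVneq t' 0%R; first by move: xy x0; rewrite t00; lra.
  have : (0 < t' * y)%R by rewrite mulr_gt0 // lt_neqAle eq_sym tn.
  have : (0 <= (1 - t') * x)%R by rewrite mulr_ge0 ?subr_ge0 // ltW.
  by move: xy; lra.
Qed.

Let place U P : #|U| <= #|P| ->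
  exists pos, {in U &, injective pos} /\ forall v, v \in U -> pos v \in P.
Proof.
move=> UP; pose pos v := nth i0 (enum P) (seq.index v (enum U)); exists pos.
have lt v : v \in U -> seq.index v (enum U) < size (enum P).
  by move=> vU; rewrite -cardE; apply: leq_trans UP; rewrite cardE index_mem mem_enum.
split=> [u v uU vU /eqP|v vU].
  rewrite /pos nth_uniq ?lt ?enum_uniq // => /eqP e.
  by rewrite -(nth_index u (_ : u \in enum U)) ?mem_enum // e nth_index ?mem_enum.
by rewrite -mem_enum mem_nth ?lt.
Qed.

Let touch_pairs0 A : M A = 0 -> A = finset.set0.
Proof.
move=> M0; apply/eqP; apply: contra_eqT M0 => /set0Pn[e eA].
rewrite -lt0n /touch_pairs (bigD1 e) //= addn_gt0; apply/orP; left.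
by apply/card_gt0P; exists e; rewrite finset.inE eA tch_refl.
Qed.

Let E_neq0 e : e \in E -> exists v, v \in e.
Proof. by move=> /E_pair[u [v [_ ->]]]; exists u; rewrite !finset.inE eqxx. Qed.

(* Each cluster receives one colour class; a line meets at most two clusters,
   and the crossing segments of one step all lie on few lines. *)
Lemma layout h A U P : A \subset E ->
  (forall e, e \in A -> e \subset U) -> M A < 5 ^ h -> #|U| * cluster_factor 16 ^ h <= #|P| ->
  exists pos, [/\ {in U &, injective pos}, forall v, v \in U -> pos v \in P,
    forall l, is_line l -> #|[set e in A | line_hits pos l e]%SET| ^ 2 <= 270 * 270 * c ^ 2 * M A &
    \sum_(e in A) \sum_(f in A) cross pos e f <= 180 * 180 * c ^ 2 * h * M A].
Proof.
have K0 : 0 < cluster_factor 16 by rewrite !muln_gt0 expn_gt0.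
have HK := separated_family gp (N := 16).
move: (cluster_factor 16) K0 HK => K K0 HK.
elim: h A U P => [|h IH] A U P AE AU Mh UP.
  have A0 : A = finset.set0 by apply: touch_pairs0; move: Mh; rewrite expn0; lia.
  have [|pos [pi pP]] := @place U P; first by rewrite -[#|U|]muln1.
  exists pos; split=> // [l _|]; last by rewrite A0 big1 // => e; rewrite finset.inE.
  rewrite A0; set B := finset _; have -> : B = finset.set0 by apply/finset.setP => e; rewrite !finset.inE.
  by rewrite finset.cards0.
have [M0|M0] := posnP (M A).
  have A0 : A = finset.set0 by apply: touch_pairs0.
  have [|pos [pi pP]] := @place U P.
    by apply: leq_trans UP; rewrite leq_pmulr // expn_gt0 K0.
  exists pos; split=> // [l _|]; last by rewrite A0 big1 // => e; rewrite finset.inE.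
  rewrite A0; set B := finset _; have -> : B = finset.set0 by apply/finset.setP => e; rewrite !finset.inE.
  by rewrite finset.cards0.
have [s Ms sM] := nat_sqrt_up M0.
have [S [col [SA cS col16 colE MC]]] :=
  split_pow tch_sym E_neq0 share_tch sep 4 AE Ms.
pose n := #|U| * K ^ h.
have [|F [FP cF sepF]] := HK P n.
  by apply: leq_trans UP; rewrite /n expnS mulnCA mulnA.
pose C (a : nat) := color_class A S col a.
have CA a : C a \subset A.
  by apply: fintype.subset_trans (color_class_sub _ _ _ _) (finset.subsetDl _ _).
have CP a e : e \in C a -> e \in (A :\: S)%SET /\ forall v, v \in e -> col v = a.
  rewrite /C /color_class finset.in_set => /andP[h1 /forallP h2]; split=> // v ve.
  by have /implyP/(_ ve)/eqP := h2 v.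
pose Ua (a : nat) := [set v in U | col v == a]%SET.
have /choice [p pP] (a : 'I_16) : exists pos, [/\ {in Ua a &, injective pos},
    forall v, v \in Ua a -> pos v \in F a,
    forall l, is_line l -> #|[set e in C a | line_hits pos l e]%SET| ^ 2 <= 270 * 270 * c ^ 2 * M (C a) &
    \sum_(e in C a) \sum_(f in C a) cross pos e f <= 180 * 180 * c ^ 2 * h * M (C a)].
  apply: IH.
  - exact: fintype.subset_trans (CA a) AE.
  - move=> e eC; have [eAS ca] := CP _ _ eC; apply/fintype.subsetP => v ve.
    rewrite finset.inE ca // eqxx andbT; apply: (fintype.subsetP (AU e _)) => //.
    exact: (fintype.subsetP (CA a)).
  (* One level gains a factor 5 in the touching pairs, as 16 * 5 < 81. *)
  - have := MC a; have -> : 3 ^ 4 = 81 by []; have -> : 2 ^ 4 = 16 by [].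
    by move: Mh; rewrite expnS -/(C a); lia.
  - apply: leq_trans (cF a); rewrite /n leq_mul2r; apply/orP; right.
    by apply: subset_leq_card; apply/fintype.subsetP => v; rewrite finset.inE => /andP[].
pose cl v : 'I_16 := Ordinal (col16 v).
pose pos v := p (cl v) v.
have posC (a : 'I_16) e v : e \in C a -> v \in e -> pos v = p a v.
  by move=> /CP[_ h1] ve; rewrite /pos; congr (p _ v); apply: val_inj; exact: h1.
have clU v : v \in U -> v \in Ua (cl v) by move=> vU; rewrite finset.inE vU /=.
have posF v : v \in U -> pos v \in F (cl v).
  by move=> /clU vU; have [_ h1 _ _] := pP (cl v); apply: h1.
have Fdis (a b : 'I_16) i : i \in F a -> i \in F b -> a = b.
  move=> ia ib; apply/eqP/negPn/negP => ab.
  have t0 : ((0 : R) <= (0 : R) <= 1)%R by apply/andP; split; rewrite ?lexx ?ler01.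
  by have := disjoint_hulls sepF isT ab ia ia ib ib t0 t0; rewrite eqxx.
have pos_inj : {in U &, injective pos}.
  move=> u v uU vU uv; have cuv : cl u = cl v.
    by apply: (Fdis _ _ (pos u)); rewrite ?posF // uv posF.
  have [h1 _ _ _] := pP (cl v); apply: h1; [by rewrite -cuv clU|exact: clU|].
  by move: uv; rewrite /pos cuv.
have hitsC (a : 'I_16) l e : e \in C a -> line_hits pos l e = line_hits (p a) l e.
  by move=> eC; apply: line_hits_ext => v ve; apply: (posC a e).
have crossC (a : 'I_16) e f : e \in C a -> f \in C a -> cross pos e f = cross (p a) e f.
  by move=> eC fC; apply: cross_ext => v ve; [apply: (posC a e)|apply: (posC a f)].
have eU e v : e \in A -> v \in e -> v \in U by move=> /AU/fintype.subsetP; apply.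
have colE' e : e \in (A :\: S)%SET -> exists a : 'I_16, e \in C a.
  move=> eA; have [i eC] := colE e eA.
  have [v ve] : exists v, v \in e.
    by apply: E_neq0; apply: (fintype.subsetP AE); move: eA; rewrite finset.inE => /andP[].
  have [_ ci] := CP _ _ eC; have i16 : i < 16 by rewrite -(ci v ve).
  by exists (Ordinal i16).
have hits_cl l (a : 'I_16) e : e \in C a -> line_hits pos l e -> exists i j,
    [/\ i \in F a, j \in F a, (affine l (pt i) <= 0)%R & (0 <= affine l (pt j))%R].
  move=> eC /asboolP[u [v [ue ve h1 h2]]]; exists (pos u), (pos v).
  have [eAS ca] := CP _ _ eC; have eA := fintype.subsetP (CA a) _ eC.
  have cla w : w \in e -> cl w = a by move=> we; apply: val_inj; exact: ca.
  by split=> //; [rewrite -(cla u ue)|rewrite -(cla v ve)]; apply: posF; apply: (eU e).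
have two l : is_line l -> exists a b : 'I_16, forall e, e \in (A :\: S)%SET -> line_hits pos l e ->
    (e \in C a) || (e \in C b).
  move=> ln; apply: contrapT => nex.
  have next (a b : 'I_16) : exists d : 'I_16, [/\ d != a, d != b & exists2 e, e \in C d & line_hits pos l e].
    apply: contrapT => nd; apply: nex; exists a, b => e eA he.
    have [d ed] := colE' e eA; apply/negPn/negP; rewrite negb_or => /andP[ea eb].
    apply: nd; exists d; split; last by exists e.
      by apply: contraNneq ea => <-.
    by apply: contraNneq eb => <-.
  have [a [_ _ [ea eaC ha]]] := next ord0 ord0.
  have [b [ba _ [eb ebC hb]]] := next a a.
  have [d [da db [ed edC hd]]] := next a b.
  have ab : a != b by rewrite eq_sym.
  apply: (line_hits_two sepF ln ab da db) => x; rewrite !inE => /or3P[] /eqP->.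
  - exact: hits_cl eaC ha.
  - exact: hits_cl ebC hb.
  - exact: hits_cl edC hd.
have cS15 : #|S| <= 15 * (c * s) by [].
have hitsA l : is_line l -> #|[set e in A | line_hits pos l e]%SET| ^ 2 <= 270 * 270 * c ^ 2 * M A.
  move=> ln; have [a [b hab]] := two l ln.
  pose H (a : 'I_16) := [set e in C a | line_hits (p a) l e]%SET.
  have sub : [set e in A | line_hits pos l e]%SET \subset (S :|: (H a :|: H b))%SET.
    apply/fintype.subsetP => e; rewrite finset.in_set => /andP[eA he].
    rewrite !finset.in_setU; have [//|eS] := boolP (e \in S).
    have eAS : e \in (A :\: S)%SET by rewrite finset.inE eS.
    have /orP[eC|eC] := hab e eAS he.
      by rewrite /= [e \in H a]finset.in_set eC -(hitsC a) // he.
    by rewrite /= [e \in H b]finset.in_set eC -(hitsC b) // he orbT.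
  have Hb (d : 'I_16) : 81 * #|H d| ^ 2 <= 16 * (270 * 270 * c ^ 2 * M A).
    have [_ _ h1 _] := pP d; have := h1 l ln; rewrite -/(H d) => h2.
    have := MC d; have -> : 3 ^ 4 = 81 by []; have -> : 2 ^ 4 = 16 by [].
    rewrite -/(C d) => h3; apply: (@leq_trans (81 * (270 * 270 * c ^ 2 * M (C d)))); first by rewrite leq_mul2l.
    by rewrite mulnCA [leqRHS]mulnCA leq_mul2l h3 orbT.
  have := subset_leq_card sub.
  move=> /leq_trans /(_ (leq_trans (leq_card_setU _ _) (leq_add (leqnn _) (leq_card_setU _ _)))).
  move=> h1; apply: hits_arith h1 (Hb a) (Hb b) cS15 sM.
exists pos; split=> //.
  by move=> v vU; apply: (fintype.subsetP (FP (cl v))); apply: posF.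
have crossS e : e \in S -> \sum_(f in A) cross pos e f <= 270 * (c * s).
  move=> eS; have eA := fintype.subsetP SA _ eS.
  have [u [v [uv eE]]] := E_pair (fintype.subsetP AE _ eA).
  have [|l ln lh] := @cross_line pos e u v eE.
    by apply: contraNneq uv => /pos_inj ->; rewrite // (eU e) // eE !finset.inE eqxx ?orbT.
  apply: (@leq_trans #|[set f in A | line_hits pos l f]%SET|).
    rewrite -sum1_card big_mkcond [leqRHS]big_mkcond; apply: leq_sum => f _ /=.
    rewrite finset.inE; case: (f \in A) => //=.
    by case cr : (cross pos e f) => //; rewrite lh.
  rewrite -(@leq_exp2r _ _ 2) //; apply: leq_trans (hitsA l ln) _.
  by rewrite !expnMn -mulnA leq_mul // leq_mul.
have cross_sym e f : cross pos e f = cross pos f e.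
  by apply: asbool_equiv_eq; split=> -[z [h1 h2]]; exists z.
(* There are [15 * (c * s)] deleted edges with [270 * (c * s)] crossings each, and
   [s ^ 2 <= 4 * M A]. Counting both orders gives the [180 * 180] of one level. *)
have crossSA : \sum_(e in S) \sum_(f in A) cross pos e f <= 90 * 180 * c ^ 2 * M A.
  apply: (@leq_trans (\sum_(e in S) 270 * (c * s))); first exact: leq_sum.
  rewrite sum_nat_const; apply: (@leq_trans (15 * (c * s) * (270 * (c * s)))); first by rewrite leq_mul2r cS15 orbT.
  have -> : 15 * (c * s) * (270 * (c * s)) = 45 * 90 * c ^ 2 * s ^ 2 by rewrite -!mulnn; ring.
  have -> : 90 * 180 * c ^ 2 * M A = 45 * 90 * c ^ 2 * (4 * M A) by ring.
  by rewrite leq_mul2l sM orbT.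
have crossAS : \sum_(e in (A :\: S)%SET) \sum_(f in S) cross pos e f <= 90 * 180 * c ^ 2 * M A.
  apply: leq_trans crossSA; rewrite exchange_big /=; apply: leq_sum => e _.
  rewrite (eq_bigr (fun f => nat_of_bool (cross pos e f))); last by move=> f _; rewrite cross_sym.
  by apply: leq_sum_sub; apply: finset.subsetDl.
have ce e : exists a : 'I_16, e \in (A :\: S)%SET -> e \in C a.
  by have [/colE'[a ea]|] := boolP (e \in (A :\: S)%SET); [exists a|exists ord0].
have {ce}/choice [g gP] := ce.
have part (G : 'I_16 -> {set V} -> nat) :
    \sum_(e in (A :\: S)%SET) G (g e) e <= \sum_(a < 16) \sum_(e in C a) G a e.
  rewrite (partition_big g predT) //=; apply: leq_sum => a _.
  rewrite big_mkcond [leqRHS]big_mkcond; apply: leq_sum => e _ /=.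
  case: ifP => // /andP[eA /eqP ga]; by rewrite -ga (gP e eA).
have MCsum : \sum_(a < 16) M (C a) <= M A.
  have Cdis (a : 'I_16) e : e \in C a -> e \in (A :\: S)%SET /\ g e = a.
    move=> eC; have [eA ca] := CP _ _ eC; split=> //.
    have [v ve] : exists v, v \in e.
      by apply: E_neq0; apply: (fintype.subsetP AE); apply: (fintype.subsetP (CA a)).
    by apply: val_inj; rewrite /= -(ca v ve); have [_ ->] := CP _ _ (gP e eA).
  apply: (@leq_trans (\sum_(a < 16) \sum_(e in C a) touch_deg tch A e)).
    by apply: leq_sum => a _; apply: leq_sum => e _; apply: touch_deg_sub.
  apply: (@leq_trans (\sum_(e in (A :\: S)%SET) touch_deg tch A e)); last first.
    by apply: leq_sum_sub; apply: finset.subsetDl.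
  rewrite [leqRHS](partition_big g predT) //=; apply: leq_sum => a _.
  rewrite big_mkcond [leqRHS]big_mkcond; apply: leq_sum => e _ /=.
  by case: ifP => // /Cdis[-> ->]; rewrite eqxx.
have inner : \sum_(e in (A :\: S)%SET) \sum_(f in (A :\: S)%SET) cross pos e f <=
    \sum_(a < 16) \sum_(e in C a) \sum_(f in C a) cross (p a) e f.
  apply: leq_trans (part (fun a e => \sum_(f in C a) cross (p a) e f)).
  apply: leq_sum => e eA; rewrite big_mkcond [leqRHS]big_mkcond; apply: leq_sum => f _ /=.
  have [fA|//] := boolP (f \in (A :\: S)%SET).
  have eC := gP e eA; have fC := gP f fA.
  have [gg|gg] := eqVneq (g f) (g e).
    by rewrite -gg fC -(crossC (g f)) // gg.
  case cr : (cross pos e f) => //; exfalso.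
  move/asboolP: cr => [z [[u [v [t [ue ve t01 ze]]]] [u' [v' [t' [uf vf t01' zf]]]]]].
  have eA' : e \in A by move: eA; rewrite finset.inE => /andP[].
  have fA' : f \in A by move: fA; rewrite finset.inE => /andP[].
  have pF (k : {set V}) w : k \in A -> k \in (A :\: S)%SET -> w \in k -> pos w \in F (g k).
    move=> kA kAS wk; have -> : g k = cl w.
      by apply: val_inj; have [_ h1] := CP _ _ (gP k kAS); rewrite /= h1.
    by apply: posF; apply: (eU k).
  have := disjoint_hulls sepF isT gg (pF _ _ fA' fA uf) (pF _ _ fA' fA vf)
    (pF _ _ eA' eA ue) (pF _ _ eA' eA ve) t01' t01.
  by rewrite -ze -zf eqxx.
have innerB : \sum_(e in (A :\: S)%SET) \sum_(f in (A :\: S)%SET) cross pos e f <=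
    180 * 180 * c ^ 2 * h * M A.
  apply: leq_trans inner _; apply: (@leq_trans (\sum_(a < 16) 180 * 180 * c ^ 2 * h * M (C a))).
    by apply: leq_sum => a _; have [_ _ _] := pP a.
  by rewrite -big_distrr leq_mul2l MCsum orbT.
rewrite (big_setID S) /= (finset.setIidPr SA).
have -> : \sum_(e in (A :\: S)%SET) \sum_(f in A) cross pos e f =
   \sum_(e in (A :\: S)%SET) \sum_(f in S) cross pos e f +
   \sum_(e in (A :\: S)%SET) \sum_(f in (A :\: S)%SET) cross pos e f.
  by rewrite -big_split; apply: eq_bigr => e _; rewrite (big_setID S) /= (finset.setIidPr SA).
have -> : 180 * 180 * c ^ 2 * h.+1 * M A = 90 * 180 * c ^ 2 * M A + (90 * 180 * c ^ 2 * M A +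
    180 * 180 * c ^ 2 * h * M A) by ring.
by apply: leq_add => //; apply: leq_add.
Qed.

End Layout.

(** * From curves to lattice points *)

Section Discretization.
Local Open Scope ring_scope.
Variable R : realType.
Implicit Types (p q : R * R) (z u : int * int) (A B : set (R * R)) (s d : R).

Definition close d p q : Prop := `|p.1 - q.1| < d /\ `|p.2 - q.2| < d.

Lemma compact_gap A B : compact A -> compact B -> A `&` B = set0 ->
  \forall d \near 0^'+, forall p q, A p -> B q -> ~ close d p q.
Proof.
move=> cA cB AB.
have clB : closed B by apply: compact_closed cB; exact: norm_hausdorff.
have /compact_near_coveringP ncA := cA.
suff : \forall d \near 0^'+, A `<=` (fun p => forall q, B q -> ~ close d p q).
  by apply: filterS => d h p q Ap; apply: h.
apply: (ncA R (0^'+) (fun d p => forall q, B q -> ~ close d p q)) => p Ap.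
have nBp : nbhs p (~` B).
  by apply: open_nbhs_nbhs; split; [rewrite openC|move=> Bp; have : (A `&` B) p by []; rewrite AB].
have [e /= e0 eB] := (@nbhs_ballP _ _ _ _).1 nBp.
have e20 : 0 < e / 2 by rewrite divr_gt0.
exists (ball p (e / 2), [set d | d < e / 2]); first split => /=.
- exact: nbhsx_ballx.
- exact: nbhs_right_lt.
move=> [p' d] /= [pp' de] q Bq p'q; apply: (eB q) => //.
rewrite [e]splitr; apply: ball_triangle pp' _.
exact: (le_ball (ltW de)).
Qed.

Let near s p : set (int * int) :=
  [set z | `|z.1%:~R - p.1 / s| <= 1 /\ `|z.2%:~R - p.2 / s| <= 1].

Let near1 (a b : R) : `|a - b| < 1 -> exists t : int, `|t%:~R - a| <= 1 /\ `|t%:~R - b| <= 1.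
Proof.
wlog ab : a b / b <= a.
  have [ab|/ltW ab] := leP b a; first by move=> h; exact: (h _ _ ab).
  by move=> h; rewrite distrC => /(h _ _ ab)[t [t1 t2]]; exists t.
rewrite ger0_norm ?subr_ge0 // => h; exists (Num.floor a).
have := floor_le a; have := floorD1_gt a; rewrite intrD /= => h1 h2.
by rewrite !ler_norml; split; apply/andP; split; lra.
Qed.

Let near_meets s p q : 0 < s -> close s p q -> exists z, near s p z /\ near s q z.
Proof.
move=> s0 [h1 h2].
have dv (x y : R) : `|x - y| < s -> `|x / s - y / s| < 1.
  by move=> h; rewrite -mulrBl normrM [X in _ * X]gtr0_norm ?invr_gt0 // ltr_pdivrMr ?mul1r.
have [t1 [a1 b1]] := near1 (dv _ _ h1); have [t2 [a2 b2]] := near1 (dv _ _ h2).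
by exists (t1, t2).
Qed.

Let conn_hor (C : set (int * int)) (y x x' : int) :
  (forall t : int, Num.min x x' <= t <= Num.max x x' -> C (t, y)) -> conn lat_adj C (x, y) (x', y).
Proof.
wlog xx : x x' / x <= x'.
  case/orP: (le_total x x') => xx; first by move=> h; exact: (h _ _ xx).
  move=> h hC; apply: conn_sym; first exact: lat_adj_sym.
  by apply: h => // t; rewrite minC maxC; apply: hC.
rewrite (min_idPl xx) (max_idPr xx) => hC.
have -> : x' = x + `|x' - x|%N%:Z by lia.
have : forall t : int, x <= t <= x + `|x' - x|%N%:Z -> C (t, y) by move=> t ht; apply: hC; lia.
elim: `|x' - x|%N => [|n IH] {}hC.
  by rewrite addr0; apply: conn_refl; apply: hC; lia.
apply: (@conn_step _ _ _ _ (x + n%:Z, y)); first by apply: IH => t ht; apply: hC; lia.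
  by rewrite /lat_adj /=; lia.
by apply: hC; lia.
Qed.

Let conn_ver (C : set (int * int)) (y x x' : int) :
  (forall t : int, Num.min x x' <= t <= Num.max x x' -> C (y, t)) -> conn lat_adj C (y, x) (y, x').
Proof.
wlog xx : x x' / x <= x'.
  case/orP: (le_total x x') => xx; first by move=> h; exact: (h _ _ xx).
  move=> h hC; apply: conn_sym; first exact: lat_adj_sym.
  by apply: h => // t; rewrite minC maxC; apply: hC.
rewrite (min_idPl xx) (max_idPr xx) => hC.
have -> : x' = x + `|x' - x|%N%:Z by lia.
have : forall t : int, x <= t <= x + `|x' - x|%N%:Z -> C (y, t) by move=> t ht; apply: hC; lia.
elim: `|x' - x|%N => [|n IH] {}hC.
  by rewrite addr0; apply: conn_refl; apply: hC; lia.
apply: (@conn_step _ _ _ _ (y, x + n%:Z)); first by apply: IH => t ht; apply: hC; lia.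
  by rewrite /lat_adj /=; lia.
by apply: hC; lia.
Qed.

Let near_conn s p z u : near s p z -> near s p u -> conn lat_adj (near s p) z u.
Proof.
case: z u => [z1 z2] [u1 u2] [/= h1 h2] [/= h3 h4].
have conv (a : R) (x x' t : int) : `|x%:~R - a| <= 1 -> `|x'%:~R - a| <= 1 ->
    Num.min x x' <= t <= Num.max x x' -> `|t%:~R - a| <= 1.
  wlog xx : x x' / x <= x'.
    case/orP: (le_total x x') => xx; first by move=> h; exact: (h _ _ xx).
    by move=> h hx hx'; rewrite minC maxC; exact: (h _ _ xx).
  rewrite (min_idPl xx) (max_idPr xx) -!(ler_int R) !ler_norml => /andP[? ?] /andP[? ?] /andP[? ?].
  by apply/andP; split; lra.
apply: (@conn_trans _ _ _ _ (u1, z2)).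
  by apply: conn_hor => t ht; split=> //=; apply: conv ht.
by apply: conn_ver => t ht; split=> //=; apply: conv ht.
Qed.

(** By the step hypothesis both the points of [A] with [P] and those without are relatively open,
    and the former exist. *)
Let connected_chain s A (P : R * R -> Prop) p0 : 0 < s -> connected A -> A p0 -> P p0 ->
  (forall p q, A p -> A q -> close s p q -> P p -> P q) -> forall p, A p -> P p.
Proof.
move=> s0 Ac A0 P0 Pstep.
have cs p q : close s p q -> close s q p by move=> [? ?]; split; rewrite distrC.
suff -> : A = A `&` P by move=> p [].
apply/esym/Ac.
- by exists p0.
- exists (\bigcup_(q in A `&` P) (ball q s)°); first by apply: bigcup_open => q _; apply: open_interior.
  apply/seteqP; split=> p [Ap].
    by move=> Pp; split=> //; exists p => //; apply: nbhsx_ballx.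
  move=> [q [Aq Pq] /interior_subset qp]; split=> //; exact: Pstep Pq.
- exists (~` \bigcup_(q in A `&` ~` P) (ball q s)°).
    by apply: open_closedC; apply: bigcup_open => q _; apply: open_interior.
  apply/seteqP; split=> p [Ap].
    move=> Pp; split=> // -[q [Aq nPq] /interior_subset qp]; apply: nPq.
    by apply: Pstep Pp => //; apply: cs.
  move=> h; split=> //; apply: contrapT => nP; apply: h; exists p => //.
  exact: nbhsx_ballx.
Qed.

(* Each set is replaced by the points near it of a lattice finer than a third of
   every gap between disjoint sets of the family. *)
Lemma discretize (X : finType) (A : X -> set (R * R)) :
  (forall x, compact (A x)) -> (forall x, connected (A x)) -> (forall x, A x !=set0) ->
  exists C : X -> set (int * int), [/\ forall x, C x !=set0,
    forall x z u, C x z -> C x u -> conn lat_adj (C x) z u &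
    forall x y, C x `&` C y !=set0 <-> A x `&` A y !=set0].
Proof.
move=> Acp Acn A0.
have ev : \forall d \near 0^'+, forall xy : X * X, A xy.1 `&` A xy.2 = set0 ->
    forall p q, A xy.1 p -> A xy.2 q -> ~ close d p q.
  apply: filter_forall => xy; have [e|ne] := pselect (A xy.1 `&` A xy.2 = set0).
    by have := compact_gap (Acp xy.1) (Acp xy.2) e; apply: filterS => d h _.
  by near=> d => /ne.
have [d dP] := @filter_ex _ _ (at_right_proper_filter (0 : R)) _ (filterI ev (nbhs_right_gt (0 : R))).
have [gap d0] : (forall xy : X * X, A xy.1 `&` A xy.2 = set0 ->
    forall p q, A xy.1 p -> A xy.2 q -> ~ close d p q) /\ 0 < d := dP.
(* Two points near a common lattice point differ by at most [2 * s < d] in each coordinate, so their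
   sets cannot be disjoint. *)
pose s := d / 3; have s0 : 0 < s by rewrite divr_gt0.
exists (fun x => \bigcup_(p in A x) near s p); split=> [x|x z u|x y].
- have [p Ap] := A0 x; have [||z [pz _]] := @near_meets s p p => //.
    by split; rewrite subrr normr0.
  by exists z, p.
- move=> [p Ap pz] [q Aq qu].
  have sub p' : A x p' -> near s p' `<=` \bigcup_(p in A x) near s p by move=> Ap' v; exists p'.
  have := @connected_chain s (A x) (fun p' => forall v, near s p' v ->
    conn lat_adj (\bigcup_(p in A x) near s p) z v) p s0 (Acn x) Ap _ _ q Aq u qu.
  apply.
    by move=> v pv; apply: conn_sub (near_conn pz pv); apply: sub.
  move=> p1 p2 Ap1 Ap2 c12 IH v p2v; have [v0 [v1 v2]] := near_meets s0 c12.
  apply: (conn_trans (IH v0 v1)).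
  by apply: conn_sub (near_conn v2 p2v); apply: sub.
- split=> [[z [[p Ap [/= p1 p2]] [q Aq [/= q1 q2]]]]|[p [px py]]].
    apply: contrapT => /set0P/negP/negPn/eqP e; have := gap (x, y) e p q Ap Aq; apply.
    have dv (a b c : R) : `|c - a / s| <= 1 -> `|c - b / s| <= 1 -> `|a - b| < d.
      rewrite !ler_norml ltr_norml => /andP[h1 h2] /andP[h3 h4].
      have aE : a = a / s * s by rewrite mulfVK // gt_eqF.
      have bE : b = b / s * s by rewrite mulfVK // gt_eqF.
      have dE : d = 3 * s by rewrite /s mulrC divfK.
      by rewrite aE bE dE -mulrBl; apply/andP; split; nra.
    by split; [apply: dv p1 q1|apply: dv p2 q2].
  have [||z [pz _]] := @near_meets s p p => //; first by split; rewrite subrr normr0.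
  by exists z; split; exists p.
Unshelve. all: by end_near. Qed.

End Discretization.

(** * Straight-line drawings *)

Section ChordsOfParabola.
Local Open Scope ring_scope.
Variable R : realType.
Implicit Types (a b c x : R).

(* Vanishes when the chords of the parabola y = x^2 over the pairs (a, a'),
   (b, b') and (c, c') are concurrent. *)
Definition concurrency (a a' b b' c c' : R) : R :=
  (a + a') * (b * b' - c * c') + (b + b') * (c * c' - a * a') + (c + c') * (a * a' - b * b').

(** The coefficient of [a] in [concurrency], which is affine in [a]. *)
Definition pencil (a' b b' c c' : R) : R := b * b' - c * c' + a' * (c + c' - b - b').

Let concurrency_linear (a a' b b' c c' : R) :
  concurrency a a' b b' c c' = a * pencil a' b b' c c' + concurrency 0 a' b b' c c'.
Proof. by rewrite /concurrency /pencil; ring. Qed.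

(** If [concurrency] vanished for every [a], the lines of the two fixed chords would coincide or
    would meet at the parabola point of [a']. *)
Let pencil_neq0 (a' b b' c c' : R) : a' != b -> a' != b' -> b != c -> b != c' ->
  pencil a' b b' c c' = 0 -> concurrency 0 a' b b' c c' != 0.
Proof.
move=> ab ab' bc bc' p0; apply/eqP => c0.
have e1 : (b + b' - c - c') * ((a' - b) * (a' - b')) = 0.
  transitivity (concurrency 0 a' b b' c c' + (b + b' - a') * pencil a' b b' c c').
    by rewrite /concurrency /pencil; ring.
  by rewrite c0 p0; ring.
have /eqP := e1; rewrite !mulf_eq0 !subr_eq0 (negbTE ab) (negbTE ab') !orbF => /eqP s0.
have s0' : b' = c + c' - b by lra.
have : (b - c) * (b - c') = 0.
  transitivity (- pencil a' b b' c c'); last by rewrite p0 oppr0.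
  by rewrite /pencil s0'; ring.
by move/eqP; rewrite mulf_eq0 !subr_eq0 (negbTE bc) (negbTE bc').
Qed.

Definition generic (n : nat) (t : nat -> R) : Prop :=
  (forall i j, (i < n)%N -> (j < n)%N -> t i = t j -> i = j) /\
  forall i i' j j' k k' : nat, all (fun m => (m < n)%N) [:: i; i'; j; j'; k; k'] ->
    uniq [:: i; i'; j; j'; k; k'] -> concurrency (t i) (t i') (t j) (t j') (t k) (t k') != 0.

Lemma generic_exists n : exists t, generic n t.
Proof.
elim: n => [|n [t [tinj tgen]]]; first by exists (fun=> 0).
pose root (w : 'I_n * 'I_n * 'I_n * ('I_n * 'I_n)) : R :=
  - concurrency 0 (t w.1.1.1) (t w.1.1.2) (t w.1.2) (t w.2.1) (t w.2.2) /
    pencil (t w.1.1.1) (t w.1.1.2) (t w.1.2) (t w.2.1) (t w.2.2).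
(* Larger than all earlier parameters and than every value at which the new point could create a
   concurrency. *)
pose x := 1 + \sum_(i < n) `|t i| + \sum_w `|root w|.
have xt (i : nat) : (i < n)%N -> x != t i.
  move=> il; rewrite gt_eqF // (le_lt_trans (ler_norm _)) // /x (bigD1 (Ordinal il)) //=.
  have h1 : 0 <= \sum_(i0 < n | i0 != Ordinal il) `|t i0| by apply: sumr_ge0.
  have h2 : 0 <= \sum_w `|root w| by apply: sumr_ge0.
  by lra.
have xr w : x != root w.
  have h0 : `|root w| <= \sum_w `|root w| by rewrite (bigD1 w) //= lerDl sumr_ge0.
  have h1 : 0 <= \sum_(i0 < n) `|t i0| by apply: sumr_ge0.
  by rewrite gt_eqF // (le_lt_trans (ler_norm _)) // /x; lra.
have xgen (i' j j' k k' : nat) : all (fun m => (m < n)%N) [:: i'; j; j'; k; k'] ->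
    uniq [:: i'; j; j'; k; k'] -> concurrency x (t i') (t j) (t j') (t k) (t k') != 0.
  rewrite /= !inE !negb_or => /and5P[i'n jn j'n kn /andP[k'n _]].
  move=> /and5P[/and4P[i1 i2 i3 i4] /and3P[_ j1 j2] _ _ _].
  have tne (u v : nat) : (u < n)%N -> (v < n)%N -> u != v -> t u != t v.
    by move=> un vn; apply: contra_neq; exact: tinj.
  rewrite concurrency_linear.
  have [p0|p0] := eqVneq (pencil (t i') (t j) (t j') (t k) (t k')) 0.
    by rewrite p0 mulr0 add0r; apply: pencil_neq0 p0; apply: tne.
  have := xr ((Ordinal i'n, Ordinal jn, Ordinal j'n), (Ordinal kn, Ordinal k'n)).
  rewrite /root /=; apply: contra_neq => h.
  by apply: (mulIf p0); rewrite mulfVK //; apply/eqP; rewrite -addr_eq0 h.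
exists (fun m => if m == n then x else t m); split=> [i j|i i' j j' k k'].
  rewrite !ltnS; case: eqP => [->|/eqP ni]; case: eqP => [->|/eqP nj] // iln jln e.
  - by have := @xt j; rewrite ltn_neqAle nj jln e eqxx => /(_ isT).
  - by have := @xt i; rewrite ltn_neqAle ni iln e eqxx => /(_ isT).
  - by apply: tinj => //; rewrite ltn_neqAle ?ni ?nj.
move=> hall huniq; pose f m := if m == n then x else t m.
(* Up to sign, [concurrency] is symmetric in the chords and in the ends of each, so the new
   parameter may be moved to the first place. *)
have fgen (l l' j1 j2 k1 k2 : nat) : all (fun m => (m < n.+1)%N) [:: l; l'; j1; j2; k1; k2] ->
    uniq [:: l; l'; j1; j2; k1; k2] -> l == n ->
    concurrency (f l) (f l') (f j1) (f j2) (f k1) (f k2) != 0.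
  move=> hl hu /eqP ln; subst l; move: hu; rewrite cons_uniq => /andP[+ hu']; rewrite !inE !negb_or.
  move=> /and5P[n1 n2 n3 n4 n5]; rewrite /f eqxx ![_ == n]eq_sym.
  rewrite (negbTE n1) (negbTE n2) (negbTE n3) (negbTE n4) (negbTE n5).
  apply: xgen; last exact: hu'; move: hl; rewrite /= !ltnS => /and5P[_ l1 l2 l3 /and3P[l4 l5 _]].
  by rewrite !ltn_neqAle ![_ == n]eq_sym n1 n2 n3 n4 n5 l1 l2 l3 l4 l5.
have perm (s s' : seq nat) : perm_eq s s' -> all (fun m => (m < n.+1)%N) s -> uniq s ->
    all (fun m => (m < n.+1)%N) s' /\ uniq s'.
  by move=> ss h1 h2; rewrite -(perm_all _ ss) -(perm_uniq ss).
have sgn (y z : R) : y != 0 -> z = y \/ z = - y -> z != 0.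
  by move=> y0 [->|->] //; rewrite oppr_eq0.
change (concurrency (f i) (f i') (f j) (f j') (f k) (f k') != 0).
have [i0|ni] := boolP (i == n); first exact: (fgen _ _ _ _ _ _ hall huniq i0).
have [i0|ni'] := boolP (i' == n).
  apply: (sgn (concurrency (f i') (f i) (f j) (f j') (f k) (f k'))); last by left; rewrite /concurrency; ring.
  have [|h1 h2] := perm _ [:: i'; i; j; j'; k; k'] _ hall huniq; last exact: (fgen _ _ _ _ _ _ h1 h2 i0).
  by apply/permP => q /=; lia.
have [i0|nj] := boolP (j == n).
  apply: (sgn (concurrency (f j) (f j') (f i) (f i') (f k) (f k'))); last by right; rewrite /concurrency; ring.
  have [|h1 h2] := perm _ [:: j; j'; i; i'; k; k'] _ hall huniq; last exact: (fgen _ _ _ _ _ _ h1 h2 i0).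
  by apply/permP => q /=; lia.
have [i0|nj'] := boolP (j' == n).
  apply: (sgn (concurrency (f j') (f j) (f i) (f i') (f k) (f k'))); last by right; rewrite /concurrency; ring.
  have [|h1 h2] := perm _ [:: j'; j; i; i'; k; k'] _ hall huniq; last exact: (fgen _ _ _ _ _ _ h1 h2 i0).
  by apply/permP => q /=; lia.
have [i0|nk] := boolP (k == n).
  apply: (sgn (concurrency (f k) (f k') (f j) (f j') (f i) (f i'))); last by right; rewrite /concurrency; ring.
  have [|h1 h2] := perm _ [:: k; k'; j; j'; i; i'] _ hall huniq; last exact: (fgen _ _ _ _ _ _ h1 h2 i0).
  by apply/permP => q /=; lia.
have [i0|nk'] := boolP (k' == n).
  apply: (sgn (concurrency (f k') (f k) (f j) (f j') (f i) (f i'))); last by right; rewrite /concurrency; ring.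
  have [|h1 h2] := perm _ [:: k'; k; j; j'; i; i'] _ hall huniq; last exact: (fgen _ _ _ _ _ _ h1 h2 i0).
  by apply/permP => q /=; lia.
rewrite /f (negbTE ni) (negbTE ni') (negbTE nj) (negbTE nj') (negbTE nk) (negbTE nk').
apply: tgen => //; move: hall; rewrite /= !ltnS => /and5P[l0 l1 l2 l3 /and3P[l4 l5 _]].
by rewrite !ltn_neqAle ni ni' nj nj' nk nk' l0 l1 l2 l3 l4 l5.
Qed.

End ChordsOfParabola.

Section Segments.
Local Open Scope ring_scope.
Variable R : realType.
Implicit Types (p q z : R * R) (s t : R).

Lemma segmentP p q z : segment p q z <-> exists2 t, 0 <= t <= 1 &
  z = ((1 - t) * p.1 + t * q.1, (1 - t) * p.2 + t * q.2).
Proof.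
split=> [[t /= t01 <-]|[t t01 ->]].
  by exists t => //; rewrite in_itv /= in t01.
by exists t; rewrite //= in_itv.
Qed.

Lemma segment_sym p q : segment p q = segment q p.
Proof.
have sub (u v : R * R) : segment u v `<=` segment v u.
  move=> z zs; have [t t01 ->] := (segmentP _ _ _).1 zs; apply: (segmentP _ _ _).2; exists (1 - t); first by lra.
  by congr pair; ring.
by apply/seteqP; split; apply: sub.
Qed.

Lemma affine_map_continuous (a b c a' b' c' : R) :
  continuous (fun z : R * R => (a * z.1 + b * z.2 + c, a' * z.1 + b' * z.2 + c')).
Proof.
have coord (u v w : R) (z : R * R) : (u * z0.1 + v * z0.2 + w) @[z0 --> z] --> u * z.1 + v * z.2 + w.
  apply: cvgD; last exact: cvg_cst.
  by apply: cvgD; apply: cvgM; [exact: cvg_cst|exact: cvg_fst|exact: cvg_cst|exact: cvg_snd].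
by move=> z; exact: (cvg_pair (coord _ _ _ _) (coord _ _ _ _)).
Qed.

Lemma simple_curve_segment p q : p != q -> simple_curve p q (segment p q).
Proof.
move=> pq; exists (fun t => ((1 - t) * p.1 + t * q.1, (1 - t) * p.2 + t * q.2)); split.
- apply: continuous_subspaceT => t.
  have -> : (fun t0 : R => ((1 - t0) * p.1 + t0 * q.1, (1 - t0) * p.2 + t0 * q.2)) =
            (fun t0 : R => ((q.1 - p.1) * t0 + p.1, (q.2 - p.2) * t0 + p.2)).
    by apply/funext => x; congr pair; ring.
  have coord (u v : R) : (u * x + v) @[x --> t] --> u * t + v.
    by apply: cvgD; [apply: cvgM; [exact: cvg_cst|exact: cvg_id]|exact: cvg_cst].
  exact: (cvg_pair (coord _ _) (coord _ _)).
- move=> s t _ _ [e1 e2]; apply: contraNeq pq => st.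
  have st0 : s - t != 0 by rewrite subr_eq0.
  have h1 : (s - t) * (q.1 - p.1) = 0.
    have -> : (s - t) * (q.1 - p.1) = ((1 - s) * p.1 + s * q.1) - ((1 - t) * p.1 + t * q.1) by ring.
    by rewrite e1 subrr.
  have h2 : (s - t) * (q.2 - p.2) = 0.
    have -> : (s - t) * (q.2 - p.2) = ((1 - s) * p.2 + s * q.2) - ((1 - t) * p.2 + t * q.2) by ring.
    by rewrite e2 subrr.
  move/eqP: h1; move/eqP: h2; rewrite !mulf_eq0 (negbTE st0) /= !subr_eq0 => /eqP h2 /eqP h1.
  by rewrite [p]surjective_pairing [q]surjective_pairing h1 h2.
- by rewrite subr0 !mul1r !mul0r !addr0 -surjective_pairing.
- by rewrite subrr !mul1r !mul0r !add0r -surjective_pairing.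
- by [].
Qed.

Lemma proper_crossing_segments p q p' q' z s s' :
  0 < s < 1 -> 0 < s' < 1 ->
  z = ((1 - s) * p.1 + s * q.1, (1 - s) * p.2 + s * q.2) ->
  z = ((1 - s') * p'.1 + s' * q'.1, (1 - s') * p'.2 + s' * q'.2) ->
  (q.1 - p.1) * (q'.2 - p'.2) - (q.2 - p.2) * (q'.1 - p'.1) != 0 ->
  proper_crossing (segment p q) (segment p' q') z.
Proof.
move=> s01 s01' zE zE' det0.
pose dx := q.1 - p.1; pose dy := q.2 - p.2; pose dx' := q'.1 - p'.1; pose dy' := q'.2 - p'.2.
pose D := dx * dy' - dy * dx'; have D0 : D != 0 by [].
pose h (w : R * R) : R * R := ((dy' / D) * w.1 + (- dx' / D) * w.2 + (dx' * z.2 - dy' * z.1) / D,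
  (- dy / D) * w.1 + (dx / D) * w.2 + (dy * z.1 - dx * z.2) / D).
pose g (w : R * R) : R * R := (dx * w.1 + dx' * w.2 + z.1, dy * w.1 + dy' * w.2 + z.2).
(* In a square of this size around [z], in coordinates along the two segments, neither segment ends,
   so each coincides with its axis. *)
pose e := Num.min (Num.min s (1 - s)) (Num.min s' (1 - s')).
have e0 : 0 < e.
  by rewrite !lt_min; case/andP: s01 => -> ?; case/andP: s01' => -> ?; rewrite !subr_gt0 /=; apply/andP.
have [es es1 es' es1'] : [/\ e <= s, e <= 1 - s, e <= s' & e <= 1 - s'].
  by rewrite /e !ge_min !lexx !orbT.
pose W : set (R * R) := [set w | `|w.1| < e /\ `|w.2| < e].
have hg w : h (g w) = w.
  case: w => x y; rewrite /h /g /=; congr pair; rewrite /D; move: D0; rewrite /D => D0; field.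
    exact: D0.
  exact: D0.
have gh w : g (h w) = w.
  case: w => x y; rewrite /h /g /=; congr pair; rewrite /D; move: D0; rewrite /D => D0; field.
    exact: D0.
  exact: D0.
have hc : continuous h by apply: affine_map_continuous.
have gc : continuous g by apply: affine_map_continuous.
have Wo : open W.
  have -> : W = ball ((0, 0) : R * R) e.
    by apply/seteqP; split=> w [/= h1 h2]; split; move: h1 h2; rewrite /ball /= ?sub0r ?normrN.
  exact: ball_open.
exists (h @^-1` W), W, h, g; split; [|split].
- split=> //; first by apply: open_comp => // w _; exact: hc.
    rewrite /= /W /h /=.
    have -> : dy' / D * z.1 + - dx' / D * z.2 + (dx' * z.2 - dy' * z.1) / D = 0 by field.
    have -> : - dy / D * z.1 + dx / D * z.2 + (dy * z.1 - dx * z.2) / D = 0 by field.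
    by rewrite normr0.
  rewrite /h; congr pair; field; exact: D0.
- split.
  + apply/seteqP; split=> w; first by move=> [v vW <-].
    by move=> wW; exists (g w) => //=; rewrite /preimage /= hg.
  + by move=> w _; exact: gh.
  + exact: continuous_subspaceT.
  + exact: continuous_subspaceT.
- move=> w ww; have wg : w = g (h w) by rewrite gh.
  have [h1 h2] : `|(h w).1| < e /\ `|(h w).2| < e := ww.
  move: (h w) h1 h2 wg => [x y] /= h1 h2 wg; rewrite wg.
  move: h1 h2; rewrite !ltr_norml => /andP[x1 x2] /andP[y1 y2].
  have inj v v' : g v = g v' -> v = v' by move=> /(congr1 h); rewrite !hg.
  split; split.
  + move=> zs; have [t t01 E] := (segmentP _ _ _).1 zs.
    have : g (x, y) = g (t - s, 0).
      rewrite E /g /= {1 2}zE /= /dx /dy; congr pair; ring.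
    by move=> /inj E'; case: E' => _ ->.
  + move=> y0; apply: (segmentP _ _ _).2; exists (s + x); first by apply/andP; split; lra.
    by rewrite y0 /g /= {1 2}zE /= /dx /dy; congr pair; ring.
  + move=> zs; have [t t01 E] := (segmentP _ _ _).1 zs.
    have : g (x, y) = g (0, t - s').
      rewrite E /g /= {1 2}zE' /= /dx' /dy'; congr pair; ring.
    by move=> /inj E'; case: E' => -> _.
  + move=> x0; apply: (segmentP _ _ _).2; exists (s' + y); first by apply/andP; split; lra.
    by rewrite x0 /g /= {1 2}zE' /= /dx' /dy'; congr pair; ring.
Qed.

End Segments.

Lemma eq_set2 (V : finType) (u v u' v' : V) :
  ([set u; v] = [set u'; v'])%SET -> (u = u' /\ v = v') \/ (u = v' /\ v = u').
Proof.
move=> E; have: (u \in [set u'; v'])%SET by rewrite -E finset.set21.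
have: (v \in [set u'; v'])%SET by rewrite -E finset.set22.
have: (u' \in [set u; v])%SET by rewrite E finset.set21.
have: (v' \in [set u; v])%SET by rewrite E finset.set22.
by rewrite !finset.inE => /orP[]/eqP h1 /orP[]/eqP h2 /orP[]/eqP h3 /orP[]/eqP h4;
  (left; split; congruence) || (right; split; congruence).
Qed.

Section StraightDrawing.
Variables (R : realType) (V : finType) (pos : V -> R * R).

(** The ends are quantified, so that no orientation of an edge has to be chosen. *)
Definition straight : drawing R V := Drawing pos
  (fun e => [set z | exists u v, e = [set u; v]%SET /\ segment (pos u) (pos v) z]).

Lemma straight_edge u v : dcurve straight [set u; v]%SET = segment (pos u) (pos v).
Proof.
apply/seteqP; split=> z /=; last by exists u, v.
by move=> [u' [v' [/eq_set2[[<- <-]|[<- <-]]]]]; rewrite // segment_sym.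
Qed.

End StraightDrawing.

Section Parabola.
Local Open Scope ring_scope.
Variable R : realType.
Implicit Types (a b c d : R) (z : R * R).

Definition parabola a : R * R := (a, a ^+ 2).
Definition chord a b : set (R * R) := segment (parabola a) (parabola b).

Lemma parabola_inj : injective parabola.
Proof. by move=> a b []. Qed.

Lemma chord_line a b z : chord a b z -> z.2 = (a + b) * z.1 - a * b.
Proof. by move=> zs; have [t _ ->] := (segmentP _ _ _).1 zs; rewrite /=; ring. Qed.

Lemma chord_parabola a b c : chord a b (parabola c) -> c = a \/ c = b.
Proof.
move=> /chord_line /= E; have /eqP : (c - a) * (c - b) = 0.
  transitivity (c ^+ 2 - ((a + b) * c - a * b)); first by ring.
  by rewrite E subrr.
by rewrite mulf_eq0 !subr_eq0 => /orP[/eqP|/eqP]; auto.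
Qed.

Lemma chord_share a b c z : b != c -> chord a b z -> chord a c z -> z = parabola a.
Proof.
move=> bc /chord_line E /chord_line E'.
have : (b - c) * (z.1 - a) = 0.
  transitivity (((a + b) * z.1 - a * b) - ((a + c) * z.1 - a * c)); first by ring.
  by rewrite -E -E' subrr.
move/eqP; rewrite mulf_eq0 !subr_eq0 (negbTE bc) /= => /eqP z1.
by rewrite [z]surjective_pairing E z1; congr pair; ring.
Qed.

Lemma chord_slope a b c d z : chord a b z -> chord c d z -> a + b = c + d ->
  (c = a /\ d = b) \/ (c = b /\ d = a).
Proof.
move=> /chord_line E /chord_line E' s.
have p : a * b = c * d.
  have -> : a * b = (a + b) * z.1 - z.2 by rewrite E; ring.
  by rewrite E' s; ring.
have /eqP : (c - a) * (c - b) = 0.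
  transitivity (c ^+ 2 - (a + b) * c + a * b); first by ring.
  by rewrite s p; ring.
rewrite mulf_eq0 !subr_eq0 => /orP[/eqP ca|/eqP cb]; [left|right]; split=> //; lra.
Qed.

Lemma chord_unique a b c d z z' : a + b != c + d ->
  chord a b z -> chord c d z -> chord a b z' -> chord c d z' -> z = z'.
Proof.
move=> s /chord_line E1 /chord_line E2 /chord_line E3 /chord_line E4.
have : ((a + b) - (c + d)) * (z.1 - z'.1) = 0.
  transitivity ((((a + b) * z.1 - a * b) - ((c + d) * z.1 - c * d)) -
                (((a + b) * z'.1 - a * b) - ((c + d) * z'.1 - c * d))); first by ring.
  by rewrite -E1 -E2 -E3 -E4 !subrr.
move/eqP; rewrite mulf_eq0 !subr_eq0 (negbTE s) /= => /eqP z1.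
by rewrite [z]surjective_pairing [z']surjective_pairing E1 E3 z1.
Qed.

Lemma chord_interior a b z : chord a b z -> z != parabola a -> z != parabola b ->
  exists2 t, 0 < t < 1 & z = ((1 - t) * (parabola a).1 + t * (parabola b).1,
                              (1 - t) * (parabola a).2 + t * (parabola b).2).
Proof.
move=> zs za zb; have [t t01 E] := (segmentP _ _ _).1 zs; exists t => //.
case/andP: t01 => t0 t1; rewrite !lt_neqAle t0 t1 !andbT; apply/andP; split.
  apply: contraNneq za => t00; rewrite E -t00 /parabola /=.
  by apply/eqP; congr pair; ring.
apply: contraNneq zb => t00; rewrite E t00 /parabola /=.
by apply/eqP; congr pair; ring.
Qed.

Lemma chord_proper a b c d z : a != b -> c != d -> a + b != c + d ->
  chord a b z -> chord c d z -> (forall e, e \in [:: a; b; c; d] -> z != parabola e) ->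
  proper_crossing (chord a b) (chord c d) z.
Proof.
move=> ab cd s zab zcd zP.
have [za zb zc zd] : [/\ z != parabola a, z != parabola b, z != parabola c & z != parabola d].
  by split; apply: zP; rewrite !inE eqxx ?orbT.
have [t t01 E] := chord_interior zab za zb; have [t' t01' E'] := chord_interior zcd zc zd.
apply: (proper_crossing_segments t01 t01' E E').
rewrite /parabola /=.
have -> : (b - a) * (d ^+ 2 - c ^+ 2) - (b ^+ 2 - a ^+ 2) * (d - c) =
  (b - a) * (d - c) * ((c + d) - (a + b)) by ring.
by rewrite !mulf_neq0 // subr_eq0 eq_sym.
Qed.

Lemma chord_concurrent a a' b b' c c' z : chord a a' z -> chord b b' z -> chord c c' z ->
  concurrency a a' b b' c c' = 0.
Proof.
move=> /chord_line E1 /chord_line E2 /chord_line E3; rewrite /concurrency.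
have -> : a * a' = (a + a') * z.1 - z.2 by rewrite E1; ring.
have -> : b * b' = (b + b') * z.1 - z.2 by rewrite E2; ring.
have -> : c * c' = (c + c') * z.1 - z.2 by rewrite E3; ring.
ring.
Qed.

End Parabola.

Section Drawable.
Local Open Scope ring_scope.
Variables (R : realType) (V : finType) (adj : rel V).
Hypothesis adj_irr : irreflexive adj.

Lemma edgesP e : reflect (exists u v, adj u v /\ e = [set u; v]%SET) (e \in edges adj).
Proof.
rewrite finset.inE; apply: (iffP existsP) => [[u /existsP[v /andP[uv /eqP ->]]]|[u [v [uv ->]]]].
  by exists u, v.
by exists u; apply/existsP; exists v; rewrite uv eqxx.
Qed.

Lemma adj_neq u v : adj u v -> u != v.
Proof. by apply: contraTneq => ->; rewrite adj_irr. Qed.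

(** Makes [pcrP] applicable. On a parabola no edge passes through a third vertex and edges meet
    transversally; triple crossings are excluded by [generic]. *)
Lemma topological_drawing_exists : exists D : drawing R V, topological_drawing adj D.
Proof.
have [t [tinj tgen]] := generic_exists R #|V|.
pose T (v : V) := t (enum_rank v).
have Tinj : injective T.
  by move=> u v /(tinj _ _ (ltn_ord _) (ltn_ord _)) E; apply: enum_rank_inj; exact: val_inj.
have Tgen a a' b b' c c' : uniq [:: a; a'; b; b'; c; c'] ->
    concurrency (T a) (T a') (T b) (T b') (T c) (T c') != 0.
  move=> U; apply: tgen; first by rewrite /= !ltn_ord.
  by rewrite -(map_inj_uniq (inj_comp val_inj enum_rank_inj)) in U.
exists (straight (fun v => parabola (T v))).
have edge u v z : dcurve (straight (fun v => parabola (T v))) [set u; v]%SET z -> chord (T u) (T v) z.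
  by rewrite straight_edge.
have share a b c z : b != c -> chord (T a) (T b) z -> chord (T a) (T c) z -> z = parabola (T a).
  by move=> bc; apply: chord_share; rewrite (inj_eq Tinj).
have slope a b c d z : chord (T a) (T b) z -> chord (T c) (T d) z ->
    ([set a; b] != [set c; d])%SET -> T a + T b != T c + T d.
  move=> h h'; apply: contra => /eqP s.
  have [[/Tinj -> /Tinj ->]|[/Tinj -> /Tinj ->]] := chord_slope h h' s; rewrite ?eqxx //.
  by rewrite finset.setUC.
(* Distinct chords with a common end meet only there. So three chords through a point off the
   vertices have six different ends, as [generic] requires. *)
have apart a b c d z : ~ range (fun v => parabola (T v)) z ->
    chord (T a) (T b) z -> chord (T c) (T d) z -> ([set a; b] != [set c; d])%SET ->
    [&& a != c, a != d, b != c & b != d].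
  have sep u v w x : ~ range (fun v => parabola (T v)) z ->
      chord (T u) (T v) z -> chord (T w) (T x) z -> ([set u; v] != [set w; x])%SET -> u != w.
    move=> zr h h' ne; apply/eqP => uw; rewrite -uw in h' ne; apply: zr; exists u => //.
    by apply: esym; apply: share h h'; apply: contra ne => /eqP ->.
  have symC u v : chord (T u) (T v) z -> chord (T v) (T u) z by rewrite /chord segment_sym.
  move=> zr h h' ne; apply/and4P; split.
  + exact: sep zr h h' ne.
  + by apply: (sep _ _ _ _ zr h (symC _ _ h')); rewrite (finset.setUC [set d]%SET).
  + by apply: (sep _ _ _ _ zr (symC _ _ h) h'); rewrite finset.setUC.
  + by apply: (sep _ _ _ _ zr (symC _ _ h) (symC _ _ h')); rewrite finset.setUC (finset.setUC [set d]%SET).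
split; split.
- by move=> u v /parabola_inj/Tinj.
- move=> u v uv; rewrite straight_edge; apply: simple_curve_segment.
  by rewrite (inj_eq (@parabola_inj R)) (inj_eq Tinj) adj_neq.
- move=> u v w _ /edge/chord_parabola[/Tinj ->|/Tinj ->]; by rewrite !finset.inE eqxx ?orbT.
- move=> _ _ /edgesP[u [v [uv ->]]] /edgesP[u' [v' [uv' ->]]] ne.
  have [->|/set0P[z [h h']]] := eqVneq (dcurve (straight (fun v => parabola (T v))) [set u; v]%SET `&`
    dcurve (straight (fun v => parabola (T v))) [set u'; v']%SET) set0; first exact: finite_set0.
  apply: (@sub_finite_set _ _ [set z]); last exact: finite_set1.
  move=> z' [g g']; apply: esym.
  exact: (chord_unique (slope _ _ _ _ _ (edge _ _ _ h) (edge _ _ _ h') ne) (edge _ _ _ h) (edge _ _ _ h')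
    (edge _ _ _ g) (edge _ _ _ g')).
- move=> _ _ z /edgesP[u [v [uv ->]]] /edgesP[u' [v' [uv' ->]]] ne /edge h /edge h' zr.
  rewrite !straight_edge; apply: (chord_proper _ _ (slope _ _ _ _ _ h h' ne) h h').
  + by rewrite (inj_eq Tinj) adj_neq.
  + by rewrite (inj_eq Tinj) adj_neq.
  + move=> e; rewrite !inE => /or4P[]/eqP->; apply/eqP => ze; apply: zr; rewrite ze;
      [by exists u|by exists v|by exists u'|by exists v'].
- move=> _ _ _ z /edgesP[a [a' [aa ->]]] /edgesP[b [b' [bb ->]]] /edgesP[c [c' [cc ->]]].
  rewrite /= !inE negb_or andbT => /andP[/andP[ab ac] bc] /edge h1 /edge h2 /edge h3.
  apply: contrapT => zr.
  have d12 := apart _ _ _ _ _ zr h1 h2 ab; have d13 := apart _ _ _ _ _ zr h1 h3 ac.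
  have d23 := apart _ _ _ _ _ zr h2 h3 bc.
  have /eqP := chord_concurrent h1 h2 h3; apply/negP; apply: Tgen.
  rewrite /= !inE !negb_or (adj_neq aa) (adj_neq bb) (adj_neq cc); case/and4P: d12 => -> -> -> ->.
  by case/and4P: d13 => -> -> -> ->; case/and4P: d23 => -> -> -> ->.
Qed.

End Drawable.

(** * Touching pairs and separators in a topological drawing *)

Section DrawingSeparator.
Variables (R : realType) (V : finType) (adj : rel V) (D : drawing R V).
Hypothesis adj_sym : symmetric adj.
Hypothesis topD : topological_drawing adj D.
Implicit Types (e f : {set V}) (A S K : {set {set V}}).

Local Notation E := (edges adj).

(** The disjunct [e == f] gives reflexivity also for sets that are not edges, whose curve may be
    empty. *)
Definition curves_meet e f : bool := (e == f) || `[< dcurve D e `&` dcurve D f !=set0 >].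

Lemma curves_meet_refl : reflexive curves_meet.
Proof. by move=> e; rewrite /curves_meet eqxx. Qed.

Lemma curves_meet_sym : symmetric curves_meet.
Proof. by move=> e f; rewrite /curves_meet eq_sym setIC. Qed.

Let edge_curve e : e \in E ->
  [/\ compact (dcurve D e), connected (dcurve D e) & forall v, v \in e -> dcurve D e (dpos D v)].
Proof.
move=> /edgesP[u [v [uv ->]]]; have [[_ sc _] _] := topD.
have [g [gc _ g0 g1 ->]] := sc u v uv; split.
- by apply: continuous_compact => //; exact: segment_compact.
- by apply: connected_continuous_connected => //; exact: segment_connected.
- move=> w; rewrite !finset.inE => /orP[]/eqP->.
    by exists 0%R => //=; rewrite in_itv /= lexx ler01.
  by exists 1%R => //=; rewrite in_itv /= lexx ler01.
Qed.

Lemma edge_neq0 e : e \in E -> exists v, v \in e.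
Proof. by move=> /edgesP[u [v [_ ->]]]; exists u; rewrite !finset.inE eqxx. Qed.

Lemma share_curves_meet e f v : e \in E -> f \in E -> v \in e -> v \in f -> curves_meet e f.
Proof.
move=> eE fE ve vf; apply/orP; right; apply/asboolP; exists (dpos D v).
by have [_ _ he] := edge_curve eE; have [_ _ hf] := edge_curve fE; split; auto.
Qed.

(** Only the curves of [A] become lattice strings, so that the number of strings touched is
    [touch_deg curves_meet A]; the rest is transport along the subtype [X]. *)
Lemma drawing_separator A s : A \subset E -> touch_pairs curves_meet A <= s ^ 2 ->
  exists S, [/\ S \subset A, #|S| <= 25252 * s & forall K, K \subset (A :\: S)%SET ->
    (forall e f, e \in K -> f \in K -> linked curves_meet K e f) ->
    3 * \sum_(e in K) touch_deg curves_meet A e <= 2 * touch_pairs curves_meet A].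
Proof.
move=> AE Ms; pose X : finType := {e : {set V} | e \in A}.
pose B (x : X) := dcurve D (val x).
have valE (x : X) : val x \in E by apply: (fintype.subsetP AE); apply: valP.
have B0 x : B x !=set0.
  have [v ve] := edge_neq0 (valE x); have [_ _ h] := edge_curve (valE x).
  by exists (dpos D v); apply: h.
have [C [C0 Cconn CB]] : exists C : X -> set (int * int), [/\ forall x, C x !=set0,
    forall x z u, C x z -> C x u -> conn lat_adj (C x) z u &
    forall x y, C x `&` C y !=set0 <-> B x `&` B y !=set0].
  apply: discretize => // x; by have [] := edge_curve (valE x).
have /choice[rep Crep] x : exists z, C x z by have [z ?] := C0 x; exists z.
have meetsE x y : meets C x y = curves_meet (val x) (val y).
  apply/idP/idP => [/asboolP /CB h|]; first by apply/orP; right; apply/asboolP.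
  move=> /orP[/eqP/val_inj <-|/asboolP/CB h]; last exact/asboolP.
  by apply/asboolP; have [z ?] := C0 x; exists z.
have imE (F : {set {set V}}) : F \subset A -> F = [set val x | x in [set x : X | val x \in F]]%SET.
  move=> FA; apply/finset.setP => e; apply/idP/imsetP => [eF|[x + ->]]; last by rewrite finset.inE.
  by exists (Sub e (fintype.subsetP FA _ eF)); rewrite ?finset.inE SubK.
have degE x : touches (meets C) x = touch_deg curves_meet A (val x).
  rewrite /touch_deg (imE [set f in A | curves_meet (val x) f]%SET); last by apply/fintype.subsetP => e; rewrite finset.inE => /andP[].
  rewrite card_imset; last exact: val_inj.
  by apply: eq_card => y; rewrite !finset.inE meetsE (valP y).
have sumE (F : {set {set V}}) : F \subset A ->
    \sum_(e in F) touch_deg curves_meet A e =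
    \sum_(x in [set x : X | val x \in F]%SET) touches (meets C) x.
  move=> FA; rewrite {1}(imE _ FA) big_imset /=; last by move=> x y _ _; apply: val_inj.
  by apply: eq_bigr => x _; rewrite degE.
have Mmu : \sum_(x in [set: X]%SET) touches (meets C) x = touch_pairs curves_meet A.
  by rewrite /touch_pairs sumE //; apply: eq_bigl => x; rewrite !finset.inE (valP x).
have [S cS hS] := string_separator lat_adj_sym lattice_K33_free (0%R, 0%R) Crep Cconn Mmu Ms.
exists [set val x | x in S]%SET; split.
- by apply/fintype.subsetP => e /imsetP[x _ ->]; apply: valP.
- exact: leq_trans (leq_imset_card _ _) cS.
move=> K KA Kc; have KA' : K \subset A by apply: fintype.subset_trans KA (finset.subsetDl _ _).
rewrite sumE //; apply: hS.
  apply/fintype.subsetP => x; rewrite !finset.inE => /(fintype.subsetP KA).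
  rewrite finset.inE => /andP[+ _]; apply: contra => xS; exact: imset_f.
have lift e f : linked curves_meet K e f -> forall x y : X, val x = e -> val y = f ->
    linked (meets C) [set x : X | val x \in K]%SET x y.
  elim=> [{}e eK x y xe yf|{}e f' {}f h IH ff' fK x y xe yf].
    have -> : y = x by apply: val_inj; rewrite xe yf.
    by apply: conn_refl; rewrite /= finset.inE xe.
  have f'K : f' \in K := conn_memr h.
  apply: (conn_step (IH x (Sub f' (fintype.subsetP KA' _ f'K)) xe (SubK _ _))).
    by rewrite meetsE SubK yf.
  by rewrite /= finset.inE yf.
move=> x y; rewrite !finset.inE => xK yK; exact: (lift _ _ (Kc _ _ xK yK)).
Qed.

Lemma card_incident w : #|[set e in E | w \in e]%SET| <= degree adj w.
Proof.
apply: leq_trans (leq_imset_card (fun x => [set w; x]%SET) _).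
apply/subset_leq_card/fintype.subsetP => e; rewrite finset.inE => /andP[/edgesP[u [v [uv ->]]]].
rewrite finset.inE => /orP[]; rewrite finset.inE => /eqP->.
  by apply/imsetP; exists v; rewrite ?finset.inE.
by apply/imsetP; exists u; rewrite ?finset.inE 1?adj_sym // finset.setUC.
Qed.

Let share e f : nat := \sum_w (w \in e) * (w \in f).

Let proper_meet e f : bool := (e != f) && `[< edges_cross D e f >].

(** A common point is either a vertex, and then an end of both edges because curves avoid other
    vertices, or a crossing. *)
Let meet_split e f : e \in E -> f \in E -> curves_meet e f <= share e f + proper_meet e f.
Proof.
move=> eE fE; have shareP w : w \in e -> w \in f -> 0 < share e f.
  by move=> we wf; rewrite /share (bigD1 w) //= we wf.
have [ef|ef] := eqVneq e f.
  have [w we] := edge_neq0 eE; have := shareP w we; rewrite -ef => /(_ we).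
  by case: (curves_meet _ _) => // h; apply: leq_trans h (leq_addr _ _).
rewrite /curves_meet (negbTE ef) /=; case: asboolP => // -[z [ze zf]].
have [[w _ wz]|nz] := pselect (range (dpos D) z); last first.
  have -> : proper_meet e f = true by rewrite /proper_meet ef; apply/asboolP; exists z.
  by rewrite leq_addl.
have [[_ _ vx] _] := topD.
have h k : k \in E -> dcurve D k z -> w \in k.
  by move=> /edgesP[u [v [uv ->]]]; rewrite -wz; apply: vx.
by apply: leq_trans (shareP w (h e eE ze) (h f fE zf)) (leq_addr _ _).
Qed.

Let sum_share : \sum_(e in E) \sum_(f in E) share e f <= \sum_v degree adj v ^ 2.
Proof.
have -> : \sum_(e in E) \sum_(f in E) share e f =
    \sum_w (\sum_(e in E) (w \in e)) * (\sum_(f in E) (w \in f)).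
  rewrite /share; under eq_bigr => e _ do rewrite exchange_big.
  rewrite exchange_big; apply: eq_bigr => w _ /=; rewrite big_distrl; apply: eq_bigr => e _ /=.
  by rewrite big_distrr.
apply: leq_sum => w _; rewrite -mulnn.
have -> : \sum_(e in E) (w \in e) = #|[set e in E | w \in e]%SET|.
  rewrite -sum1_card [LHS]big_mkcond [RHS]big_mkcond; apply: eq_bigr => e _.
  by rewrite finset.inE; case: (e \in E); case: (w \in e).
by rewrite leq_mul // card_incident.
Qed.

Let sum_proper_meet : \sum_(e in E) \sum_(f in E) proper_meet e f <= 2 * pair_crossings adj D.
Proof.
rewrite pair_big_dep /=.
pose W := [set p : {set V} * {set V} | [&& p.1 \in E, p.2 \in E & proper_meet p.1 p.2]]%SET.
have -> : \sum_(p | (p.1 \in E) && (p.2 \in E)) proper_meet p.1 p.2 = \sum_(p in W) 1.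
  rewrite [LHS]big_mkcond [RHS]big_mkcond; apply: eq_bigr => p _.
  by rewrite [p \in W]finset.in_set; do 2 case: (_ \in E); case: (proper_meet _ _).
rewrite (partition_big (fun p => [set p.1; p.2]%SET) (mem (crossing_pairs adj D))) /=; last first.
  move=> [e f]; rewrite finset.inE /= => /and3P[eE fE /andP[ef /asboolP cr]].
  by rewrite finset.inE; apply/asboolP; exists e, f.
rewrite mulnC /pair_crossings -sum_nat_const; apply: leq_sum => P.
rewrite finset.inE => /asboolP[e [f [_ _ _ -> _]]].
rewrite sum1_card; apply: (@leq_trans #|[set (e, f); (f, e)]%SET|); last first.
  by rewrite finset.cards2; case: eqP.
apply/subset_leq_card/fintype.subsetP => -[e' f'] h.
have /andP[_ /eqP/eq_set2] : ((e', f') \in W) && ([set e'; f'] == [set e; f])%SET := h.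
by rewrite !finset.inE => -[[-> ->]|[-> ->]]; rewrite eqxx ?orbT.
Qed.

Lemma touch_pairs_drawing :
  touch_pairs curves_meet E <= 2 * pair_crossings adj D + \sum_v degree adj v ^ 2.
Proof.
rewrite addnC; apply: leq_trans (leq_add sum_share sum_proper_meet).
rewrite -big_split; apply: leq_sum => e eE; rewrite -big_split /=.
apply: (@leq_trans (\sum_(f in E) curves_meet e f)); last by apply: leq_sum => f; apply: meet_split.
rewrite /touch_deg -sum1_card big_mkcond [leqRHS]big_mkcond; apply: leq_sum => f _ /=.
by rewrite finset.inE; case: (f \in E); case: (curves_meet _ _).
Qed.

End DrawingSeparator.

(** * Constants and the final bound *)

Lemma card_edges (V : finType) (adj : rel V) : #|edges adj| <= #|V| ^ 2.
Proof.
rewrite -mulnn -card_prod; apply: leq_trans (leq_imset_card (fun p : V * V => [set p.1; p.2]%SET) _).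
apply/subset_leq_card/fintype.subsetP => _ /edgesP[u [v [_ ->]]].
by apply/imsetP; exists (u, v).
Qed.

(** For the depth [h = 2 * (trunc_log 2 n).+1]: the at most [n ^ 4] touching pairs are used up, and
    since [h <= 4 * trunc_log 2 n] the loss of points stays polynomial. *)
Lemma trunc_log2_expn n k : 2 <= n -> n ^ 4 < 5 ^ (2 * (trunc_log 2 n).+1) /\
  (2 ^ k) ^ (2 * (trunc_log 2 n).+1) <= n ^ (4 * k).
Proof.
move=> n2; have L1 : 0 < trunc_log 2 n by rewrite trunc_log_gt0; lia.
split.
  apply: (@leq_trans ((2 ^ (trunc_log 2 n).+1) ^ 4)); first by rewrite ltn_exp2r ?trunc_log_ltn.
  have -> : (2 ^ (trunc_log 2 n).+1) ^ 4 = 4 ^ (2 * (trunc_log 2 n).+1).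
    transitivity ((2 ^ 2) ^ (2 * (trunc_log 2 n).+1)); last by [].
    by rewrite -!expnM; congr expn; rewrite mulnA mulnC.
  by rewrite leq_exp2r.
apply: (@leq_trans ((2 ^ trunc_log 2 n) ^ (4 * k))); last first.
  by case: k => [|k]; rewrite // leq_exp2r ?trunc_logP //; lia.
by rewrite -!expnM leq_exp2l //; nia.
Qed.

Lemma straight_pair_crossings (R : realType) (V I : finType) (adj : rel V)
    (pt : I -> R * R) (pos : V -> I) :
  pair_crossings adj (straight (fun v => pt (pos v))) <=
    \sum_(e in edges adj) \sum_(f in edges adj) cross pt pos e f.
Proof.
rewrite pair_big_dep /=.
pose W := [set p : {set V} * {set V} | [&& p.1 \in edges adj, p.2 \in edges adj &
  cross pt pos p.1 p.2]]%SET.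
apply: (@leq_trans #|W|); last first.
  rewrite -sum1_card [leqLHS]big_mkcond [leqRHS]big_mkcond; apply: leq_sum => p _.
  by rewrite [p \in W]finset.in_set; do 2 case: (_ \in edges adj); case: (cross _ _ _ _).
apply: leq_trans (leq_imset_card (fun p => [set p.1; p.2]%SET) _).
apply/subset_leq_card/fintype.subsetP => P; rewrite finset.inE => /asboolP[e [f [eE fE _ -> [z [ze zf _]]]]].
apply/imsetP; exists (e, f) => //; rewrite finset.in_set eE fE; apply/asboolP; exists z.
have on g : dcurve (straight (fun v => pt (pos v))) g z -> on_edge pt pos g z.
  move=> [u [v [-> /segmentP[t t01 ->]]]].
  by exists u, v, t; rewrite !finset.inE !eqxx orbT.
by split; apply: on.
Qed.

Lemma good_straight_drawing : exists k c : nat, forall (R : realType) (V : finType) (adj : rel V),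
  symmetric adj -> irreflexive adj -> 2 <= #|V| ->
  forall (S : set (R * R)) (F : {fset R * R}),
  general_position S -> [set` F] `<=` S -> #|V| ^ k <= #|` F| ->
  exists D : drawing R V, straight_drawing_on adj S D /\
    pair_crossings adj D <=
      c * trunc_log 2 #|V| * (pcr R adj + \sum_v degree adj v ^ 2).
Proof.
(* 3 ^ (16 ^ 3) must stay abstract: it is far too large to be evaluated. *)
have lay R I pt i0 pti gp V tch E c tr ts ep st sep h A :=
  @layout R I pt i0 pti gp V tch E c tr ts ep st sep h A [set: V]%SET [set: I]%SET.
move: (cluster_factor 16) lay => K lay.
(* [layout] asks for [#|V| * K ^ h] points, and [K ^ h <= (2 ^ K) ^ h <= #|V| ^ (4 * K)]. The 8 is 4
   from [h <= 4 * trunc_log 2 #|V|] times 2 from [touch_pairs_drawing]. *)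
pose c := 25252; exists (1 + 4 * K), (180 * 180 * c ^ 2 * 8).
have cE : c = 25252 by []; move: (c) cE => {}c cE.
move=> R V adj adj_sym adj_irr n2 S F gp FS nF.
have [D0 topD0] := topological_drawing_exists R adj_irr.
have [[D topD <-] _] := pcrP topD0.
pose pt (i : F) : R * R := val i.
have pt_inj : injective pt := val_inj.
have gpt (i j k : F) l : uniq [:: i; j; k] -> is_line l ->
    ~ (affine l (pt i) = 0 /\ affine l (pt j) = 0 /\ affine l (pt k) = 0)%R.
  move=> U ln [h1 [h2 h3]].
  have FSi (x : F) : S (pt x) by apply: FS; exact: (valP x).
  apply: (gp _ _ _ (FSi i) (FSi j) (FSi k)); first by have := U; rewrite -(map_inj_uniq pt_inj).
  exists l.1.1, l.1.2, (- l.2)%R; split; first by rewrite -surjective_pairing.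
  by move=> z; rewrite !inE => /or3P[]/eqP->; apply/eqP; rewrite -subr_eq0 opprK; apply/eqP.
have [i0 _] : exists i : F, true.
  have : 0 < #|{: F}| by rewrite -cardfE; apply: leq_trans nF; rewrite expn_gt0; lia.
  by move=> /card_gt0P[i _]; exists i.
pose h := 2 * (trunc_log 2 #|V|).+1.
have [h5 hK] := trunc_log2_expn K n2.
have ME : touch_pairs (curves_meet D) (edges adj) < 5 ^ h.
  apply: leq_ltn_trans h5; rewrite (expnM _ 2 2); apply: (@leq_trans (#|edges adj| * #|edges adj|)).
    by rewrite -sum_nat_const; apply: leq_sum => e _; apply/subset_leq_card/fintype.subsetP => f; rewrite finset.inE => /andP[].
  by rewrite mulnn leq_exp2r // card_edges.
have [||||||pos [pos_inj _ _ crb]] := lay R F pt i0 pt_inj gpt V (curves_meet D) (edges adj) c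
  (@curves_meet_refl _ _ D) (@curves_meet_sym _ _ D) _ _ _ h (edges adj) _ _ ME.
- by move=> e /edgesP[u [v [uv ->]]]; exists u, v; rewrite (adj_neq adj_irr uv).
- exact: share_curves_meet topD.
- by rewrite cE; exact: drawing_separator topD.
- exact: fintype.subxx.
- by move=> e _; apply: finset.subsetT.
- rewrite !finset.cardsT -cardfE; apply: leq_trans nF; rewrite expnD expn1 leq_mul2l; apply/orP; right.
  apply: leq_trans hK; rewrite leq_exp2r; last by rewrite /h.
  exact/ltnW/ltn_expl.
exists (straight (fun v => pt (pos v))); split.
  split=> [u v /pt_inj/pos_inj|v|u v _]; last exact: straight_edge.
    by apply; rewrite finset.inE.
  by apply: FS; exact: (valP (pos v)).
apply: leq_trans (straight_pair_crossings adj pt pos) _; apply: leq_trans crb _.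
have Mb := touch_pairs_drawing adj_sym topD.
have L1 : 0 < trunc_log 2 #|V| by rewrite trunc_log_gt0; lia.
apply: (@leq_trans (180 * 180 * c ^ 2 * (4 * trunc_log 2 #|V|) *
    (2 * (pair_crossings adj D + \sum_v degree adj v ^ 2)))).
  apply: leq_mul; last by rewrite mulnDr; apply: leq_trans Mb _; rewrite leq_add2l leq_pmull.
  by rewrite leq_mul2l; apply/orP; right; rewrite /h; lia.
by apply: eq_leq; rewrite -!mulnA; congr muln; congr muln; congr muln; lia.
Qed.

Local Open Scope ring_scope.

Lemma trunc_log_le_log2 (R : realType) n : (0 < n)%N -> (trunc_log 2 n)%:R <= log2 (n%:R : R).
Proof.
move=> n0; have l2 : 0 < ln 2 :> R by rewrite ln_gt0 // ltr1n.
rewrite /log2 ler_pdivlMr // mulr_natl -lnXn // ler_ln ?posrE ?exprn_gt0 ?ltr0n //.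
by rewrite -natrX ler_nat trunc_logP.
Qed.

Theorem theorem6 (R : realType) :
  exists C c : R, 1 <= C /\ 0 < c /\
  forall (V : finType) (adj : rel V),
    symmetric adj -> irreflexive adj -> (2 <= #|V|)%N ->
  forall S : set (R * R),
    general_position S -> at_least_points (#|V|%:R `^ C) S ->
  exists D : drawing R V,
    straight_drawing_on adj S D /\
    (pair_crossings adj D)%:R <=
      c * log2 #|V|%:R *
      ((pcr R adj)%:R + \sum_(v : V) (degree adj v)%:R ^+ 2).
Proof.
have [k [c main]] := good_straight_drawing.
exists k.+1%:R, c.+1%:R; split; first by rewrite ler1n.
split; first by rewrite ltr0n.
move=> V adj adj_sym adj_irr n2 S gp [F FS].
rewrite powR_mulrn ?ler0n // -natrX ler_nat => nF.
have [|D [Dstr Dcr]] := main R V adj adj_sym adj_irr n2 S F gp FS.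
  by apply: leq_trans nF; rewrite leq_exp2l.
exists D; split=> //.
have -> : (pcr R adj)%:R + \sum_(v : V) (degree adj v)%:R ^+ 2 =
    (pcr R adj + \sum_v degree adj v ^ 2)%N%:R :> R.
  by rewrite natrD natr_sum; congr (_ + _); apply: eq_bigr => v _; rewrite natrX.
apply: (@le_trans _ _ (c * trunc_log 2 #|V| * (pcr R adj + \sum_v degree adj v ^ 2))%N%:R).
  by rewrite ler_nat.
rewrite natrM ler_wpM2r ?ler0n // natrM ler_pM ?ler0n // ?ler_nat //.
by apply: trunc_log_le_log2; apply: ltnW.
Qed.
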